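(* Let $-A$ be the generator of a bounded $C_0$-semigroup $(e^{-tA})_{t\ge 0}$ on a complex Banach space $X$. Suppose that $\overline{\mathrm{ran}}(A)=X$ and that $\sigma(A)\cap i\mathbb R$ has an accumulation point at infinity (i.e. is unbounded). Let $f\in\tilde{\mathcal S}_2$ and suppose in addition that $$\lim_{\tau\to\infty}\tau^2f(\tau)=\infty .$$ Then, whenever $\epsilon:(0,\infty)\to(0,\infty)$ is a decreasing function with $\lim_{\tau\to\infty}\epsilon(\tau)=0$, there exists $y\in\mathrm{ran}(f(A))$ such that $$\limsup_{\sqrt n/t\to\infty}\frac{\|\Delta_{n,t}(A)y\|}{\epsilon(\sqrt n/t)\,f(\sqrt n/t)}=\infty .$$
   Context: $\mathbb C_+=\{z\in\mathbb C:\mathrm{Re}\,z>0\}$, $\mathbb R_+=[0,\infty)$; $\sigma(A)$ is the spectrum of $A$; $\mathrm{dom}$ and $\mathrm{ran}$ denote domain and range, and $\overline{\mathrm{ran}}(A)$ is the norm-closure of the range. For $n\in\mathbb N$, $t>0$: $\Delta_{n,t}(A):=\left(1+\frac tn A\right)^{-n}-e^{-tA}$. For a quantity $F(n,t)$, $\limsup_{\sqrt n/t\to\infty}F(n,t)$ means $\lim_{R\to\infty}\sup\{F(n,t): n\in\mathbb N,\ t>0,\ \sqrt n/t\ge R\}$. Stieltjes functions: a function $f:(0,\infty)\to[0,\infty)$ belongs to $\mathcal S$ if $f(z)=a+\int_0^\infty\frac{\mu(d\tau)}{z+\tau}$ for $z>0$, where $a\ge 0$ and $\mu$ is a positive Radon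 measure on $[0,\infty)$ with $\int_0^\infty\frac{\mu(d\tau)}{1+\tau}<\infty$; $f$ is identified with its unique analytic extension to $\mathbb C\setminus(-\infty,0]$. Further, $\tilde{\mathcal S}_2:=\{f_1\cdot f_2: f_1,f_2\in\mathcal S\}$. Functional calculus: $M(\mathbb R_+)$ is the Banach algebra of bounded (complex) Radon measures on $\mathbb R_+$, $(\mathcal L\mu)(z)=\int_0^\infty e^{-sz}\mu(ds)$ for $z\in\mathbb C_+$, and $A^1_+(\mathbb C_+)=\{\mathcal L\mu:\mu\in M(\mathbb R_+)\}$. For $g=\mathcal L\mu\in A^1_+(\mathbb C_+)$, $g(A)x:=\int_0^\infty e^{-sA}x\,\mu(ds)$ for $x\in X$. If $f:\mathbb C_+\to\mathbb C$ is holomorphic and there is $e\in A^1_+(\mathbb C_+)$ (a regularizer) with $ef\in A^1_+(\mathbb C_+)$ and $e(A)$ injective, then $f(A):=e(A)^{-1}(ef)(A)$ with $\mathrm{dom}(f(A))=\{x\in X:(ef)(A)x\in\mathrm{ran}(e(A))\}$; this does not depend on the choice of $e$ (extended Hille–Phillips calculus). For $\overline{\mathrm{ran}}(A)=X$ every $f\in\tilde{\mathcal S}_2$ is regularizable by $e(z)=z^2/(1+z)^2$. *)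

(* Defs.v *)
From HB Require Import structures.
From mathcomp Require Import all_boot all_order all_algebra.
From mathcomp Require Import all_classical all_reals all_analysis.
From mathcomp Require Import complex.

Set Implicit Arguments.
Unset Strict Implicit.
Unset Printing Implicit Defensive.

Import Order.TTheory GRing.Theory Num.Theory.
Import numFieldNormedType.Exports.

Local Open Scope classical_set_scope.
Local Open Scope complex_scope.
Local Open Scope ring_scope.

Section ComplexNumbers.
Variable R : realType.

(* The norm of a normed space over R[i] takes its values in R[i]; this is the
   same norm as a real number. *)
Definition rnorm (X : normedModType R[i]) (x : X) : R := complex.Re `|x|.

Definition cexp (z : R[i]) : R[i] :=
  (expR (complex.Re z))%:C * (cos (complex.Im z) +i* sin (complex.Im z)).

Definition right_half_plane : set R[i] := [set z | 0 < complex.Re z].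

(* C \ (-oo, 0] *)
Definition slit_plane : set R[i] :=
  [set z | ~ (complex.Im z = 0 /\ complex.Re z <= 0)].

(* Complex differentiability at each point of the open set U. *)
Definition holomorphic_on (U : set R[i]) (F : R[i] -> R[i]) : Prop :=
  forall z, U z -> derivable (F : R[i]^o -> R[i]^o) z 1.

End ComplexNumbers.

(* A (possibly unbounded, not everywhere defined) operator in X is represented
   by its graph: (x, y) is in A iff x is in dom(A) and A x = y. *)
Section Operators.
Variables (R : realType) (X : completeNormedModType R[i]).
Implicit Types A B : set (X * X).

Definition op_graph (B : X -> X) : set (X * X) := [set p | p.2 = B p.1].
Definition op_id : set (X * X) := op_graph id.
Definition op_scale (c : R[i]) A : set (X * X) :=
  [set p | exists2 y, A (p.1, y) & p.2 = c *: y].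
Definition op_add A B : set (X * X) :=
  [set p | exists y z, [/\ A (p.1, y), B (p.1, z) & p.2 = y + z]].
Definition op_comp A B : set (X * X) :=
  [set p | exists2 y, B (p.1, y) & A (y, p.2)].
Definition op_pow A (n : nat) : set (X * X) := iter n (op_comp A) op_id.
Definition op_inv A : set (X * X) := [set p | A (p.2, p.1)].
Definition op_ran A : set X := [set y | exists x, A (x, y)].
(* The value A x; it is 0 by convention when x is not in dom(A). *)
Definition op_app A (x : X) : X := xget 0 [set y | A (x, y)].

(* lambda is in the resolvent set iff lambda - A has an inverse which is a
   bounded linear operator on the whole of X. *)
Definition resolvent_set A : set R[i] :=
  [set lambda | exists B : {linear X -> X}, continuous B /\
     op_inv (op_add (op_scale lambda op_id) (op_scale (-1) A)) = op_graph B].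
Definition spectrum A : set R[i] := ~` resolvent_set A.

End Operators.
Arguments op_id {R X}.

Section Semigroups.
Variables (R : realType) (X : completeNormedModType R[i]).

(* Only the values T t with t >= 0 are relevant. *)
Record C0_semigroup (T : R -> {linear X -> X}) : Prop := {
  C0_bounded_op : forall t, 0 <= t -> continuous (T t);
  C0_zero : forall x, T 0 x = x;
  C0_add : forall s t x, 0 <= s -> 0 <= t -> T (s + t) x = T s (T t x);
  C0_cvg : forall x, T t x @[t --> 0^'+] --> x }.

Definition bounded_semigroup (T : R -> {linear X -> X}) : Prop :=
  exists M : R, forall t x, 0 <= t -> rnorm (T t x) <= M * rnorm x.

Definition generator (T : R -> {linear X -> X}) : set (X * X) :=
  [set p | (h^-1)%:C *: (T h p.1 - p.1) @[h --> 0^'+] --> p.2].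

(* Here T is the semigroup exp(- t A). *)
Definition Delta (T : R -> {linear X -> X}) (A : set (X * X))
    (n : nat) (t : R) (x : X) : X :=
  op_app (op_pow (op_inv (op_add op_id (op_scale (t / n%:R)%:C A))) n) x
  - T t x.

End Semigroups.

Section Measures.
Variable R : realType.
Local Notation borelR := (measurableTypeR R).

Definition halfline : set borelR := `[0, +oo[%classic.

(* A bounded complex Borel measure on [0, +oo[, given as
   (cm1 - cm2) + i (cm3 - cm4) with finite positive measures, which are only
   ever integrated over [0, +oo[. Finite Borel measures on [0, +oo[ are Radon,
   and every complex measure has such a (Jordan) decomposition. *)
Record cmeasure := CMeasure {
  cm1 : {finite_measure set borelR -> \bar R};
  cm2 : {finite_measure set borelR -> \bar R};
  cm3 : {finite_measure set borelR -> \bar R};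
  cm4 : {finite_measure set borelR -> \bar R} }.

(* Extends an integral from finite positive measures to complex ones. *)
Definition cm_int (V : lmodType R[i])
    (I : {finite_measure set borelR -> \bar R} -> V) (mu : cmeasure) : V :=
  (I (cm1 mu) - I (cm2 mu)) + (0 +i* 1) *: (I (cm3 mu) - I (cm4 mu)).

Definition scalar_int (g : R -> R[i])
    (m : {finite_measure set borelR -> \bar R}) : R[i] :=
  (\int[m]_(s in halfline) complex.Re (g s))
  +i* (\int[m]_(s in halfline) complex.Im (g s)).

Definition laplace (mu : cmeasure) (z : R[i]) : R[i] :=
  cm_int (scalar_int (fun s => cexp (- (s%:C * z))) : _ -> R[i]^o) mu.

Section Bochner.
Variable X : completeNormedModType R[i].

Definition simple_int (m : {finite_measure set borelR -> \bar R})
    (S : {fimfun borelR >-> X}) : X :=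
  \sum_(v \in range S) (fine (m (halfline `&` S @^-1` [set v])))%:C *: v.

(* y is the Bochner integral of G over [0, +oo[ with respect to m. *)
Definition is_bochner (m : {finite_measure set borelR -> \bar R})
    (G : R -> X) (y : X) : Prop :=
  exists S : nat -> {fimfun borelR >-> X},
    [/\ forall k v, measurable (S k @^-1` [set v]),
        {ae m, forall s, halfline s -> S k s @[k --> \oo] --> G s},
        (\int[m]_(s in halfline) (rnorm (G s - S k s))%:E)%E @[k --> \oo]
          --> 0%E
      & simple_int m (S k) @[k --> \oo] --> y].

(* 0 by convention when G is not Bochner integrable. *)
Definition bochner (G : R -> X) (m : {finite_measure set borelR -> \bar R}) : X :=
  xget 0 [set y | is_bochner m G y].

End Bochner.
End Measures.

Section FunctionalCalculus.
Variables (R : realType) (X : completeNormedModType R[i]).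

(* g(A) x for g = laplace mu, where T is the semigroup exp(- t A). *)
Definition hp (T : R -> {linear X -> X}) (mu : cmeasure R) (x : X) : X :=
  cm_int (bochner (fun s => T s x)) mu.

(* The operator F(A) of the extended Hille-Phillips calculus, with regularizer
   e = laplace mu and e F = laplace nu. Since e(A)^-1 (e F)(A) does not depend
   on the regularizer, any one may be used to relate x and y = F(A) x; if there
   is no regularizer, the graph is empty. *)
Definition hp_calculus (T : R -> {linear X -> X}) (F : R[i] -> R[i]) :
    set (X * X) :=
  [set p | holomorphic_on (@right_half_plane R) F /\
    exists mu nu : cmeasure R,
      [/\ forall z, right_half_plane z -> laplace mu z * F z = laplace nu z,
          injective (hp T mu)
        & hp T mu p.2 = hp T nu p.1]].

Definition stieltjes (f : R -> R) : Prop :=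
  exists (a : R) (mu : {measure set (measurableTypeR R) -> \bar R}),
    [/\ 0 <= a,
        (* this makes mu finite on compact subsets of [0, +oo[, i.e. Radon *)
        (\int[mu]_(tau in @halfline R) ((1 + tau)^-1)%:E < +oo)%E
      & forall z, 0 < z ->
        (f z)%:E = (a%:E + \int[mu]_(tau in @halfline R) ((z + tau)^-1)%:E)%E].

(* Functions on (0, +oo): the values f z for z <= 0 are irrelevant. *)
Definition stieltjes2 (f : R -> R) : Prop :=
  exists f1 f2, [/\ stieltjes f1, stieltjes f2
    & forall z, 0 < z -> f z = f1 z * f2 z].

Definition analytic_extension (f : R -> R) (F : R[i] -> R[i]) : Prop :=
  holomorphic_on (@slit_plane R) F /\ forall z : R, 0 < z -> F z%:C = (f z)%:C.

(* f(A), where f is identified with its analytic extension to C \ (-oo, 0],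
   which is unique there. *)
Definition stieltjes2_calculus (T : R -> {linear X -> X}) (f : R -> R) :
    set (X * X) :=
  [set p | exists2 F, analytic_extension f F & hp_calculus T F p].

End FunctionalCalculus.

(* limsup of F(n, t) as sqrt n / t -> oo, equal to l *)
Definition limsup_sqrt (R : realType) (F : nat -> R -> R) (l : \bar R) : Prop :=
  ereal_sup [set e | exists (n : nat) (t : R),
    [/\ (0 < n)%N, 0 < t, r <= Num.sqrt n%:R / t & e = (F n t)%:E]]
  @[r --> +oo] --> l.

(* Main.v *)
Require Import Defs.
From HB Require Import structures.
From mathcomp Require Import all_boot all_order all_algebra.
From mathcomp Require Import all_classical all_reals all_analysis measurable_realfun.
From mathcomp Require Import complex ring lra.

(** Only the Euler scheme with a single step is used.  On the exponential
function exp(- z) with z = i s, |s| = 1 / t, one step of the scheme makes an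
error of modulus |1 / (1 +- i) - exp(-+ i)| >= 1 - 1 / sqrt 2, a constant.  So
at a spectral point i s of A the operator Delta T A 1 |s|^-1 does not become
small, although 1 / t = |s| is arbitrarily large.

The points of the spectrum on the imaginary axis lie on the boundary of the
resolvent set, so they carry approximate eigenvectors: unit vectors x with
||A x - i s x|| as small as desired ([approximate_eigenvector]).  On such an x
the semigroup acts almost as exp(- i s t), hence every operator of the
Hille-Phillips calculus acts almost as multiplication by the value of its
symbol at i s ([approx_eigen_hp]).

The regularizer is e(z) = z^2 / ((1 + z) (2 + z)).  For a Stieltjes function F
the function z / (1 + z) F(z) is a difference of two Laplace transforms of
finite positive measures ([stieltjes_transform]), so e f = laplace nu for some
measure nu, and B = (e f)(A) is a bounded operator with range inside
ran(f(A)), because operators of the calculus commute.  As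
|f(i s)| >= f(|s|) / 4 ([stieltjes2_extension]) and |e(i s)| >= 1 / 6 for
|s| >= 1, approximate eigenvectors give ||Delta T A 1 |s|^-1 B|| >= f(|s|) / 384
along the unbounded set of spectral points ([Delta_spectral_ge]).  After
division by eps(|s|) f(|s|) these operators have unbounded norms since eps tends
to 0, and the uniform boundedness principle ([uniform_boundedness]) provides one
vector x on which they are unbounded; y = B x is the required element.

The operators of the calculus are Bochner integrals of orbits.  The orbits are
bounded and uniformly continuous on the half-line, and for such functions the
integral is a limit of Riemann sums ([riemann_cvg]); linearity, commutation with
bounded operators, and norm estimates are read off from these sums. *)

Set Implicit Arguments.
Unset Strict Implicit.
Unset Printing Implicit Defensive.

Import Order.TTheory GRing.Theory Num.Theory.
Import numFieldNormedType.Exports.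
Import Normc.

Local Open Scope classical_set_scope.
Local Open Scope complex_scope.
Local Open Scope ring_scope.

(** * Norms as real numbers *)

Lemma normc_ge0 (R : realType) (z : R[i]) : 0 <= normc z.
Proof. by case: z => a b; exact: sqrtr_ge0. Qed.

Section Norm.
Variables (R : realType) (X : normedModType R[i]).
Implicit Types (x y z : X) (c : R[i]).

Lemma norm_rnorm x : `|x| = (rnorm x)%:C.
Proof.
have := normr_ge0 x; rewrite /rnorm lecE/=.
by case: `|x| => a b /=/andP[/eqP -> _].
Qed.

Lemma rnorm_ge0 x : 0 <= rnorm x.
Proof. by rewrite -lecR -norm_rnorm normr_ge0. Qed.

Lemma rnorm0 : rnorm (0 : X) = 0.
Proof. by rewrite /rnorm normr0. Qed.

Lemma rnorm0_eq0 x : rnorm x = 0 -> x = 0.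
Proof. by move=> x0; apply/eqP; rewrite -normr_eq0 norm_rnorm x0. Qed.

Lemma rnormN x : rnorm (- x) = rnorm x.
Proof. by rewrite /rnorm normrN. Qed.

Lemma rnormBC x y : rnorm (x - y) = rnorm (y - x).
Proof. by rewrite /rnorm distrC. Qed.

Lemma rnormD x y : rnorm (x + y) <= rnorm x + rnorm y.
Proof. by rewrite -lecR rmorphD/= -!norm_rnorm ler_normD. Qed.

Lemma rnormB x y : rnorm (x - y) <= rnorm x + rnorm y.
Proof. by rewrite (le_trans (rnormD _ _))// rnormN. Qed.

Lemma rnorm_triangle z x y : rnorm (x - y) <= rnorm (x - z) + rnorm (z - y).
Proof. by rewrite (le_trans _ (rnormD _ _))// addrA subrK. Qed.

Lemma rnormZ c x : rnorm (c *: x) = normc c * rnorm x.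
Proof.
apply: complexI; rewrite -norm_rnorm normrZ norm_rnorm rmorphM/=.
by congr (_ * _).
Qed.

Lemma normc_real (r : R) : normc r%:C = `|r|.
Proof. by rewrite /= expr0n/= addr0 sqrtr_sqr. Qed.

Lemma rnormZr (r : R) x : rnorm (r%:C *: x) = `|r| * rnorm x.
Proof. by rewrite rnormZ normc_real. Qed.

Lemma rnorm_sum I (s : seq I) (P : pred I) (F : I -> X) :
  rnorm (\sum_(i <- s | P i) F i) <= \sum_(i <- s | P i) rnorm (F i).
Proof.
elim/big_ind2 : _ => //; first by rewrite rnorm0.
by move=> x a y b xa yb; rewrite (le_trans (rnormD _ _))// lerD.
Qed.

Lemma cvg_rnorm (I : Type) (F : set_system I) (FF : Filter F) (u : I -> X) l :
  u i @[i --> F] --> l <-> rnorm (u i - l) @[i --> F] --> (0 : R).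
Proof.
split=> [/cvgrPdist_lt|/cvgrPdist_lt] h; apply/cvgrPdist_lt => e e0.
  have := h e%:C; rewrite ltcR => /(_ e0); apply: filterS => i.
  by rewrite norm_rnorm ltcR sub0r normrN ger0_norm ?rnorm_ge0// rnormBC.
move: e0; rewrite ltcE/= => /andP[/eqP e2 e1].
have := h _ e1; apply: filterS => i.
rewrite sub0r normrN ger0_norm ?rnorm_ge0// rnormBC norm_rnorm ltcE/= => ->.
by rewrite e2 eqxx.
Qed.

Lemma rcvg_le (I : Type) (F : set_system I) (FF : Filter F)
  (u : I -> X) l (w : I -> R) :
  (\forall i \near F, rnorm (u i - l) <= w i) -> w i @[i --> F] --> (0 : R) ->
  u i @[i --> F] --> l.
Proof.
move=> h w0; apply/cvg_rnorm; apply: (squeeze_cvgr _ (cvg_cst (0 : R)) w0).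
by apply: filterS h => i h; rewrite rnorm_ge0.
Qed.

Lemma rnorm_lim_le (I : topologicalType) (F : set_system I) (FF : ProperFilter F)
  (u : I -> X) l (w : I -> R) (b : R) :
  u i @[i --> F] --> l -> w i @[i --> F] --> b ->
  (\forall i \near F, rnorm (u i) <= w i) -> rnorm l <= b.
Proof.
move=> /cvg_rnorm ul wb h.
suff : rnorm l <= 0 + b by rewrite add0r.
apply: (ler_cvg_to (cvg_cst (rnorm l)) (cvgD ul wb)).
  apply: filterS h => i h /=; rewrite -[l in leLHS](subKr (u i)).
  by rewrite (le_trans (rnormB _ _))// addrC lerD2l.
Qed.

End Norm.

Lemma cauchy_rnorm (R : realType) (X : completeNormedModType R[i])
  (u : nat -> X) : (forall e : R, 0 < e -> exists N, forall m n,
    (N <= m)%N -> (N <= n)%N -> rnorm (u m - u n) < e) ->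
  exists l : X, u n @[n --> \oo] --> l.
Proof.
move=> h; apply/cvg_ex; have FF : ProperFilter (u @ \oo) by exact: fmap_proper_filter.
apply: cauchy_cvg; apply: cauchy_exP => e /=.
rewrite ltcE/= => /andP[/eqP e2 e1].
have [N HN] := h _ e1; exists (u N); rewrite /fmapE; exists N => // n /= Nn.
by rewrite -ball_normE/= norm_rnorm ltcE/= e2 eqxx HN.
Qed.

(** * Simple functions and step functions on the half-line *)

Section Cells.
Variables (R : realType) (X : completeNormedModType R[i]).
Local Notation borelR := (measurableTypeR R).
Local Notation halfline := (@halfline R).
Variable m : {finite_measure set borelR -> \bar R}.

Definition rmeas (A : set R) : R := fine (m A).

Lemma rmeasE A : measurable A -> (rmeas A)%:E = m A.
Proof. by move=> mA; rewrite /rmeas fineK// fin_num_measure. Qed.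

Lemma rmeas_ge0 A : 0 <= rmeas A.
Proof. by rewrite /rmeas fine_ge0. Qed.

Lemma measurable_halfline : measurable halfline.
Proof. exact: measurable_itv. Qed.
Hint Resolve measurable_halfline : core.

Variables (Y : choiceType) (Q : R -> Y) (q : seq Y).
Hypotheses (uq : uniq q) (Qq : forall s, Q s \in q)
  (mQ : forall y, measurable (Q @^-1` [set y] : set borelR)).

Let mHQ y : measurable (halfline `&` Q @^-1` [set y] : set borelR).
Proof. exact: measurableI. Qed.

Let cell_triv (D : set Y) : trivIset D (fun y => halfline `&` Q @^-1` [set y]).
Proof. by move=> i j _ _ [s [[_ /= <-] [_ /= <-]]]. Qed.

(** The values of a simple function may coincide on several cells of the
    partition [Q]; grouping the cells by value turns the sum over the range,
    which defines [simple_int], into a sum over the cells. *)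
Lemma simple_int_cells (S : {fimfun borelR >-> X}) (h : Y -> X) :
  (forall s, S s = h (Q s)) ->
  simple_int m S = \sum_(y <- q) (rmeas (halfline `&` Q @^-1` [set y]))%:C *: h y.
Proof.
move=> Sh; rewrite /simple_int.
pose r := undup (map h q).
rewrite (@fsbig_widen _ _ _ _ _ [set` r]); first last.
- move=> v/= [_ vS]; suff -> : S @^-1` [set v] = set0.
    by rewrite setI0 measure0/= scale0r.
  by rewrite -subset0 => s /= Sv; apply: vS; exists s.
- by move=> _ [s _ <-] /=; rewrite Sh mem_undup map_f.
rewrite -fsbig_seq ?undup_uniq//.
transitivity (\sum_(v <- r) \sum_(y <- q | h y == v)
    (rmeas (halfline `&` Q @^-1` [set y]))%:C *: h y).
  apply: eq_bigr => v _.
  have -> : halfline `&` S @^-1` [set v] =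
      \big[setU/set0]_(y \in [set` [seq y <- q | h y == v]])
        (halfline `&` Q @^-1` [set y]).
    rewrite -fsbig_seq ?filter_uniq// big_filter; apply/seteqP; split=> [s|].
      move=> [Hs /= Sv]; rewrite -bigcup_seq_cond; exists (Q s) => //=.
      by rewrite Qq -Sv Sh eqxx.
    move=> s; rewrite -bigcup_seq_cond => -[y /= /andP[yq /eqP <-]] [Hs /= <-].
    by split=> //=; rewrite Sh.
  rewrite measure_fsbig//= -fsbig_seq ?filter_uniq// big_filter.
  rewrite -sum_fine => [|i _]; last exact: fin_num_measure.
  rewrite rmorph_sum scaler_suml; apply: eq_bigr => y /eqP <-//.
rewrite (exchange_big_dep xpredT)//=; apply: eq_big_seq => y yq.
rewrite (eq_bigl (pred1 (h y))); last by move=> v; rewrite /= eq_sym.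
rewrite -big_filter filter_pred1_uniq ?undup_uniq ?mem_undup ?map_f//.
by rewrite big_seq1.
Qed.

Lemma measurable_cells (phi : Y -> R) :
  @measurable_fun _ _ borelR (\bar R) halfline (EFin \o (phi \o Q)).
Proof.
apply: measurable_funTS => _ B _; rewrite setTI.
have -> : (EFin \o (phi \o Q)) @^-1` B =
    \big[setU/set0]_(y <- q | (phi y)%:E \in B) (Q @^-1` [set y]).
  rewrite -bigcup_seq_cond; apply/seteqP; split=> [s Bs|s [y /= /andP[_ +] Qy]].
    by exists (Q s) => //=; rewrite Qq mem_set.
  by rewrite inE -Qy.
exact: bigsetU_measurable.
Qed.

Lemma integral_cells (phi : Y -> R) :
  (\int[m]_(s in halfline) (phi (Q s))%:E =
   (\sum_(y <- q) rmeas (halfline `&` Q @^-1` [set y]) * phi y)%:E)%E.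
Proof.
have HE : halfline = \big[setU/set0]_(y <- q) (halfline `&` Q @^-1` [set y]).
  rewrite -bigcup_seq; apply/seteqP; split=> [s Hs|s [y _ []//]].
  by exists (Q s) => //=; rewrite Qq.
rewrite [in LHS]HE integral_bigsetU_EFin//; last first.
  by rewrite -HE; exact: measurable_cells.
have E y : (\int[m]_(x in halfline `&` Q @^-1` [set y]) (phi (Q x))%:E)%E =
    (rmeas (halfline `&` Q @^-1` [set y]) * phi y)%:E.
  rewrite (eq_integral (cst (phi y)%:E)) => [|s].
    by rewrite integral_cst//= EFinM muleC rmeasE//; exact: mHQ.
  by rewrite inE => -[_ /= ->].
by rewrite -sumEFin; under eq_bigr do rewrite E.
Qed.

End Cells.

#[global] Hint Extern 0 (measurable (@Defs.halfline _)) =>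
  solve [exact: measurable_halfline] : core.

Section RiemannDefs.
Variables (R : realType) (X : normedModType R[i]).
Local Notation borelR := (measurableTypeR R).
Variable m : {finite_measure set borelR -> \bar R}.

(** Orbits of a bounded semigroup are of this kind; the bound K is kept because
    it controls the tails of integrals. *)
Definition buc (G : R -> X) (K : R) : Prop :=
  (forall s : R, 0 <= s -> rnorm (G s) <= K) /\
  forall e : R, 0 < e -> exists2 d : R, 0 < d &
    forall s h : R, 0 <= s -> 0 <= h -> h < d -> rnorm (G (s + h) - G s) <= e.

Definition cell (d : R) (k : nat) : set R := `[k%:R * d, k.+1%:R * d[%classic.

Definition rsum (G : R -> X) (d : R) (N : nat) : X :=
  \sum_(k < N) (rmeas m (cell d k))%:C *: G (k%:R * d).

(** The mesh is h / (p + 1) and there are (p + 1)^2 cells, so that the sums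
    become finer and exhaust the half-line at the same time.  The factor h
    allows the mesh to divide a prescribed time. *)
Definition riemann (G : R -> X) (h : R) (p : nat) : X :=
  rsum G (h / p.+1%:R) (p.+1 ^ 2).

End RiemannDefs.

Section SimpleDist.
Variables (R : realType) (X : completeNormedModType R[i]).
Local Notation borelR := (measurableTypeR R).
Local Notation halfline := (@halfline R).
Variable m : {finite_measure set borelR -> \bar R}.

Lemma fimfun_values (S : {fimfun borelR >-> X}) :
  exists2 r : seq X, uniq r & forall s, S s \in r.
Proof.
exists (finmap.enum_fset (fset_set (range S))); first exact: finmap.fset_uniq.
by move=> s; rewrite in_fset_set// inE; exists s.
Qed.

(** Both integrals are written over the common partition by the pair of values. *)
Lemma simple_int_dist (S1 S2 : {fimfun borelR >-> X}) :
  (forall v, measurable (S1 @^-1` [set v])) ->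
  (forall v, measurable (S2 @^-1` [set v])) ->
  @measurable_fun _ _ borelR (\bar R) halfline (fun s => (rnorm (S1 s - S2 s))%:E)
  /\ ((rnorm (simple_int m S1 - simple_int m S2))%:E <=
   \int[m]_(s in halfline) (rnorm (S1 s - S2 s))%:E)%E.
Proof.
move=> m1 m2.
have [r1 u1 S1r] := fimfun_values S1; have [r2 u2 S2r] := fimfun_values S2.
pose Q s := (S1 s, S2 s); pose q := [seq (a, b) | a <- r1, b <- r2].
have uq : uniq q by rewrite allpairs_uniq// => -[? ?] [? ?].
have Qq s : Q s \in q by exact: allpairs_f.
have mQ y : measurable (Q @^-1` [set y] : set borelR).
  rewrite (_ : Q @^-1` [set y] = S1 @^-1` [set y.1] `&` S2 @^-1` [set y.2]).
    exact: measurableI.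
  by case: y => a b; apply/seteqP; split=> [s [<- <-]//|s [/= <- <-]].
split; first exact: (measurable_cells Qq mQ (fun y => rnorm (y.1 - y.2))).
rewrite (simple_int_cells m uq Qq mQ (h := fst))//.
rewrite (simple_int_cells m uq Qq mQ (h := snd))//.
rewrite (integral_cells m uq Qq mQ (fun y => rnorm (y.1 - y.2))).
rewrite lee_fin -sumrB (le_trans (rnorm_sum _ _ _))//; apply: ler_sum => y _.
by rewrite -scalerBr rnormZr ger0_norm// rmeas_ge0.
Qed.

Lemma fimfun_of (f : R -> X) (r : seq X) : (forall s, f s \in r) ->
  exists S : {fimfun borelR >-> X}, forall s, S s = f s.
Proof.
move=> fr; have ff : finite_set (range (f : borelR -> X)).
  by apply: (@sub_finite_set _ _ [set` r]) => // _ [s _ <-] /=.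
pose b := FiniteImage.Build borelR X f ff.
by exists (HB.pack_for {fimfun borelR >-> X} f b).
Qed.

End SimpleDist.

Section BUC.
Variables (R : realType) (X : completeNormedModType R[i]).
Local Notation borelR := (measurableTypeR R).
Local Notation halfline := (@halfline R).

Implicit Types (G : R -> X).

Lemma buc_dist G K e : buc G K -> 0 < e -> exists2 d : R, 0 < d &
    forall s t : R, 0 <= s -> 0 <= t -> `|s - t| < d -> rnorm (G s - G t) <= e.
Proof.
move=> [_ h] e0; have [d d0 Hd] := h e e0; exists d => // s t s0 t0 std.
have [st|ts] := leP s t.
  rewrite -(subrKC s t) rnormBC Hd// ?subr_ge0//.
  by rewrite (le_lt_trans _ std)// distrC ler_norm.
by rewrite -(subrKC t s) Hd// ?subr_ge0 ?(ltW ts)// (le_lt_trans _ std)// ler_norm.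
Qed.

(** The function is extended from the half-line to the line through the
    retraction max(0, s), because continuity there gives Borel measurability. *)
Lemma buc_continuous G K v : buc G K ->
  continuous (fun s : R => rnorm (G (Num.max 0 s) - v)).
Proof.
move=> bG s; apply/cvgrPdist_le => e e0.
have [d d0 Hd] := buc_dist bG e0.
near=> t.
apply: (@le_trans _ _ (rnorm (G (Num.max 0 s) - G (Num.max 0 t)))).
  have dd (a b : X) : `|rnorm (a - v) - rnorm (b - v)| <= rnorm (a - b).
    have := rnorm_triangle a b v; have := rnorm_triangle b a v.
    by rewrite (rnormBC b a) ler_norml => h1 h2; apply/andP; split; lra.
  exact: dd.
apply: Hd; rewrite ?le_max ?lexx//.
have : `|s - t| < d by near: t; exact: cvgr_dist_lt.
apply: le_lt_trans.
have h1 := ler_norm (s - t); have h2 := ler_norm (t - s); rewrite distrC in h2.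
by rewrite /Num.max; do 2 case: ltP => ?; rewrite ler_norml; apply/andP; split; lra.
Unshelve. all: by end_near. Qed.

Lemma measurable_dist G K (S : {fimfun borelR >-> X}) : buc G K ->
  (forall v, measurable (S @^-1` [set v])) ->
  @measurable_fun _ _ borelR (\bar R) halfline (fun s => (rnorm (G s - S s))%:E).
Proof.
move=> bG mS; have [r ur Sr] := fimfun_values S.
apply/measurable_EFinP => _ B mB.
have -> : halfline `&` (fun s => rnorm (G s - S s)) @^-1` B =
  \big[setU/set0]_(v <- r) (S @^-1` [set v] `&`
    (halfline `&` (fun s => rnorm (G (Num.max 0 s) - v)) @^-1` B)).
  rewrite -bigcup_seq; apply/seteqP; split=> [s [Hs Bs]|s [v /= _ [/= <- []]]].
    exists (S s) => //=; split => //; split => //=.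
    move: Hs; rewrite /Defs.halfline/= in_itv/= andbT => s0.
    by have -> : Num.max 0 s = s by apply/max_idPr.
  move=> Hs /=; have -> // : Num.max 0 s = s.
  by apply/max_idPr; move: Hs; rewrite /Defs.halfline/= in_itv/= andbT.
apply: bigsetU_measurable => v _; apply: measurableI => //.
have h := continuous_measurable_fun (buc_continuous (v := v) bG).
by apply: (measurable_funS _ _ h).
Qed.

End BUC.

Section StepIndex.
Variable R : realType.
Local Notation borelR := (measurableTypeR R).
Local Notation halfline := (@halfline R).
Variables (d : R) (N : nat).
Hypothesis d0 : 0 < d.
Local Notation cell := (cell d).

(** All points from N d on, and the negative ones, share the index N, where the
    step functions below vanish. *)
Definition step_idx (s : R) : nat :=
  if 0 <= s then minn (Num.truncn (s / d)) N else N.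

Lemma step_idx_cell s k : 0 <= s -> (k < N)%N -> (step_idx s == k) = (s \in cell k).
Proof.
move=> s0 kN; rewrite /step_idx s0.
have sd : 0 <= s / d by rewrite divr_ge0// ltW.
have -> : (s \in cell k) = (Num.truncn (s / d) == k).
  by rewrite truncn_eq// mem_setE in_itv/= ler_pdivlMr// ltr_pdivrMr.
apply/eqP/eqP => [|->]; last by apply/minn_idPl; exact: ltnW.
by case: leqP => // _ Nk; rewrite Nk ltnn in kN.
Qed.

Lemma cell_sub k : cell k `<=` halfline.
Proof.
move=> s; rewrite /cell/= in_itv/= => /andP[+ _]; rewrite /Defs.halfline/= in_itv/= andbT.
by apply: le_trans; rewrite mulr_ge0// ltW.
Qed.

Lemma step_idx_preim k : (k < N)%N -> step_idx @^-1` [set k] = cell k.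
Proof.
move=> kN; apply/seteqP; split=> s.
  move=> /= Es; have [s0|s0] := leP 0 s.
    by apply/set_mem; rewrite -step_idx_cell// Es eqxx.
  by move: kN; rewrite -Es /step_idx leNgt s0/= ltnn.
move=> sk; have := cell_sub sk; rewrite /Defs.halfline/= in_itv/= andbT => s0.
by apply/eqP; rewrite step_idx_cell// mem_set.
Qed.

Lemma step_idx_leN s : (step_idx s <= N)%N.
Proof. by rewrite /step_idx; case: ifP => // _; exact: geq_minr. Qed.

Lemma measurable_step_idx k : measurable (step_idx @^-1` [set k] : set borelR).
Proof.
have mk j : (j < N)%N -> measurable (step_idx @^-1` [set j] : set borelR).
  by move=> jN; rewrite step_idx_preim//; exact: measurable_itv.
have [kN|] := ltnP k N; first exact: mk.
rewrite leq_eqVlt => /predU1P[<-|Nk].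
  rewrite (_ : _ @^-1` _ = ~` \big[setU/set0]_(j < N) (step_idx @^-1` [set val j])).
    by apply: measurableC; apply: bigsetU_measurable => j _; exact: mk (ltn_ord j).
  rewrite -(bigcup_mkord N (fun j => step_idx @^-1` [set j])).
  apply/seteqP; split=> [s /= sN [j /= jN]|s /= h].
    by rewrite sN => Nj; rewrite -Nj ltnn in jN.
  apply/eqP; rewrite eqn_leq step_idx_leN leqNgt; apply/negP => sN.
  by apply: h; exists (step_idx s).
rewrite (_ : _ @^-1` _ = set0)//; apply/seteqP; split=> // s /= sk.
by have := step_idx_leN s; rewrite sk leqNgt Nk.
Qed.

Lemma step_idx_lt s : 0 <= s -> s < N%:R * d ->
  [/\ (step_idx s < N)%N, (step_idx s)%:R * d <= s & s - (step_idx s)%:R * d < d].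
Proof.
move=> s0 sN; have sd : 0 <= s / d by rewrite divr_ge0// ltW.
have tN : (Num.truncn (s / d) < N)%N by rewrite truncn_lt_nat// ltr_pdivrMr.
have -> : step_idx s = Num.truncn (s / d).
  by rewrite /step_idx s0; apply/minn_idPl; exact: ltnW.
have /andP[] := truncn_itv sd; rewrite ler_pdivlMr// ltr_pdivrMr// => t1 t2.
by split => //; rewrite ltrBlDl -[X in _ + X]mul1r -mulrDl natr1.
Qed.

Lemma step_idx_ge s : N%:R * d <= s -> step_idx s = N.
Proof.
move=> sN; have s0 : 0 <= s by rewrite (le_trans _ sN)// mulr_ge0// ltW.
have sd : 0 <= s / d by rewrite divr_ge0// ltW.
by rewrite /step_idx s0; apply/minn_idPr; rewrite truncn_ge_nat// ler_pdivlMr.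
Qed.

End StepIndex.

Section IntegralSplit.
Variables (R : realType).
Local Notation borelR := (measurableTypeR R).
Local Notation halfline := (@halfline R).
Variable m : {finite_measure set borelR -> \bar R}.

(** All integral estimates have this shape: small on [0, r[, merely bounded on
    the tail, whose measure is small. *)
Lemma integral_split_le (g : R -> R) (r w K : R) :
  @measurable_fun _ _ borelR (\bar R) halfline (EFin \o g) ->
  0 <= r -> 0 <= w -> 0 <= K ->
  (forall s : R, 0 <= s -> 0 <= g s) ->
  (forall s : R, 0 <= s -> s < r -> g s <= w) ->
  (forall s : R, r <= s -> g s <= K) ->
  (\int[m]_(s in halfline) (g s)%:E <=
   (w * rmeas m halfline + K * rmeas m `[r, +oo[)%:E)%E.
Proof.
move=> mg r0 w0 K0 g0 gw gK.
pose f s : \bar R := (w%:E + K%:E * (\1_(`[r, +oo[%classic) s)%:E)%E.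
have f0 s : (0 <= f s)%E by rewrite adde_ge0// mule_ge0// lee_fin.
have mi : @measurable_fun _ _ borelR (\bar R) halfline
    (fun s => (\1_(`[r, +oo[%classic) s)%:E).
  by apply/measurable_EFinP; exact: measurable_indic.
apply: (@le_trans _ _ (\int[m]_(s in halfline) f s)%E).
  apply: ge0_le_integral => //.
  - by move=> s; rewrite /Defs.halfline/= in_itv/= andbT lee_fin => /g0.
  - by apply: emeasurable_funD => //; exact: measurable_funeM.
  - move=> s; rewrite /Defs.halfline/= in_itv/= andbT => s0.
    rewrite /f indicE -EFinM -EFinD lee_fin.
    have [sr|sr] := leP r s.
      by rewrite mem_set/= ?in_itv/= ?sr// mulr1 (le_trans (gK _ sr))// lerDr.
    rewrite memNset; last by rewrite /= in_itv/= andbT leNgt sr.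
    by rewrite mulr0 addr0 gw.
rewrite /f ge0_integralD//; last 2 first.
- by move=> s _; rewrite mule_ge0// lee_fin.
- exact: measurable_funeM.
rewrite integral_cst//= ge0_integralZl//.
rewrite integral_indic// EFinD 2!EFinM !rmeasE// leeD// lee_wpmul2l//.
by apply: le_measure; rewrite ?inE//; exact: measurableI.
Qed.

End IntegralSplit.

Section Bochner.
Variables (R : realType) (X : completeNormedModType R[i]).
Local Notation borelR := (measurableTypeR R).
Local Notation halfline := (@halfline R).
Variable m : {finite_measure set borelR -> \bar R}.
Variables (G : R -> X) (K : R).
Hypothesis bG : buc G K.

(** Makes simple integrals of approximations of G a Cauchy sequence. *)
Lemma simple_int_dist_buc (S1 S2 : {fimfun borelR >-> X}) :
  (forall v, measurable (S1 @^-1` [set v])) ->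
  (forall v, measurable (S2 @^-1` [set v])) ->
  ((rnorm (simple_int m S1 - simple_int m S2))%:E <=
   \int[m]_(s in halfline) (rnorm (G s - S1 s))%:E +
   \int[m]_(s in halfline) (rnorm (G s - S2 s))%:E)%E.
Proof.
move=> m1 m2; have [mD le12] := simple_int_dist m m1 m2.
apply: (le_trans le12).
have mG1 := measurable_dist bG m1; have mG2 := measurable_dist bG m2.
rewrite -ge0_integralD//; try by move=> s _; rewrite lee_fin rnorm_ge0.
apply: ge0_le_integral => //.
- by move=> s _; rewrite lee_fin rnorm_ge0.
- exact: emeasurable_funD.
- move=> s _; rewrite -EFinD lee_fin (le_trans (rnorm_triangle (G s) _ _))//.
  by rewrite rnormBC.
Qed.

(** The distance from a Bochner integral to a simple integral is controlled by
    the L^1 distance of the integrands; uniqueness of the Bochner integral and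
    convergence of Riemann sums both follow. *)
Lemma is_bochner_dist y (S : {fimfun borelR >-> X}) : is_bochner m G y ->
  (forall v, measurable (S @^-1` [set v])) ->
  ((rnorm (y - simple_int m S))%:E <=
   \int[m]_(s in halfline) (rnorm (G s - S s))%:E)%E.
Proof.
move=> [Sk [mSk _ ik yk]] mS.
set b := (\int[m]_(s in halfline) _)%E.
have b0 : (0 <= b)%E by apply: integral_ge0 => s _; rewrite lee_fin rnorm_ge0.
have [[r Eb]|->] : (exists r, b = r%:E) \/ b = +oo%E; last by rewrite leey.
  by move: b0; case: (b) => [r| |]// _; [left; exists r|right].
rewrite Eb lee_fin.
have ykS : simple_int m (Sk k) - simple_int m S @[k --> \oo] --> y - simple_int m S.
  by apply: cvgB => //; exact: cvg_cst.
have /fine_cvgP[fink /= ik0] := ik.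
apply: (@rnorm_lim_le R X nat \oo _ _ _ (fun k =>
  fine (\int[m]_(s in halfline) (rnorm (G s - Sk k s))%:E)%E + r) r ykS).
  by rewrite -[r in X in _ --> X]add0r; apply: cvgD; [exact: ik0|exact: cvg_cst].
near=> k.
rewrite -lee_fin EFinD fineK; last by near: k; exact: fink.
by rewrite -Eb; exact: simple_int_dist_buc.
Unshelve. all: by end_near. Qed.

Section Step.
Variables (d : R) (N : nat).
Hypothesis d0 : 0 < d.
Local Notation cell := (cell d).
Local Notation step_idx := (step_idx d N).
Local Notation rsum := (rsum m G d N).

Definition step_val (k : nat) : X := if (k < N)%N then G (k%:R * d) else 0.

Lemma step_fun : exists S : {fimfun borelR >-> X},
  [/\ forall s, S s = step_val (step_idx s),
      forall v, measurable (S @^-1` [set v]) & simple_int m S = rsum].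
Proof.
have [|S SE] := @fimfun_of R X (step_val \o step_idx) (map step_val (iota 0 N.+1)).
  by move=> s; apply/mapP; exists (step_idx s); rewrite // mem_iota ltnS step_idx_leN.
exists S; split=> //.
- move=> v; rewrite (_ : _ @^-1` _ =
    \big[setU/set0]_(j < N.+1 | step_val j == v) (step_idx @^-1` [set val j])).
    by apply: bigsetU_measurable => j _; exact: (measurable_step_idx N d0).
  rewrite -(big_mkord (fun j => step_val j == v) (fun j => step_idx @^-1` [set j])).
  rewrite -bigcup_seq_cond; apply/seteqP; split=> [s /= Sv|s [k /= /andP[_ /eqP <-] <-]].
    exists (step_idx s) => //=; rewrite -Sv SE eqxx andbT mem_index_iota/=.
    by rewrite ltnS step_idx_leN.
  exact: SE.
- rewrite (@simple_int_cells _ _ m _ step_idx (iota 0 N.+1) _ _ _ _ step_val)//; last 3 first.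
  + exact: iota_uniq.
  + by move=> s; rewrite mem_iota ltnS step_idx_leN.
  + exact: (measurable_step_idx N d0).
  rewrite -[iota _ _]/(index_iota 0 N.+1) big_mkord big_ord_recr/= {2}/step_val ltnn.
  rewrite scaler0 addr0 /rsum; apply: eq_bigr => k _.
  rewrite /step_val ltn_ord (step_idx_preim d0)//; congr ((rmeas m _)%:C *: _).
  by apply/seteqP; split=> [s []//|s ks]; split=> //; exact: (cell_sub d0 ks).
Qed.

Lemma step_near (w : R) s :
  (forall s h : R, 0 <= s -> 0 <= h -> h < d -> rnorm (G (s + h) - G s) <= w) ->
  0 <= s -> s < N%:R * d -> rnorm (G s - step_val (step_idx s)) <= w.
Proof.
move=> Hw s0 sN; have [kN k1 k2] := step_idx_lt d0 s0 sN.
rewrite /step_val kN; have := Hw ((step_idx s)%:R * d) (s - (step_idx s)%:R * d).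
by rewrite subrKC; apply => //; rewrite ?subr_ge0// mulr_ge0// ltW.
Qed.

Lemma integral_step (w : R) (S : {fimfun borelR >-> X}) :
  (forall s, S s = step_val (step_idx s)) ->
  (forall v, measurable (S @^-1` [set v])) ->
  (forall s h : R, 0 <= s -> 0 <= h -> h < d -> rnorm (G (s + h) - G s) <= w) ->
  0 <= w ->
  (\int[m]_(s in halfline) (rnorm (G s - S s))%:E <=
   (w * rmeas m halfline + K * rmeas m `[N%:R * d, +oo[)%:E)%E.
Proof.
move=> SE mS Hw w0.
have K0 : 0 <= K by rewrite (le_trans _ (bG.1 0 (lexx 0)))// rnorm_ge0.
apply: integral_split_le => //; first exact: measurable_dist bG mS.
- by rewrite mulr_ge0// ltW.
- by move=> s _; exact: rnorm_ge0.
- by move=> s s0 sN; rewrite SE; exact: step_near.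
- move=> s sN; have s0 : 0 <= s by rewrite (le_trans _ sN)// mulr_ge0// ltW.
  by rewrite SE step_idx_ge// /step_val ltnn subr0 bG.1.
Qed.

End Step.
End Bochner.

(** * Bochner integrals as limits of Riemann sums *)

Lemma div_succ_mul_le (R : realFieldType) (a b : R) :
  0 <= a -> 0 <= b -> a / (b + 1) * b <= a.
Proof.
move=> a0 b0; rewrite mulrAC ler_pdivrMr ?ltr_wpDl//.
by rewrite ler_wpM2l// lerDl.
Qed.

Section Riemann.
Variables (R : realType) (X : completeNormedModType R[i]).
Local Notation borelR := (measurableTypeR R).
Local Notation halfline := (@halfline R).
Variable m : {finite_measure set borelR -> \bar R}.

Lemma rmeas_tail_cvg (h : R) : 0 < h ->
  rmeas m `[p.+1%:R * h, +oo[ @[p --> \oo] --> (0 : R).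
Proof.
move=> h0.
pose F p : set borelR := `[p.+1%:R * h, +oo[%classic.
have F0 : \bigcap_p F p = set0.
  rewrite -subset0 => s Fs.
  have := Fs (Num.truncn (s / h)) I; rewrite /F/= in_itv/= andbT.
  rewrite -ler_pdivlMr// leNgt => /negP; apply.
  exact: truncnS_gt.
have : m (F p) @[p --> \oo] --> m (\bigcap_p F p).
  apply: nonincreasing_cvg_mu => //.
  - by rewrite -ge0_fin_numE// fin_num_measure//; exact: measurable_itv.
  - by move=> p; exact: measurable_itv.
  - by rewrite F0.
  - move=> p q pq; apply/subsetPset => s; rewrite /F/= !in_itv/= !andbT.
    by apply: le_trans; rewrite ler_wpM2r ?ler_nat ?ltnS// ltW.
by rewrite F0 measure0 => /fine_cvgP[].
Qed.

Lemma norm_cvg_unique (u : nat -> X) (y y' : X) :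
  u p @[p --> \oo] --> y -> u p @[p --> \oo] --> y' -> y = y'.
Proof. move=> h1 h2; exact: (cvg_unique (@norm_hausdorff _ X) h1 h2). Qed.

Variables (G : R -> X) (K : R).
Hypothesis bG : buc G K.

Local Notation riemann := (riemann m G).

Let mesh (h : R) p : 0 < h -> 0 < h / p.+1%:R.
Proof. by move=> h0; rewrite divr_gt0// ltr0n. Qed.

Let mesh_len (h : R) p : (p.+1 ^ 2)%:R * (h / p.+1%:R) = p.+1%:R * h.
Proof. by rewrite natrX; field; rewrite addrC natr1 pnatr_eq0. Qed.

Let buc_mesh (h e : R) : 0 < h -> 0 < e -> \forall p \near \oo,
  forall s u : R, 0 <= s -> 0 <= u -> u < h / p.+1%:R -> rnorm (G (s + u) - G s) <= e.
Proof.
move=> h0 e0; have [d d0 Hd] := bG.2 e e0.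
near=> p => s u s0 u0 up; apply: Hd => //; apply: (lt_trans up).
rewrite ltr_pdivrMr ?ltr0n// mulrC -ltr_pdivrMr//.
have : h / d < p%:R by near: p; exact: nbhs_infty_gtr.
by move/lt_trans; apply; rewrite ltr_nat.
Unshelve. all: by end_near. Qed.

Lemma riemann_integral_small (h e : R) : 0 < h -> 0 < e -> \forall p \near \oo,
  forall S : {fimfun borelR >-> X},
    (forall s, S s = step_val G (h / p.+1%:R) (p.+1 ^ 2)
                       (step_idx (h / p.+1%:R) (p.+1 ^ 2) s)) ->
    (forall v, measurable (S @^-1` [set v])) ->
  (\int[m]_(s in halfline) (rnorm (G s - S s))%:E <= e%:E)%E.
Proof.
move=> h0 e0.
have K0 : 0 <= K by rewrite (le_trans _ (bG.1 0 (lexx 0)))// rnorm_ge0.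
pose M := rmeas m halfline.
have M0 : 0 <= M by exact: rmeas_ge0.
have w0 : 0 < e / 2 / (M + 1) by rewrite !divr_gt0// ltr_wpDl.
near=> p => S SE mS.
apply: (le_trans (integral_step m bG (mesh p h0) SE mS _ (ltW w0))).
  by near: p; exact: buc_mesh.
rewrite lee_fin -/M mesh_len [leRHS](splitr e) lerD//.
  by rewrite div_succ_mul_le// ltW// divr_gt0.
have : `|0 - rmeas m `[p.+1%:R * h, +oo[| < e / 2 / (K + 1).
  near: p; move/cvgrPdist_lt : (rmeas_tail_cvg h0); apply.
  by rewrite !divr_gt0// ltr_wpDl.
rewrite sub0r normrN ger0_norm ?rmeas_ge0// => /ltW t.
rewrite mulrC (le_trans (ler_wpM2r K0 t))//.
by rewrite div_succ_mul_le// ltW// divr_gt0.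
Unshelve. all: by end_near. Qed.

Lemma is_bochner_riemann y (h : R) : 0 < h -> is_bochner m G y ->
  riemann h p @[p --> \oo] --> y.
Proof.
move=> h0 By; apply/cvg_rnorm/cvgrPdist_le => e e0.
near=> p; rewrite sub0r normrN ger0_norm ?rnorm_ge0// rnormBC.
have [S [SE mS SI]] := step_fun m G (p.+1 ^ 2) (mesh p h0).
rewrite /riemann -SI -lee_fin (le_trans (is_bochner_dist bG By mS))//.
have := SE; have := mS; move: S {SE mS SI} => S mS SE.
move: S SE mS; near: p; exact: riemann_integral_small.
Unshelve. all: by end_near. Qed.

(** The step functions of the Riemann sums witness the integral: they converge
    pointwise by uniform continuity and in L^1 by [integral_step]. *)
Lemma is_bochner_exists : exists y, is_bochner m G y.
Proof.
have h0 : 0 < 1 :> R by [].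
have [S HS] := choice (fun p => step_fun m G (p.+1 ^ 2) (mesh p h0)).
have small e : 0 < e -> \forall p \near \oo,
    (\int[m]_(s in halfline) (rnorm (G s - S p s))%:E <= e%:E)%E.
  move=> e0; near=> p; have [SE mS _] := HS p.
  move: (S p) SE mS; near: p; exact: riemann_integral_small.
have [e e0|y Hy] := @cauchy_rnorm _ X (fun p => simple_int m (S p)).
  have e30 : 0 < e / 3 by rewrite divr_gt0.
  have [N _ HN] := small _ e30; exists N => p q Np Nq.
  have [_ mp _] := HS p; have [_ mq _] := HS q.
  rewrite -lte_fin (le_lt_trans (simple_int_dist_buc m bG mp mq))//.
  rewrite (le_lt_trans (leeD (HN p Np) (HN q Nq)))// -EFinD lte_fin; lra.
exists y, S; split => //.
- by move=> k v; have [_ + _] := HS k; exact.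
- apply: aeW => s; rewrite /Defs.halfline/= in_itv/= andbT => s0.
  apply/cvg_rnorm/cvgrPdist_le => e e0.
  near=> p; rewrite sub0r normrN ger0_norm ?rnorm_ge0// rnormBC.
  have [-> _ _] := HS p.
  apply: step_near => //.
  + by near: p; exact: buc_mesh.
  + rewrite mesh_len mulr1.
    have : s < p%:R by near: p; exact: nbhs_infty_gtr.
    by move/lt_trans; apply; rewrite ltr_nat.
- apply/fine_cvgP; split.
    near=> p; rewrite fin_numElt; apply/andP; split.
      by rewrite (@lt_le_trans _ _ 0%E)// integral_ge0// => s _; rewrite lee_fin rnorm_ge0.
    have : (\int[m]_(s in halfline) (rnorm (G s - S p s))%:E <= 1%:E)%E.
      by near: p; exact: small.
    by move/le_lt_trans; apply; rewrite ltry.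
  apply/cvgrPdist_le => e e0; near=> p.
  have i0 : (0 <= \int[m]_(s in halfline) (rnorm (G s - S p s))%:E)%E.
    by rewrite integral_ge0// => s _; rewrite lee_fin rnorm_ge0.
  have ie : (\int[m]_(s in halfline) (rnorm (G s - S p s))%:E <= e%:E)%E.
    by near: p; exact: small.
  rewrite sub0r normrN/= ger0_norm ?fine_ge0// -lee_fin fineK//.
  by rewrite ge0_fin_numE// (le_lt_trans ie)// ltry.
Unshelve. all: by end_near. Qed.

(** The properties of [bochner] below are obtained by passing to the limit in
    the corresponding identity between Riemann sums. *)
Lemma riemann_cvg (h : R) : 0 < h ->
  riemann h p @[p --> \oo] --> bochner G m.
Proof.
move=> h0; apply: is_bochner_riemann => //.
have [y By] := is_bochner_exists.
exact: (xgetI _ By).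
Qed.

End Riemann.

Lemma bounded_integrable d (T : measurableType d) (R : realType)
    (m : {finite_measure set T -> \bar R}) (D : set T) (g : T -> R) (K : R) :
  measurable D -> measurable_fun D g ->
  (forall s, D s -> `|g s| <= K) -> m.-integrable D (EFin \o g).
Proof.
move=> mD mg gK; apply: measurable_bounded_integrable => //.
  by rewrite -ge0_fin_numE// fin_num_measure.
exists K; split; first exact: num_real.
by move=> M KM x Dx /=; rewrite (le_trans (gK _ Dx))// ltW.
Qed.

Lemma normr_Re_le (R : realType) (z : R[i]) : `|complex.Re z| <= normc z.
Proof.
case: z => a b /=; rewrite -[leLHS]sqrtr_sqr /=; rewrite sqrtr_sqr -[leLHS]sqrtr_sqr.
by rewrite ler_sqrt ?addr_ge0 ?sqr_ge0// lerDl sqr_ge0.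
Qed.

Lemma normr_Im_le (R : realType) (z : R[i]) : `|complex.Im z| <= normc z.
Proof.
case: z => a b /=; rewrite -[leLHS]sqrtr_sqr.
by rewrite ler_sqrt ?addr_ge0 ?sqr_ge0// lerDr sqr_ge0.
Qed.

Lemma normc_le (R : realType) (z : R[i]) :
  normc z <= `|complex.Re z| + `|complex.Im z|.
Proof.
case: z => a b /=; rewrite -[leRHS]ger0_norm ?addr_ge0// -sqrtr_sqr.
rewrite ler_sqrt ?sqr_ge0// [leRHS]sqrrD !real_normK ?num_real// addrAC lerDl.
by rewrite mulrn_wge0// mulr_ge0.
Qed.

Lemma complex_sum (R : realType) (n : nat) (F : nat -> R[i]) :
  \sum_(k < n) F k =
  (\sum_(k < n) complex.Re (F k)) +i* (\sum_(k < n) complex.Im (F k)).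
Proof.
elim: n => [|n IHn]; first by rewrite !big_ord0.
by rewrite !big_ord_recr/= IHn; case: (F n).
Qed.

Lemma realC_mul (R : realType) (r : R) (z : R[i]) :
  r%:C * z = (r * complex.Re z) +i* (r * complex.Im z).
Proof. by case: z => a b; apply/eqP; rewrite eq_complex/= !mul0r subr0 addr0 !eqxx. Qed.

Section ScalarRiemann.
Variables (R : realType).
Local Notation borelR := (measurableTypeR R).
Local Notation halfline := (@halfline R).
Variable m : {finite_measure set borelR -> \bar R}.

Section RealFun.
Variables (u : R -> R) (K : R).
Hypothesis uK : forall s : R, 0 <= s -> `|u s| <= K.
Hypothesis uc : forall e : R, 0 < e -> exists2 d : R, 0 < d &
    forall s h : R, 0 <= s -> 0 <= h -> h < d -> `|u (s + h) - u s| <= e.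

Lemma bucr_measurable : @measurable_fun _ _ borelR borelR halfline u.
Proof.
have cu : continuous (fun s : R => u (Num.max 0 s)).
  move=> s; apply/cvgrPdist_le => e e0.
  have [d d0 Hd] := uc e0.
  have Hd' a b : 0 <= a -> 0 <= b -> `|a - b| < d -> `|u a - u b| <= e.
    move=> a0 b0; case: (leP a b) => ab; last first.
      rewrite gtr0_norm ?subr_gt0// => abd.
      by rewrite -(subrKC b a) Hd// ltW// subr_gt0.
    rewrite distrC ger0_norm ?subr_ge0// => abd.
    by rewrite -(subrKC a b) distrC Hd// subr_ge0.
  near=> t; apply: Hd'; rewrite ?le_max ?lexx//.
  have : `|s - t| < d by near: t; exact: cvgr_dist_lt.
  apply: le_lt_trans.
  have h1 := ler_norm (s - t); have h2 := ler_norm (t - s); rewrite distrC in h2.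
  by rewrite /Num.max; do 2 case: ltP => ?; rewrite ler_norml; apply/andP; split; lra.
have h := continuous_measurable_fun cu.
have hh : @measurable_fun _ _ borelR borelR halfline (fun s : R => u (Num.max 0 s)).
  by apply: (measurable_funS _ _ h).
apply: eq_measurable_fun hh => s; rewrite inE /Defs.halfline/= in_itv/= andbT => s0.
by have -> : Num.max 0 s = s by apply/max_idPr.
Unshelve. all: by end_near. Qed.

Let sumK (d : R) N := \sum_(k < N) rmeas m (cell d k) * u (k%:R * d).

(** The scalar version of [integral_step]; scalar integrals are
    Lebesgue integrals, so the comparison with the sum is made anew. *)
Lemma real_sum_dist (d w : R) N : 0 < d -> 0 <= w ->
  (forall s h : R, 0 <= s -> 0 <= h -> h < d -> `|u (s + h) - u s| <= w) ->
  `|\int[m]_(s in halfline) u s - sumK d N| <=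
    w * rmeas m halfline + K * rmeas m `[N%:R * d, +oo[.
Proof.
move=> d0 w0 Hw.
have K0 : 0 <= K by rewrite (le_trans _ (uK (lexx 0))).
pose v k := if (k < N)%N then u (k%:R * d) else 0.
pose g s := v (step_idx d N s).
have idxq s : step_idx d N s \in iota 0 N.+1.
  by rewrite mem_iota ltnS step_idx_leN.
have mg : @measurable_fun _ _ borelR borelR halfline g.
  by apply/measurable_EFinP; exact: (measurable_cells idxq (measurable_step_idx N d0) v).
have gE : \int[m]_(s in halfline) g s = sumK d N.
  rewrite /Rintegral.
  rewrite (integral_cells m (iota_uniq _ _) idxq (measurable_step_idx N d0) v).
  rewrite -[iota _ _]/(index_iota 0 N.+1) big_mkord big_ord_recr/=.
  rewrite {2}/v ltnn mulr0 addr0.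
  apply: eq_bigr => k _; rewrite /v ltn_ord (step_idx_preim d0)//; congr (rmeas m _ * _).
  by apply/seteqP; split=> [s []//|s ks]; split=> //; exact: (cell_sub d0 ks).
have mu := bucr_measurable.
have iu : m.-integrable halfline (EFin \o u).
  apply: (@bounded_integrable _ _ _ m halfline _ (K)) => // s.
  by rewrite /Defs.halfline/= in_itv/= andbT => /uK.
have vK k : `|v k| <= K.
  by rewrite /v; case: ifP => _; rewrite ?normr0// uK// mulr_ge0// ltW.
have ig : m.-integrable halfline (EFin \o g).
  by apply: (@bounded_integrable _ _ _ m halfline _ (K)) => // s _; exact: vK.
have mB : @measurable_fun _ _ borelR borelR halfline (fun s => u s - g s).
  exact: measurable_funB.
have iB : m.-integrable halfline (EFin \o (fun s => u s - g s)).
  apply: (@bounded_integrable _ _ _ m halfline _ (K + K)) => // s.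
  rewrite /Defs.halfline/= in_itv/= andbT => s0.
  by rewrite (le_trans (ler_normB _ _))// lerD ?uK//; exact: vK.
rewrite -gE -RintegralB//.
rewrite (le_trans (le_normr_Rintegral _ iB))//.
have mN : @measurable_fun _ _ borelR (\bar R) halfline (EFin \o (fun s => `|u s - g s|)).
  by apply/measurable_EFinP; exact: measurableT_comp.
rewrite -lee_fin fineK.
  apply: integral_split_le => //.
  - by rewrite mulr_ge0// ltW.
  - move=> s s0 sN; have [kN k1 k2] := step_idx_lt d0 s0 sN.
    rewrite /g /v kN; have := Hw ((step_idx d N s)%:R * d) (s - (step_idx d N s)%:R * d).
    by rewrite subrKC; apply => //; rewrite ?subr_ge0// mulr_ge0// ltW.
  - move=> s sN; rewrite /g step_idx_ge// /v ltnn subr0 uK//.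
    by rewrite (le_trans _ sN)// mulr_ge0// ltW.
have : m.-integrable halfline (EFin \o (fun s => `|u s - g s|)).
  by have := integrable_abse iB; apply: eq_integrable.
by move=> /integrable_fin_num; apply.
Qed.

Lemma real_riemann_cvg (h : R) : 0 < h ->
  sumK (h / p.+1%:R) (p.+1 ^ 2) @[p --> \oo] --> \int[m]_(s in halfline) u s.
Proof.
move=> h0; apply/cvgrPdist_le => e e0.
have K0 : 0 <= K by rewrite (le_trans _ (uK (lexx 0))).
pose M := rmeas m halfline.
have M0 : 0 <= M by exact: rmeas_ge0.
have w0 : 0 < e / 2 / (M + 1) by rewrite !divr_gt0// ltr_wpDl.
have [d d0 Hd] := uc w0.
near=> p.
have m0 : 0 < h / p.+1%:R by rewrite divr_gt0// ltr0n.
rewrite (le_trans (real_sum_dist _ m0 (ltW w0) _))//.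
  move=> s v s0 v0 vp; apply: Hd => //; apply: (lt_trans vp).
  rewrite ltr_pdivrMr ?ltr0n// mulrC -ltr_pdivrMr//.
  have : h / d < p%:R by near: p; exact: nbhs_infty_gtr.
  by move/lt_trans; apply; rewrite ltr_nat.
have -> : (p.+1 ^ 2)%:R * (h / p.+1%:R) = p.+1%:R * h :> R.
  by rewrite natrX; field; rewrite addrC natr1 pnatr_eq0.
rewrite -/M [leRHS](splitr e) lerD//.
  by rewrite div_succ_mul_le// ltW// divr_gt0.
have : `|0 - rmeas m `[p.+1%:R * h, +oo[| < e / 2 / (K + 1).
  near: p; move/cvgrPdist_lt : (rmeas_tail_cvg m h0); apply.
  by rewrite !divr_gt0// ltr_wpDl.
rewrite sub0r normrN ger0_norm ?rmeas_ge0// => /ltW t.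
rewrite mulrC (le_trans (ler_wpM2r K0 t))//.
by rewrite div_succ_mul_le// ltW// divr_gt0.
Unshelve. all: by end_near. Qed.

End RealFun.

Lemma normcB_Re (a b : R[i]) e : normc (a - b) <= e ->
  `|complex.Re a - complex.Re b| <= e.
Proof. by apply: le_trans; have := normr_Re_le (a - b); rewrite raddfB. Qed.

Lemma normcB_Im (a b : R[i]) e : normc (a - b) <= e ->
  `|complex.Im a - complex.Im b| <= e.
Proof. by apply: le_trans; have := normr_Im_le (a - b); rewrite raddfB. Qed.

Variables (g : R -> R[i]) (K : R).
Hypothesis bg : @buc R R[i]^o g K.

(** Stated with a vector factor x, so that the limit can be compared with that
    of vector-valued Riemann sums in [bochner_scalar]. *)
Lemma scalar_riemann_cvg (X : normedModType R[i]) (x : X) (h : R) : 0 < h ->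
  riemann m (fun s => g s *: x) h p @[p --> \oo] --> scalar_int g m *: x.
Proof.
move=> h0; have [gK gc] := bg.
have cRe := @real_riemann_cvg (fun s => complex.Re (g s)) K.
have cIm := @real_riemann_cvg (fun s => complex.Im (g s)) K.
have {}cRe := cRe (fun s s0 => le_trans (normr_Re_le _) (gK s s0)) _ h h0.
have {}cIm := cIm (fun s s0 => le_trans (normr_Im_le _) (gK s s0)) _ h h0.
have {}cRe := cRe (fun e e0 => let: ex_intro2 d d0 Hd := gc e e0 in
  ex_intro2 _ _ d d0 (fun s h s0 h0 hd => normcB_Re (Hd s h s0 h0 hd))).
have {}cIm := cIm (fun e e0 => let: ex_intro2 d d0 Hd := gc e e0 in
  ex_intro2 _ _ d d0 (fun s h s0 h0 hd => normcB_Im (Hd s h s0 h0 hd))).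
have E p : riemann m (fun s => g s *: x) h p =
  ((\sum_(k < p.+1 ^ 2) rmeas m (cell (h / p.+1%:R) k) * complex.Re (g (k%:R * (h / p.+1%:R))))
   +i* (\sum_(k < p.+1 ^ 2) rmeas m (cell (h / p.+1%:R) k) * complex.Im (g (k%:R * (h / p.+1%:R)))))
  *: x.
  rewrite /riemann /rsum.
  under eq_bigr do rewrite scalerA realC_mul.
  rewrite -scaler_suml; congr (_ *: x).
  exact: (complex_sum _ (fun k : nat =>
    (rmeas m (cell (h / p.+1%:R) k) * complex.Re (g (k%:R * (h / p.+1%:R)))) +i*
    (rmeas m (cell (h / p.+1%:R) k) * complex.Im (g (k%:R * (h / p.+1%:R)))))).
under eq_cvg do rewrite E.
apply: (@rcvg_le _ _ _ _ _ _ _ (fun p => (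
  `|\sum_(k < p.+1 ^ 2) rmeas m (cell (h / p.+1%:R) k) * complex.Re (g (k%:R * (h / p.+1%:R)))
   - \int[m]_(s in halfline) complex.Re (g s)| +
  `|\sum_(k < p.+1 ^ 2) rmeas m (cell (h / p.+1%:R) k) * complex.Im (g (k%:R * (h / p.+1%:R)))
   - \int[m]_(s in halfline) complex.Im (g s)|) * rnorm x)).
  near=> p; rewrite -scalerBl rnormZ ler_wpM2r ?rnorm_ge0//.
  set a := \sum_(k < _) _ * complex.Re _; set b := \sum_(k < _) _.
  rewrite /scalar_int /=.
  set a' := Rintegral _ _ _; set b' := Rintegral _ _ _.
  exact: (normc_le ((a - a') +i* (b - b'))).
rewrite -[X in _ --> X](mul0r (rnorm x)); apply: cvgM; last exact: cvg_cst.
rewrite -[X in _ --> X](addr0 0); apply: cvgD.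
  by apply/norm_cvg0P/subr_cvg0.
by apply/norm_cvg0P/subr_cvg0.
Unshelve. all: by end_near. Qed.

End ScalarRiemann.

Section BochnerTheory.
Variables (R : realType) (X : completeNormedModType R[i]).
Local Notation borelR := (measurableTypeR R).
Local Notation halfline := (@halfline R).
Implicit Types (m : {finite_measure set borelR -> \bar R}) (G H : R -> X).

Lemma buc_lin G H K L (c : R[i]) : buc G K -> buc H L ->
  buc (fun s => c *: G s + H s) (normc c * K + L).
Proof.
have nc0 : 0 <= normc c by exact: normc_ge0.
move=> [GK Gc] [HL Hc]; split=> [s s0|e e0].
  by rewrite (le_trans (rnormD _ _))// lerD ?HL// rnormZ ler_wpM2l// GK.
have e1 : 0 < e / 2 / (normc c + 1) by rewrite !divr_gt0// ltr_wpDl.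
have e2 : 0 < e / 2 by rewrite divr_gt0.
have [d d0 Hd] := Gc _ e1; have [d' d'0 Hd'] := Hc _ e2.
exists (Num.min d d'); first by rewrite lt_min d0.
move=> s h s0 h0; rewrite lt_min => /andP[hd hd'].
rewrite opprD addrACA -scalerBr (le_trans (rnormD _ _))// [leRHS](splitr e).
rewrite lerD ?Hd'// rnormZ.
rewrite (le_trans (ler_wpM2l nc0 (Hd _ _ s0 h0 hd)))// mulrC div_succ_mul_le//.
exact: ltW.
Qed.

Lemma buc_op G K (L : {linear X -> X}) C : 0 <= C ->
  (forall x, rnorm (L x) <= C * rnorm x) -> buc G K -> buc (fun s => L (G s)) (C * K).
Proof.
move=> C0 LC [GK Gc]; split=> [s s0|e e0].
  by rewrite (le_trans (LC _))// ler_wpM2l// GK.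
have e1 : 0 < e / (C + 1) by rewrite !divr_gt0// ltr_wpDl.
have [d d0 Hd] := Gc _ e1; exists d => // s h s0 h0 hd.
rewrite -linearB (le_trans (LC _))//.
rewrite (le_trans (ler_wpM2l C0 (Hd _ _ s0 h0 hd)))// mulrC div_succ_mul_le//.
exact: ltW.
Qed.

Lemma bochner_lin m G H K L (c : R[i]) : buc G K -> buc H L ->
  bochner (fun s => c *: G s + H s) m = c *: bochner G m + bochner H m.
Proof.
move=> bG bH.
have cGH := riemann_cvg (m := m) (buc_lin c bG bH) ltr01.
have cG := riemann_cvg (m := m) bG ltr01; have cH := riemann_cvg (m := m) bH ltr01.
apply: (norm_cvg_unique cGH).
have : c *: riemann m G 1 p + riemann m H 1 p @[p --> \oo] -->
    c *: bochner G m + bochner H m.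
  by apply: cvgD => //; apply: cvgZr.
apply: cvg_trans; apply: near_eq_cvg; near=> p.
rewrite /riemann /rsum scaler_sumr -big_split/=; apply: eq_bigr => k _.
by rewrite scalerDr !scalerA mulrC.
Unshelve. all: by end_near. Qed.

Lemma eq_bochner m G H K : buc G K -> (forall s, 0 <= s -> G s = H s) ->
  bochner G m = bochner H m.
Proof.
move=> bG GH; have bH : buc H K.
  split=> [s s0|e e0]; first by rewrite -GH// bG.1.
  have [d d0 Hd] := bG.2 e e0; exists d => // s h s0 h0 hd.
  by rewrite -!GH ?addr_ge0// Hd.
apply: (norm_cvg_unique (riemann_cvg (m := m) bG ltr01)).
have := riemann_cvg (m := m) bH ltr01; apply: cvg_trans; apply: near_eq_cvg; near=> p.
apply: eq_bigr => k _; rewrite GH// mulr_ge0// divr_ge0//.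
Unshelve. all: by end_near. Qed.

Lemma bochner_op m G K (L : {linear X -> X}) C : 0 <= C ->
  (forall x, rnorm (L x) <= C * rnorm x) -> buc G K ->
  bochner (fun s => L (G s)) m = L (bochner G m).
Proof.
move=> C0 LC bG.
apply: (norm_cvg_unique (riemann_cvg (m := m) (buc_op C0 LC bG) ltr01)).
have /cvg_rnorm cG := riemann_cvg (m := m) bG ltr01.
apply: (@rcvg_le _ _ _ _ _ _ _ (fun p => C * rnorm (riemann m G 1 p - bochner G m))).
  near=> p; rewrite (_ : riemann _ _ _ _ = L (riemann m G 1 p)).
    by rewrite -linearB LC.
  by rewrite /riemann /rsum linear_sum; apply: eq_bigr => k _; rewrite linearZ.
by rewrite -[X in _ --> X](mulr0 C); apply: cvgM => //; exact: cvg_cst.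
Unshelve. all: by end_near. Qed.

Lemma buc_scalar (g : R -> R[i]) K (x : X) : @buc R R[i]^o g K ->
  buc (fun s => g s *: x) (K * rnorm x).
Proof.
move=> [gK gc]; split=> [s s0|e e0].
  by rewrite rnormZ ler_wpM2r ?rnorm_ge0//; exact: gK.
have e1 : 0 < e / (rnorm x + 1) by rewrite !divr_gt0// ltr_wpDl// rnorm_ge0.
have [d d0 Hd] := gc _ e1; exists d => // s h s0 h0 hd.
rewrite -scalerBl rnormZ (le_trans (ler_wpM2r (rnorm_ge0 _) (Hd _ _ s0 h0 hd)))//.
by rewrite div_succ_mul_le// ?rnorm_ge0// ltW.
Qed.

Lemma bochner_scalar m (g : R -> R[i]) K (x : X) : @buc R R[i]^o g K ->
  bochner (fun s => g s *: x) m = scalar_int g m *: x.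
Proof.
move=> bg; have bgx := buc_scalar x bg.
apply: (norm_cvg_unique (riemann_cvg (m := m) bgx ltr01)).
exact: (@scalar_riemann_cvg _ m g K bg X x 1 ltr01).
Qed.

(** Comparison with the zero simple function. *)
Lemma bochner_norm_le m G K (r w : R) : buc G K -> 0 <= r -> 0 <= w ->
  (forall s : R, 0 <= s -> s < r -> rnorm (G s) <= w) ->
  rnorm (bochner G m) <= w * rmeas m halfline + K * rmeas m `[r, +oo[.
Proof.
move=> bG r0 w0 Gw.
have K0 : 0 <= K by rewrite (le_trans _ (bG.1 0 (lexx 0)))// rnorm_ge0.
have [S S0] := @fimfun_of R X (cst 0) [:: 0] (fun _ => mem_head _ _).
have mS v : measurable (S @^-1` [set v]).
  have -> : (S : R -> X) = cst 0 by apply/funext.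
  rewrite preimage_cst; case: ifP => _; [exact: measurableT|exact: measurable0].
have [y By] := is_bochner_exists m bG.
have Bb : is_bochner m G (bochner G m) by exact: (xgetI _ By).
have iS : simple_int m S = 0.
  rewrite /simple_int fsbig1// => v [s _ <-]; by rewrite S0 scaler0.
rewrite -[bochner G m]subr0 -iS -lee_fin (le_trans (is_bochner_dist bG Bb mS))//.
apply: integral_split_le => //.
- exact: measurable_dist bG mS.
- by move=> s _; exact: rnorm_ge0.
- by move=> s s0 sr; rewrite S0 subr0 Gw.
- by move=> s rs; rewrite S0 subr0 bG.1// (le_trans r0).
Qed.

Lemma bochner_norm_le1 m G K : buc G K ->
  rnorm (bochner G m) <= K * rmeas m halfline.
Proof.
move=> bG; have K0 : 0 <= K by rewrite (le_trans _ (bG.1 0 (lexx 0)))// rnorm_ge0.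
rewrite (le_trans (bochner_norm_le m bG (lexx 0) (lexx 0) _))//.
  by move=> s s0; rewrite ltNge s0.
by rewrite mul0r add0r.
Qed.

Lemma bochner_measure_lin m m1 m2 (a b : R) G K : buc G K ->
  (forall A, measurable A -> rmeas m A = a * rmeas m1 A + b * rmeas m2 A) ->
  bochner G m = a%:C *: bochner G m1 + b%:C *: bochner G m2.
Proof.
move=> bG mE; apply: (norm_cvg_unique (riemann_cvg (m := m) bG ltr01)).
have : a%:C *: riemann m1 G 1 p + b%:C *: riemann m2 G 1 p @[p --> \oo] -->
    a%:C *: bochner G m1 + b%:C *: bochner G m2.
  by apply: cvgD; apply: cvgZr; exact: (riemann_cvg bG ltr01).
apply: cvg_trans; apply: near_eq_cvg; near=> p.
rewrite /riemann /rsum !scaler_sumr -big_split/=; apply: eq_bigr => k _.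
rewrite mE; last exact: measurable_itv.
by rewrite !scalerA -scalerDl -!rmorphM -rmorphD.
Unshelve. all: by end_near. Qed.

End BochnerTheory.

(** * Exponential distributions and the complex exponential *)

Section Exponential.
Variable R : realType.
Local Notation borelR := (measurableTypeR R).
Variables (lam : R) (lam0 : 0 < lam).

Definition expm : {finite_measure set borelR -> \bar R} :=
  exponential_distribution_exponential_prob__canonical__measure_function_FiniteMeasure lam0.

Lemma expm_itv0 (b : R) : 0 <= b ->
  rmeas expm `[0, b[ = 1 - expR (- lam * b).
Proof.
rewrite le_eqVlt => /predU1P[<-|b0].
  by rewrite set_itvco0 /rmeas measure0 mulr0 expR0 subrr.
rewrite /rmeas /= /exponential_prob integral_itv_bndo_bndc.
  by rewrite -/(exponential_prob lam `[0, b]) exponential_prob_itv0c//.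
by apply/measurable_EFinP/measurable_funTS; exact: measurable_exponential_pdf.
Qed.

Lemma expm_itv (a b : R) : 0 <= a -> a <= b ->
  rmeas expm `[a, b[ = expR (- lam * a) - expR (- lam * b).
Proof.
move=> a0 ab; have b0 : 0 <= b by exact: le_trans ab.
have -> : `[a, b[%classic = `[0, b[ `\` `[0, a[ :> set R.
  apply/seteqP; split=> s /=; rewrite !in_itv/=.
    by move=> /andP[sa sb]; rewrite sb (le_trans a0)//; split=> //; rewrite ltNge sa.
  move=> [/andP[s0 sb]]; rewrite s0 sb/= => /negP; rewrite -leNgt => ->//.
rewrite {1}/rmeas measureD; [|exact: measurable_itv|exact: measurable_itv|]; last first.
  by rewrite -ge0_fin_numE// fin_num_measure//; exact: measurable_itv.
rewrite (_ : _ `&` _ = `[0, a[%classic :> set R); last first.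
  apply/setIidPr => s /=; rewrite !in_itv/= => /andP[-> /=].
  by move/lt_le_trans; apply.
rewrite -[X in fine (X - _)%E]rmeasE; last exact: measurable_itv.
rewrite -[X in fine (_ - X)%E]rmeasE; last exact: measurable_itv.
rewrite -EFinB/= !expm_itv0//; ring.
Qed.

Lemma expm_halfline : rmeas expm (@halfline R) <= 1.
Proof.
have eT : expm setT = 1%E by exact: integral_exponential_pdf.
by rewrite -lee_fin rmeasE// -eT; apply: le_measure; rewrite ?inE.
Qed.

End Exponential.

Section ComplexExponential.
Variable R : realType.

Lemma is_derive_right0 (u : R -> R) (l : R) : is_derive (0 : R) (1 : R) u l ->
  h^-1 * (u h - u 0) @[h --> 0^'+] --> l.
Proof.
case=> du Du; have : h^-1 *: ((u \o shift 0) (h *: (1 : R)) - u 0) @[h --> 0^'] --> l.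
  by rewrite -Du; exact: du.
move=> /cvg_dnbhs_at_right; apply: cvg_trans; apply: near_eq_cvg; near=> h.
by rewrite /= /shift/= addr0 /GRing.scale/= mulr1.
Unshelve. all: by end_near. Qed.

Lemma is_derive_scaled0 (f : R -> R) (a l : R) : is_derive (0 : R) (1 : R) f l ->
  is_derive (0 : R) (1 : R) (fun h => f (a * h)) (l * a).
Proof.
move=> df; apply: (@is_derive1_comp _ f (fun h => a * h)); first by rewrite mulr0.
rewrite -[X in is_derive _ _ _ X]mulr1.
have H := @is_deriveZ R R R (@id R) a 0 1 1 (is_derive_id _ _).
exact: H.
Qed.

Lemma expR_slope (a : R) : h^-1 * (expR (a * h) - 1) @[h --> 0^'+] --> a.
Proof.
have := @is_derive_right0 (fun h => expR (a * h)) a.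
rewrite mulr0 expR0; apply; rewrite -[X in is_derive _ _ _ X]mul1r.
by apply: is_derive_scaled0; have := is_derive_expR (0 : R); rewrite expR0.
Qed.

Lemma cexp0 : cexp (0 : R[i]) = 1.
Proof. by rewrite /cexp/= expR0 cos0 sin0 mul1r. Qed.

Lemma cexpD (z w : R[i]) : cexp (z + w) = cexp z * cexp w.
Proof.
case: z w => a b [c d]; rewrite /cexp/= expRD cosD sinD !realC_mul/=.
apply/eqP; rewrite eq_complex/=; apply/andP; split; apply/eqP; ring.
Qed.

Lemma normc_cexp (z : R[i]) : normc (cexp z) = expR (complex.Re z).
Proof.
rewrite /cexp realC_mul/= !exprMn -mulrDr cos2Dsin2 mulr1 sqrtr_sqr.
by rewrite ger0_norm// expR_ge0.
Qed.

Lemma cexp_slope (c : R[i]) :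
  normc ((h^-1)%:C * (cexp (h%:C * c) - 1) - c) @[h --> 0^'+] --> (0 : R).
Proof.
case: c => a b.
have e1 : is_derive (0 : R) (1 : R) (fun h => expR (a * h)) a.
  rewrite -[X in is_derive _ _ _ X]mul1r.
  by apply: is_derive_scaled0; have := is_derive_expR (0 : R); rewrite expR0.
have c1 : is_derive (0 : R) (1 : R) (fun h => cos (b * h)) 0.
  by have := is_derive_scaled0 b (is_derive_cos (0 : R)); rewrite sin0 oppr0 mul0r.
have s1 : is_derive (0 : R) (1 : R) (fun h => sin (b * h)) b.
  by have := is_derive_scaled0 b (is_derive_sin (0 : R)); rewrite cos0 mul1r.
have cRe : h^-1 * (expR (a * h) * cos (b * h) - 1) @[h --> 0^'+] --> a.
  have := is_derive_right0 (is_deriveM e1 c1).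
  rewrite /= (_ : _ *: _ + _ *: _ = a).
    apply: cvg_trans; apply: near_eq_cvg; near=> h.
    by rewrite [X in _ * (X - _)]/GRing.mul/= [X in _ * (_ - X)]/GRing.mul/= !mulr0 expR0 cos0 mulr1.
  by rewrite !mulr0 expR0 cos0 /GRing.scale/= mulr0 add0r mul1r.
have cIm : h^-1 * (expR (a * h) * sin (b * h)) @[h --> 0^'+] --> b.
  have := is_derive_right0 (is_deriveM e1 s1).
  rewrite /= (_ : _ *: _ + _ *: _ = b).
    apply: cvg_trans; apply: near_eq_cvg; near=> h.
    by rewrite [X in _ * (X - _)]/GRing.mul/= [X in _ * (_ - X)]/GRing.mul/= !mulr0 expR0 sin0 mulr0 subr0.
  by rewrite !mulr0 expR0 sin0 /GRing.scale/= mul0r addr0 mul1r.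
apply: (@squeeze_cvgr _ _ _ _ (cst 0) (fun h =>
  `|h^-1 * (expR (a * h) * cos (b * h) - 1) - a| +
  `|h^-1 * (expR (a * h) * sin (b * h)) - b|)).
- near=> h; apply/andP; split; first exact: normc_ge0.
  suff -> : (h^-1)%:C * (cexp (h%:C * (a +i* b)) - 1) - (a +i* b) =
    (h^-1 * (expR (a * h) * cos (b * h) - 1) - a) +i*
    (h^-1 * (expR (a * h) * sin (b * h)) - b) by exact: normc_le.
  rewrite /cexp !realC_mul/= subr0 !(mulrC h); exact: erefl.
- exact: cvg_cst.
- rewrite -[X in _ --> X](addr0 0); apply: cvgD; apply/norm_cvg0P/subr_cvg0 => //.
Unshelve. all: by end_near. Qed.

End ComplexExponential.

(** * Integrals of orbits and the resolvent *)

Section Semigroup.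
Variables (R : realType) (X : completeNormedModType R[i]).
Local Notation borelR := (measurableTypeR R).
Local Notation halfline := (@halfline R).
Variables (T : R -> {linear X -> X}) (M : R).
Hypotheses (HT : C0_semigroup T) (M0 : 0 <= M)
  (TM : forall (t : R) x, 0 <= t -> rnorm (T t x) <= M * rnorm x).
Implicit Types (m : {finite_measure set borelR -> \bar R}) (x y : X).

Lemma orbit_near0 x (e : R) : 0 < e -> exists2 d : R, 0 < d &
  forall h : R, 0 <= h -> h < d -> rnorm (T h x - x) <= e.
Proof.
move=> e0; have : T t x @[t --> 0^'+] --> x by exact: (C0_cvg HT).
move=> /cvg_rnorm/cvgrPdist_le/(_ _ e0) [d /= d0 Hd]; exists d => // h; rewrite le_eqVlt => /predU1P[<-|h0] hd.
  by rewrite C0_zero// subrr rnorm0 ltW.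
have hd' : `|0 - h| < d by rewrite sub0r normrN gtr0_norm.
by have := Hd h hd' h0; rewrite /= sub0r normrN ger0_norm ?rnorm_ge0.
Qed.

Lemma orbit_buc x : buc (fun s => T s x) (M * rnorm x).
Proof.
split=> [s s0|e e0]; first exact: TM.
have e1 : 0 < e / (M + 1) by rewrite divr_gt0// ltr_wpDl.
have [d d0 Hd] := orbit_near0 x e1; exists d => // s h s0 h0 hd.
rewrite C0_add// -linearB (le_trans (TM _ s0))//.
by rewrite (le_trans (ler_wpM2l M0 (Hd h h0 hd)))// mulrC div_succ_mul_le// ltW.
Qed.

Definition hpm m x : X := bochner (fun s => T s x) m.

Lemma hpm_lin m (c : R[i]) x y : hpm m (c *: x + y) = c *: hpm m x + hpm m y.
Proof.
rewrite /hpm -(bochner_lin m c (orbit_buc x) (orbit_buc y)).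
by congr bochner; apply/funext => s; rewrite linearP.
Qed.

Lemma hpm0 m : hpm m 0 = 0.
Proof. by have := hpm_lin m (-1) 0 0; rewrite scaleN1r oppr0 addr0 scaleN1r addNr. Qed.

Lemma hpmD m x y : hpm m (x + y) = hpm m x + hpm m y.
Proof. by have := hpm_lin m 1 x y; rewrite !scale1r. Qed.

Lemma hpmZ m c x : hpm m (c *: x) = c *: hpm m x.
Proof. by have := hpm_lin m c x 0; rewrite hpm0 !addr0. Qed.

Lemma hpmB m x y : hpm m (x - y) = hpm m x - hpm m y.
Proof. by rewrite -scaleN1r hpmD hpmZ scaleN1r. Qed.

Lemma hpm_norm_le m x : rnorm (hpm m x) <= M * rmeas m halfline * rnorm x.
Proof. by rewrite mulrAC; exact: bochner_norm_le1 (orbit_buc x). Qed.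

(** L passes under the integral sign. *)
Lemma hpm_comm m (L : {linear X -> X}) C x : 0 <= C ->
  (forall x, rnorm (L x) <= C * rnorm x) ->
  (forall (s : R) x, 0 <= s -> T s (L x) = L (T s x)) ->
  hpm m (L x) = L (hpm m x).
Proof.
move=> C0 LC LT; rewrite /hpm -(bochner_op m C0 LC (orbit_buc x)).
by apply: eq_bochner (orbit_buc _) _ => s s0; exact: LT.
Qed.

Lemma hpm_semigroup m x t : 0 <= t -> hpm m (T t x) = T t (hpm m x).
Proof.
move=> t0; apply: (@hpm_comm m (T t) M x M0) => [y|s y s0]; first exact: TM.
by rewrite -!(C0_add HT)// addrC.
Qed.

Section Resolvent.
Variables (lam : R) (lam0 : 0 < lam).

Let a (d : R) (k : nat) := expR (- lam * (k%:R * d)).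

Let a_le d k l : 0 <= d -> (k <= l)%N -> a d l <= a d k.
Proof.
move=> d0 kl; rewrite ler_expR !mulNr lerN2 ler_wpM2l ?(ltW lam0)//.
by rewrite ler_wpM2r// ler_nat.
Qed.

Let a_sum d k l : (k <= l)%N ->
  \sum_(k <= i < l) (a d i - a d i.+1) = a d k - a d l.
Proof.
move=> kl; under eq_bigr do rewrite -opprB.
by rewrite sumrN telescope_sumr// opprB.
Qed.

(** With E the integral against the exponential distribution, T h E is the
    integral of the orbit over [h, +oo[ multiplied by exp(lam h).  So
    exp(- lam h) T h E x - E x is minus the integral over [0, h[, which is close
    to (1 - exp(- lam h)) x.  The Riemann sums are taken with a mesh dividing h:
    the shift by h is then a shift of the index by n, and the sums telescope. *)
Lemma hpm_exp_shift x (h w : R) : 0 < h ->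
  (forall s : R, 0 <= s -> s <= h -> rnorm (T s x - x) <= w) ->
  rnorm ((expR (- lam * h))%:C *: T h (hpm (expm lam0) x) - hpm (expm lam0) x
         + (1 - expR (- lam * h))%:C *: x) <= (1 - expR (- lam * h)) * w.
Proof.
move=> h0 Hw; set th := expR (- lam * h); set E := hpm _ _.
have cE := riemann_cvg (m := expm lam0) (orbit_buc x) h0.
have cTE : T h (riemann (expm lam0) (fun s => T s x) h p) @[p --> \oo] --> T h E.
  apply: (@rcvg_le R X nat \oo _ _ _ (fun p => M *
    rnorm (riemann (expm lam0) (fun s => T s x) h p - E))).
    by near=> p; rewrite -linearB TM// ltW.
  rewrite -[X in _ --> X](mulr0 M); apply: cvgM; first exact: cvg_cst.
  by move/cvg_rnorm : cE.
have cF : th%:C *: T h (riemann (expm lam0) (fun s => T s x) h p)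
    - riemann (expm lam0) (fun s => T s x) h p + (1 - th)%:C *: x @[p --> \oo] -->
    th%:C *: T h E - E + (1 - th)%:C *: x.
  by apply: cvgD; [apply: cvgB => //; exact: cvgZr|exact: cvg_cst].
apply: (@rnorm_lim_le R X nat \oo _ _ _ (fun p =>
  expR (- (lam * h) * p.+1%:R) * (M * rnorm x) + (1 - th) * w) _ cF).
  rewrite -[X in _ --> X]add0r; apply: cvgD; last exact: cvg_cst.
  rewrite -(mul0r (M * rnorm x)); apply: cvgM; last exact: cvg_cst.
  under eq_fun do rewrite expRM_natr.
  have e1 : `|expR (- (lam * h))| < 1.
    by rewrite ger0_norm ?expR_ge0// expR_lt1 oppr_lt0 mulr_gt0.
  by have := cvg_expr e1; rewrite -cvg_shiftS.
near=> p.
set d := h / p.+1%:R; set n := p.+1; set N := (n ^ 2)%N.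
have n0 : n%:R != 0 :> R by rewrite pnatr_eq0.
have d0 : 0 < d by rewrite divr_gt0// ltr0n.
have nd : n%:R * d = h by rewrite /d mulrCA divff ?mulr1.
have RE : riemann (expm lam0) (fun s => T s x) h p =
    \sum_(0 <= k < N) (a d k - a d k.+1)%:C *: T (k%:R * d) x.
  rewrite /riemann /rsum big_mkord; apply: eq_bigr => k _.
  rewrite -/d expm_itv//; first by rewrite mulr_ge0// ltW.
  by rewrite ler_wpM2r ?(ltW d0)// ler_nat.
have nN : (n <= N)%N by rewrite /N expnS expn1 leq_pmulr.
have TRE : th%:C *: T h (riemann (expm lam0) (fun s => T s x) h p) =
    \sum_(n <= k < N + n) (a d k - a d k.+1)%:C *: T (k%:R * d) x.
  have shift (F : nat -> X) : \sum_(n <= k < N + n) F k = \sum_(0 <= k < N) F (k + n)%N.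
    by rewrite -{1}[n]add0n big_addn addnK.
  rewrite RE linear_sum scaler_sumr shift.
  apply: eq_bigr => k _; rewrite linearZ scalerA -rmorphM.
  rewrite -(C0_add HT) ?mulr_ge0 ?(ltW h0) ?(ltW d0)//.
  rewrite -nd -mulrDl -natrD [(n + k)%N]addnC; congr (_%:C *: _).
  rewrite /th -nd mulrBr /a -!expRD -!mulrDr -!mulrDl -!natrD.
  by rewrite -addSn ![(n + _)%N]addnC.
rewrite TRE RE [X in _ - X + _](big_cat_nat (m := 0%N) (n := n) (p := N))//= [X in X - _ + _](big_cat_nat (m := n) (n := N) (p := (N + n)%N))//= ?leq_addr//.
have -> : (1 - th)%:C *: x = \sum_(0 <= k < n) (a d k - a d k.+1)%:C *: x.
  rewrite -scaler_suml -rmorph_sum; congr (_%:C *: x).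
  by rewrite a_sum// /a mul0r mulr0 expR0 nd.
set S1 := \sum_(n <= k < N) _; set S2 := \sum_(N <= k < N + n) _.
set S3 := \sum_(0 <= k < n) _ *: T _ _; set S4 := \sum_(0 <= k < n) _.
have -> : S1 + S2 - (S3 + S1) + S4 = S2 - (S3 - S4).
  by rewrite opprB [S3 + S1]addrC opprD addrA [S1 + S2]addrC addrK -addrA [- S3 + S4]addrC.
have a_ge0 k : 0 <= a d k - a d k.+1 by rewrite subr_ge0 a_le// ltW.
have kd0 k : 0 <= k%:R * d by rewrite mulr_ge0// ltW.
rewrite (le_trans (rnormB _ _))// lerD//.
  rewrite (le_trans (rnorm_sum _ _ _))//.
  apply: (@le_trans _ _ (\sum_(N <= k < N + n) (a d k - a d k.+1) * (M * rnorm x))).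
    apply: ler_sum => k _.
    by rewrite rnormZr ger0_norm// ler_wpM2l//; exact: TM.
  rewrite -mulr_suml a_sum ?leq_addr// ler_wpM2r ?mulr_ge0 ?rnorm_ge0//.
  rewrite lerBlDr (_ : a d N = expR (- (lam * h) * n%:R)) ?lerDl ?expR_ge0//.
  by rewrite /a /N natrX expr2 -mulrA nd; congr expR; ring.
rewrite /S3 /S4 -sumrB (le_trans (rnorm_sum _ _ _))//.
apply: (@le_trans _ _ (\sum_(0 <= k < n) (a d k - a d k.+1) * w)).
  rewrite big_nat [leRHS]big_nat; apply: ler_sum => k /andP[_ kn].
  rewrite -scalerBr rnormZr ger0_norm// ler_wpM2l// Hw//.
  by rewrite -nd ler_wpM2r ?(ltW d0)// ler_nat ltnW.
by rewrite -mulr_suml a_sum// /a mul0r mulr0 expR0 nd.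
Unshelve. all: by end_near. Qed.

End Resolvent.

End Semigroup.

Section ResolventTheory.
Variables (R : realType) (X : completeNormedModType R[i]).
Variables (T : R -> {linear X -> X}) (M : R).
Hypotheses (HT : C0_semigroup T) (M0 : 0 <= M)
  (TM : forall (t : R) x, 0 <= t -> rnorm (T t x) <= M * rnorm x).
Implicit Types (x y : X).

Lemma generator_lin (c : R[i]) x y x' y' : generator T (x, x') ->
  generator T (y, y') -> generator T (c *: x + y, c *: x' + y').
Proof.
rewrite /generator/= => gx gy.
have : c *: ((h^-1)%:C *: (T h x - x)) + (h^-1)%:C *: (T h y - y) @[h --> 0^'+] -->
    c *: x' + y' by apply: cvgD => //; exact: cvgZr.
apply: cvg_trans; apply: near_eq_cvg; near=> h.
have -> : T h (c *: x + y) - (c *: x + y) = c *: (T h x - x) + (T h y - y).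
  by rewrite linearP opprD addrACA scalerBr.
by rewrite (scalerDr (h^-1)%:C (c *: (T h x - x))) !scalerA mulrC.
Unshelve. all: by end_near. Qed.

Lemma generator_unique x y y' : generator T (x, y) -> generator T (x, y') -> y = y'.
Proof.
move=> h1 h2; apply: (cvg_unique (@norm_hausdorff _ X) h1 h2).
Qed.

Variables (lam : R) (lam0 : 0 < lam).
Local Notation E := (hpm T (expm lam0)).

(** E = lam (lam + A)^-1: division of [hpm_exp_shift] by h, and h -> 0. *)
Lemma generator_hpm_exp x : generator T (E x, lam%:C *: (E x - x)).
Proof.
rewrite /generator/=; apply/cvg_rnorm/cvgrPdist_le => e e0.
have e1 : 0 < e / 2 / (lam + 1) by rewrite !divr_gt0// ltr_wpDl// ltW.
have e2 : 0 < e / 2 / (rnorm (E x - x) + 1).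
  by rewrite !divr_gt0// ltr_wpDl// rnorm_ge0.
have [d d0 Hd] := orbit_near0 HT x e1.
near=> h.
have h0 : 0 < h by near: h; exact: nbhs_right_gt.
have hd : h < d by near: h; exact: nbhs_right_lt.
have : `|lam - h^-1 * (expR (lam * h) - 1)| < 1.
  by near: h; move/cvgrPdist_lt : (@expR_slope R lam); apply.
have : `|lam - h^-1 * (expR (lam * h) - 1)| < e / 2 / (rnorm (E x - x) + 1).
  by near: h; move/cvgrPdist_lt : (@expR_slope R lam); apply.
set k := h^-1 * (expR (lam * h) - 1) => kl kl1.
have k1 : k <= lam + 1 by move: kl1; rewrite ltr_norml => /andP[+ _]; lra.
have k0 : 0 <= k.
  by rewrite mulr_ge0 ?invr_ge0 ?(ltW h0)// subr_ge0 ltW// expR_gt1 mulr_gt0.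
rewrite sub0r normrN ger0_norm ?rnorm_ge0//.
have Hw (s : R) : 0 <= s -> s <= h -> rnorm (T s x - x) <= e / 2 / (lam + 1).
  by move=> s0 sh; apply: Hd => //; exact: le_lt_trans hd.
have := hpm_exp_shift HT M0 TM lam0 h0 Hw.
set th := expR (- lam * h); set Z := _ + _ => HZ.
have th0 : 0 < th by exact: expR_gt0.
have thk : k = (h * th)^-1 * (1 - th).
  have -> : k = h^-1 * (th^-1 - 1) by rewrite /k /th mulNr expRN invrK.
  by field; rewrite !gt_eqF.
have -> : (h^-1)%:C *: (T h (E x) - E x) - lam%:C *: (E x - x) =
    ((h * th)^-1)%:C *: Z + (k - lam)%:C *: (E x - x).
  rewrite rmorphB scalerBl thk /Z.
  rewrite addrA; congr (_ - _).
  rewrite rmorphM -scalerA -scalerDr.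
  have -> : th%:C *: T h (E x) - E x + (1 - th)%:C *: x + (1 - th)%:C *: (E x - x) =
    th%:C *: (T h (E x) - E x).
    rewrite (scalerBr (1 - th)%:C) addrA addrAC addrK.
    by rewrite rmorphB scalerBl scale1r addrA subrK scalerBr.
  by rewrite scalerA -rmorphM invfM mulfVK// gt_eqF.
rewrite (le_trans (rnormD _ _))// !rnormZr [leRHS](splitr e) lerD//.
  have iv : 0 <= (h * th)^-1 by rewrite invr_ge0 mulr_ge0// ltW.
  rewrite (ger0_norm iv).
  apply: (@le_trans _ _ (k * (e / 2 / (lam + 1)))).
    by rewrite thk -mulrA ler_wpM2l.
  rewrite (le_trans (ler_wpM2r (ltW e1) k1))//.
  by rewrite mulrC divfK// gt_eqF// ltr_wpDl// ltW.
rewrite distrC (le_trans (ler_wpM2r (rnorm_ge0 _) (ltW kl)))//.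
by rewrite div_succ_mul_le ?rnorm_ge0// ltW// divr_gt0.
Unshelve. all: by end_near. Qed.

(** E commutes with the semigroup and is bounded, so it commutes with the
    generator on its domain; then [generator_hpm_exp] and the uniqueness of the
    derivative at 0 apply. *)
Lemma hpm_exp_generator x y : generator T (x, y) -> E (lam%:C *: x - y) = lam%:C *: x.
Proof.
move=> gxy; rewrite (hpmB HT M0 TM) (hpmZ HT M0 TM).
suff -> : E y = lam%:C *: (E x - x) by rewrite scalerBr subKr.
suff h1 : generator T (E x, E y) by exact: generator_unique h1 (@generator_hpm_exp x).
rewrite /generator/=.
set C := M * rmeas (expm lam0) (@halfline R).
apply: (@rcvg_le _ _ _ _ _ _ _ (fun h =>
  C * rnorm ((h^-1)%:C *: (T h x - x) - y))).
  near=> h.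
  have h0 : 0 <= h by apply: ltW; near: h; exact: nbhs_right_gt.
  rewrite -(hpm_semigroup HT M0 TM)// -(hpmB HT M0 TM) -(hpmZ HT M0 TM).
  by rewrite -(hpmB HT M0 TM) (hpm_norm_le HT M0 TM).
rewrite -[X in _ --> X](mulr0 C); apply: cvgM; first exact: cvg_cst.
by move/cvg_rnorm : gxy.
Unshelve. all: by end_near. Qed.

End ResolventTheory.

(** * Approximate eigenvectors at imaginary spectral points *)

Section Twist.
Variables (R : realType) (X : completeNormedModType R[i]).
Implicit Types (T : R -> {linear X -> X}) (x y : X) (c : R[i]).

(** The semigroup of A - c.  It moves the spectral point i s to 0. *)
Definition twist c T (t : R) : {linear X -> X} := cexp (t%:C * c) \*: T t.

Lemma twistE c T t x : twist c T t x = cexp (t%:C * c) *: T t x.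
Proof. by []. Qed.

Lemma cexp_cvg1 c : normc (cexp (h%:C * c) - 1) @[h --> 0^'+] --> (0 : R).
Proof.
apply: (@squeeze_cvgr _ _ _ _ (cst 0) (fun h : R =>
  h * (normc ((h^-1)%:C * (cexp (h%:C * c) - 1) - c) + normc c))).
- near=> h; have h0 : 0 < h by near: h; exact: nbhs_right_gt.
  apply/andP; split; first exact: normc_ge0.
  set z := _ * _ - c.
  have -> : cexp (h%:C * c) - 1 = h%:C * (z + c).
    by rewrite subrK mulrA -rmorphM mulfV ?gt_eqF// mul1r.
  rewrite normcM normc_real gtr0_norm// ler_wpM2l ?(ltW h0)//.
  exact: le_normcD.
- exact: cvg_cst.
- rewrite -[X in _ --> X](mul0r (0 + normc c)); apply: cvgM.
    by apply: cvg_at_right_filter; exact: cvg_id.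
  by apply: cvgD; [exact: cexp_slope|exact: cvg_cst].
Unshelve. all: by end_near. Qed.

Lemma twist_cvg c T : C0_semigroup T ->
  forall x, twist c T t x @[t --> 0^'+] --> x.
Proof.
move=> HT x.
have cT : T t x @[t --> 0^'+] --> x by exact: (C0_cvg HT).
apply: (@rcvg_le R X R (at_right 0) _ _ _ (fun t =>
  (normc (cexp (t%:C * c) - 1) + 1) * rnorm (T t x - x) +
  normc (cexp (t%:C * c) - 1) * rnorm x)).
  near=> t; rewrite twistE.
  have -> : cexp (t%:C * c) *: T t x - x =
    cexp (t%:C * c) *: (T t x - x) + (cexp (t%:C * c) - 1) *: x.
    by rewrite scalerBr scalerBl scale1r addrA subrK.
  rewrite (le_trans (rnormD _ _))// !rnormZ lerD2r ler_wpM2r ?rnorm_ge0//.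
  by have := le_normcD (cexp (t%:C * c) - 1) 1; rewrite subrK (normc_real 1) normr1.
have c1 := cexp_cvg1 c; have /cvg_rnorm c2 := cT.
rewrite -[X in _ --> X](addr0 0) -[X in _ --> X + _](mulr0 (0 + 1)) -[X in _ --> _ + X](mul0r (rnorm x)).
apply: cvgD; apply: cvgM => //; last exact: cvg_cst.
by apply: cvgD => //; exact: cvg_cst.
Unshelve. all: by end_near. Qed.

Lemma twist_C0 c T : C0_semigroup T -> C0_semigroup (twist c T).
Proof.
move=> HT; split.
- by move=> t t0 x; apply: cvgZr; exact: (C0_bounded_op HT).
- by move=> x; rewrite twistE mul0r cexp0 scale1r (C0_zero HT).
- move=> s t x s0 t0; rewrite !twistE linearZ/= (C0_add HT)// scalerA -cexpD.
  by rewrite rmorphD mulrDl.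
- exact: twist_cvg.
Qed.

Lemma twist_le c T M : complex.Re c <= 0 ->
  (forall (t : R) x, 0 <= t -> rnorm (T t x) <= M * rnorm x) ->
  forall (t : R) x, 0 <= t -> rnorm (twist c T t x) <= M * rnorm x.
Proof.
move=> c0 TM t x t0; rewrite twistE rnormZ normc_cexp realC_mul/=.
rewrite (le_trans _ (TM t x t0))// ler_piMl ?rnorm_ge0//.
by rewrite expR_le1 mulr_ge0_le0.
Qed.

Lemma generator_twist c T x y : C0_semigroup T ->
  generator T (x, y) -> generator (twist c T) (x, c *: x + y).
Proof.
rewrite /generator/= => HT gxy.
have cT : T t x @[t --> 0^'+] --> x by exact: (C0_cvg HT).
have cs : ((h^-1)%:C * (cexp (h%:C * c) - 1)) *: T h x @[h --> 0^'+] --> c *: x.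
  apply: (@rcvg_le R X R (at_right 0) _ _ _ (fun h =>
    normc ((h^-1)%:C * (cexp (h%:C * c) - 1) - c) * (rnorm (T h x - x) + rnorm x) +
    normc c * rnorm (T h x - x))).
    near=> h; set k := _ * _.
    have -> : k *: T h x - c *: x = (k - c) *: (T h x - x + x) + c *: (T h x - x).
      by rewrite subrK scalerBl scalerBr addrA subrK.
    rewrite (le_trans (rnormD _ _))// !rnormZ lerD2r ler_wpM2l ?normc_ge0//.
    exact: rnormD.
  have c1 := cexp_slope c; have /cvg_rnorm c2 := cT.
  rewrite -[X in _ --> X](addr0 0) -[X in _ --> X + _](mul0r (0 + rnorm x)).
  rewrite -[X in _ --> _ + X](mulr0 (normc c)).
  apply: cvgD; apply: cvgM => //.
    by apply: cvgD => //; exact: cvg_cst.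
  exact: cvg_cst.
have : ((h^-1)%:C * (cexp (h%:C * c) - 1)) *: T h x + (h^-1)%:C *: (T h x - x)
    @[h --> 0^'+] --> c *: x + y by exact: cvgD.
apply: cvg_trans; apply: near_eq_cvg; near=> h.
rewrite -scalerA -scalerDr; congr (_ *: _).
by rewrite scalerBl scale1r addrA subrK.
Unshelve. all: by end_near. Qed.

Lemma twistK c T t x : twist (- c) (twist c T) t x = T t x.
Proof. by rewrite !twistE scalerA -cexpD mulrN addNr cexp0 scale1r. Qed.

Lemma generator_twistP c T x y : C0_semigroup T ->
  generator (twist c T) (x, y) <-> generator T (x, y - c *: x).
Proof.
move=> HT; split=> [gS|gT].
  have := @generator_twist (- c) _ _ _ (twist_C0 c HT) gS.
  rewrite scaleNr addrC /generator/=; apply: cvg_trans; apply: near_eq_cvg; near=> h.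
  by have := twistK c T h x; rewrite /twist/= => ->.
by have := @generator_twist c _ _ _ HT gT; rewrite addrC subrK.
Unshelve. all: by end_near. Qed.

End Twist.

Section Neumann.
Variables (R : realType) (X : completeNormedModType R[i]).
Variables (L : X -> X).
Hypotheses (LB : forall x y, L (x - y) = L x - L y)
  (L2 : forall x, rnorm (L x) <= 2^-1 * rnorm x).

(** The iterates of w |-> L w + b from 0 are the partial sums of the Neumann
    series of (1 - L)^-1 b. *)
Lemma neumann (b : X) : exists w, w = L w + b.
Proof.
pose u n := iter n (fun w => L w + b) 0.
have uS n : rnorm (u n.+1 - u n) <= 2^-1 ^+ n * rnorm b.
  elim: n => [|n IHn].
    have L0 : L 0 = 0 by have := LB 0 0; rewrite subrr => ->; rewrite subrr.
    by rewrite /u/= L0 add0r subr0 expr0 mul1r.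
  rewrite /u/= -/(u n) -/(u n.+1) opprD addrACA subrr addr0 -LB.
  by rewrite (le_trans (L2 _))// exprS -mulrA ler_wpM2l// invr_ge0.
have ud n k : rnorm (u (n + k)%N - u n) <= 2 * 2^-1 ^+ n * rnorm b.
  suff : rnorm (u (n + k)%N - u n) <= 2 * (1 - 2^-1 ^+ k) * 2^-1 ^+ n * rnorm b.
    move/le_trans; apply; rewrite ler_wpM2r ?rnorm_ge0// ler_wpM2r ?exprn_ge0//.
    by rewrite ler_piMr// gerBl exprn_ge0.
  elim: k => [|k IHk]; first by rewrite addn0 subrr rnorm0 expr0 subrr mulr0 !mul0r.
  rewrite (le_trans (rnorm_triangle (u (n + k)%N) _ _))//.
  have := uS (n + k)%N; rewrite -addnS exprD => h.
  rewrite (le_trans (lerD h IHk))// -mulrDl ler_wpM2r ?rnorm_ge0//.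
  by rewrite [X in _ <= 2 * (1 - X) * _]exprS; lra.
have [e e0|w uw] := @cauchy_rnorm R X u.
  have : (2^-1 : R) ^+ n * (2 * rnorm b) @[n --> \oo] --> (0 : R).
    rewrite -[X in _ --> X](mul0r (2 * rnorm b)); apply: cvgM; last exact: cvg_cst.
    by apply: cvg_expr; rewrite ger0_norm// invf_lt1// ltr1n.
  have e20 : 0 < e / 2 by rewrite divr_gt0.
  move=> /cvgrPdist_lt/(_ _ e20)[N _ HN]; exists N => m n Nm Nn.
  (* the tail of the geometric series from N on is at most 2 (1 / 2)^N *)
  have := HN N (leqnn N); rewrite /= sub0r normrN ger0_norm ?mulr_ge0 ?exprn_ge0 ?rnorm_ge0//.
  rewrite mulrCA mulrA => hN.
  rewrite (le_lt_trans (rnorm_triangle (u N) _ _))// [ltRHS](splitr e) ltrD//.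
    by rewrite -(subnKC Nm) (le_lt_trans (ud _ _)).
  by rewrite rnormBC -(subnKC Nn) (le_lt_trans (ud _ _)).
exists w; have uw1 : u n.+1 @[n --> \oo] --> w.
  by have := uw; rewrite -cvg_shiftS.
apply: (norm_cvg_unique uw1).
rewrite /u/=; apply: cvgD; last exact: cvg_cst.
apply: (@rcvg_le R X nat \oo _ _ _ (fun n => 2^-1 * rnorm (u n - w))).
  by near=> n; rewrite -LB L2.
rewrite -[X in _ --> X](mulr0 (2^-1 : R)); apply: cvgM; first exact: cvg_cst.
by move/cvg_rnorm : uw.
Unshelve. all: by end_near. Qed.

End Neumann.

Section ApproximateEigenvector.
Variables (R : realType) (X : completeNormedModType R[i]).
Implicit Types (x y : X).

(** For small d > 0 the resolvent (d + A)^-1 exists.  If the generator is bounded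
    below by eta and d = eta / 3, then E = d (d + A)^-1 has norm at most 1 / 2,
    so 1 - E is onto by the Neumann series; and the generator maps E w to
    - d (w - E w). *)
Lemma generator_surj (S : R -> {linear X -> X}) (M eta : R) :
  C0_semigroup S -> 0 <= M ->
  (forall (t : R) x, 0 <= t -> rnorm (S t x) <= M * rnorm x) ->
  0 < eta -> (forall x y, generator S (x, y) -> eta * rnorm x <= rnorm y) ->
  forall y, exists z, generator S (z, y).
Proof.
move=> HS M0 SM eta0 low y.
(* eta / 3 is the largest d with d / (eta - d) <= 1 / 2 *)
have d0 : 0 < eta / 3 by rewrite divr_gt0.
pose E := hpm S (expm d0).
have E2 x : rnorm (E x) <= 2^-1 * rnorm x.
  have := low _ _ (@generator_hpm_exp _ _ _ _ HS M0 SM _ d0 x); rewrite -/E => h.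
  have h2 : eta * rnorm (E x) <= eta / 3 * (rnorm (E x) + rnorm x).
    apply: (le_trans h); rewrite rnormZr (gtr0_norm d0) ler_wpM2l ?(ltW d0)//.
    exact: rnormB.
  by move: h2; rewrite -mulrA (ler_pM2l eta0); lra.
have EB x x' : E (x - x') = E x - E x' by exact: (hpmB HS M0 SM).
have [w wE] := neumann EB E2 (- (((eta / 3)^-1)%:C *: y)).
exists (E w); have := @generator_hpm_exp _ _ _ _ HS M0 SM _ d0 w.
rewrite -/E {3}wE opprD opprK addrA subrr add0r scalerA -rmorphM mulfV ?scale1r//.
by rewrite gt_eqF.
Qed.

Variables (T : R -> {linear X -> X}) (A : set (X * X)) (M : R).
Hypotheses (HT : C0_semigroup T) (M0 : 0 <= M)
  (TM : forall (t : R) x, 0 <= t -> rnorm (T t x) <= M * rnorm x)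
  (genA : op_scale (-1) A = generator T).

Lemma resolvent_of_bounded_below (s eta : R) : 0 < eta ->
  (forall x y, generator T (x, y) ->
     eta * rnorm x <= rnorm ((0 +i* s) *: x + y)) ->
  resolvent_set A (0 +i* s).
Proof.
move=> eta0 low; set c := 0 +i* s in low *.
have HS := twist_C0 c HT.
have SM := @twist_le _ _ c T M (lexx 0) TM.
have lowS x y : generator (twist c T) (x, y) -> eta * rnorm x <= rnorm y.
  by move=> /(generator_twistP c _ _ HT) /low; rewrite addrC subrK.
have surj y := generator_surj HS M0 SM eta0 lowS y.
have [B HB] := choice surj.
have uniq x z : generator (twist c T) (z, x) -> z = B x.
  move=> h; apply/eqP; rewrite -subr_eq0; apply/eqP/rnorm0_eq0.
  have := @generator_lin _ _ _ (-1) _ _ _ _ (HB x) h; rewrite !scaleN1r addNr => /lowS.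
  rewrite rnorm0 pmulr_rle0// addrC => h0; apply/eqP; rewrite eq_le h0/=.
  exact: rnorm_ge0.
have linB : linear B.
  by move=> a x y; apply/esym/uniq; exact: generator_lin.
pose B' : {linear X -> X} := HB.pack B (GRing.isLinear.Build _ _ _ _ B linB).
exists B'; split.
  move=> x; apply: (@rcvg_le R X X (nbhs x) _ _ _ (fun y => eta^-1 * rnorm (y - x))).
    near=> y; have := lowS _ _ (HB (y - x)).
    by rewrite -[B (y - x)]/(B' (y - x)) linearB -ler_pdivlMl.
  rewrite -[X in _ --> X](mulr0 eta^-1); apply: cvgM; first exact: cvg_cst.
  by apply/cvg_rnorm; exact: cvg_id.
rewrite genA; apply/seteqP; split => [[x z]|[x z]].
  move=> [y [w [[y' /= y'E yE] gw /= xE]]].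
  have {y'E}yz : y' = z := y'E; have {yE}yE : y = c *: y' := yE.
  have {xE}xE : x = y + w := xE; rewrite /op_graph/= xE yE yz.
  by apply: uniq; apply/(generator_twistP c _ _ HT); rewrite addrC addKr.
rewrite /op_graph/op_inv/= => ->; exists (c *: B x), (x - c *: B x); split.
- by exists (B x).
- by apply/(generator_twistP c _ _ HT); exact: HB.
- by rewrite addrC subrK.
Unshelve. all: by end_near. Qed.

(** If no such vectors existed, i s - A would be bounded below; as i s is a limit
    of the resolvent points i s - d, it would then be invertible. *)
Lemma approximate_eigenvector (s eta : R) : 0 < eta -> spectrum A (0 +i* s) ->
  exists x y, [/\ generator T (x, y), rnorm x = 1 & rnorm ((0 +i* s) *: x + y) <= eta].
Proof.
move=> eta0 sA; apply: contrapT => noh; apply: sA.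
apply: (@resolvent_of_bounded_below s eta eta0) => x y gxy.
rewrite leNgt; apply/negP => h; apply: noh.
have x0 : 0 < rnorm x.
  rewrite lt_neqAle rnorm_ge0 andbT; apply/eqP => /esym x0.
  by move: h; rewrite x0 mulr0 ltNge rnorm_ge0.
exists (((rnorm x)^-1)%:C *: x), (((rnorm x)^-1)%:C *: y); split.
- have g0 : generator T (0, 0).
    rewrite /generator/=; under eq_cvg do rewrite linear0 subrr scaler0.
    exact: cvg_cst.
  by have := @generator_lin _ _ _ ((rnorm x)^-1)%:C _ _ _ _ gxy g0; rewrite !addr0.
- by rewrite rnormZr ger0_norm ?invr_ge0 ?rnorm_ge0// mulVf// gt_eqF.
- rewrite scalerA [X in X *: x]mulrC -scalerA -scalerDr rnormZr.
  rewrite ger0_norm ?invr_ge0 ?rnorm_ge0// mulrC ler_pdivrMr// ltW//.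
Qed.

End ApproximateEigenvector.

(** * The algebra of Laplace transforms of finite measures *)

Section ProductPush.
Variable R : realType.
Local Notation borelR := (measurableTypeR R).
Local Notation halfline := (@halfline R).
Implicit Types (m : {finite_measure set borelR -> \bar R}).

Lemma integral_mrestr_halfline (mu : {measure set borelR -> \bar R})
    (f : borelR -> \bar R) : measurable_fun [set: borelR] f ->
  (\int[mrestr mu (@measurable_halfline R)]_x f x = \int[mu]_(x in halfline) f x)%E.
Proof.
move=> mf; rewrite -(setUv halfline) integral_setU//; last 3 first.
- exact: measurableC.
- by rewrite setUv.
- exact/disj_setPCl.
rewrite [X in (_ + X)%E](eq_measure_integral mzero); last first.
  move=> A mA Ah; rewrite /= /mrestr (_ : A `&` _ = set0) ?measure0//.
  by rewrite -subset0 => s [/Ah].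
rewrite integral_measure_zero adde0; apply: eq_measure_integral => A mA Ah.
by rewrite /= /mrestr setIidl.
Qed.

Definition hrestr m : {finite_measure set borelR -> \bar R} :=
  mrestr m (@measurable_halfline R).

Lemma integral_hrestr m (f : borelR -> \bar R) :
  measurable_fun [set: borelR] f ->
  (\int[hrestr m]_x f x = \int[m]_(x in halfline) f x)%E.
Proof. exact: integral_mrestr_halfline. Qed.

Variables (m1 m2 : {finite_measure set borelR -> \bar R}).
Variable phi : borelR * borelR -> borelR.
Hypotheses (mphi : measurable_fun [set: borelR * borelR] phi)
  (phi0 : forall p, (0 : R) <= phi p).

Let P : {measure set (borelR * borelR) -> \bar R} := (hrestr m1 \x hrestr m2)%E.

Let Q : {measure set borelR -> \bar R} :=
  measure_function_pushforward__canonical__measure_function_Measure P mphi.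

Let P_fin : (P setT < +oo)%E.
Proof.
rewrite -setXTT /P /= product_measure1E//.
by rewrite -ge0_fin_numE ?mule_ge0// fin_numM// fin_num_measure.
Qed.

Let Q_fin : (Q halfline < +oo)%E.
Proof.
apply: le_lt_trans P_fin; rewrite /Q /= /pushforward.
apply: (@le_measure _ _ _ P); rewrite ?inE//.
by rewrite -[X in measurable X]setTI; exact: mphi.
Qed.

(** The image under phi of the product of the two measures, both restricted to
    the half-line.  For phi the addition this is the convolution. *)
Definition prod_push : {finite_measure set borelR -> \bar R} :=
  mfrestr (@measurable_halfline R) Q_fin.

Lemma prod_push_integral (u : R -> R) K : @measurable_fun _ _ borelR borelR setT u ->
  (forall s, `|u s| <= K) ->
  \int[prod_push]_(s in halfline) u s =
  \int[m1]_(x in halfline) \int[m2]_(y in halfline) u (phi (x, y)).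
Proof.
move=> mu uK.
have muphi : measurable_fun setT (u \o phi) by exact: measurableT_comp.
have my x : @measurable_fun _ _ borelR borelR setT (fun y => u (phi (x, y))).
  exact: (measurable_fun_pair2 x muphi).
have iy x : m2.-integrable halfline (EFin \o (fun y => u (phi (x, y)))).
  by apply: (@bounded_integrable _ _ _ m2 halfline _ K) => //;
    apply: measurable_funTS; exact: my.
rewrite /Rintegral.
have -> : (\int[prod_push]_(s in halfline) (u s)%:E =
    \int[Q]_(s in halfline) (u s)%:E)%E.
  by apply: eq_measure_integral => A mA Ah; rewrite /prod_push /= /mfrestr /mrestr setIidl.
have iP : P.-integrable setT (EFin \o (u \o phi)).
  apply: measurable_bounded_integrable => //.
  by exists K; split; [exact: num_real|move=> M KM x _ /=; rewrite (le_trans (uK _))// ltW].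
have phiH : phi @^-1` halfline = setT.
  by apply/seteqP; split=> // p _; rewrite /Defs.halfline /= in_itv/= phi0.
rewrite integral_pushforward//=; last 2 first.
- by apply/measurable_EFinP.
- by rewrite phiH.
rewrite phiH -integral12_prod_meas1// /fubini_F.
rewrite integral_hrestr; last first.
  have := measurable_fubini_F iP; exact.
congr fine; apply: eq_integral => x _.
rewrite (integral_hrestr m2); last by apply/measurable_EFinP; exact: my.
by rewrite fineK//; have := integrable_fin_num _ (iy x); apply.
Qed.

End ProductPush.

Section ScalarIntegral.
Variable R : realType.
Local Notation borelR := (measurableTypeR R).
Local Notation halfline := (@halfline R).
Implicit Types (m : {finite_measure set borelR -> \bar R}) (g h : R -> R[i]).

Definition cbm g : Prop := exists K : R,
  [/\ @measurable_fun _ _ borelR borelR halfline (fun s => complex.Re (g s)),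
      @measurable_fun _ _ borelR borelR halfline (fun s => complex.Im (g s))
    & forall s : R, 0 <= s -> normc (g s) <= K].

Lemma halflineE (s : R) : halfline s = (0 <= s) :> Prop.
Proof. by rewrite /Defs.halfline/= in_itv/= andbT. Qed.

Lemma cbm_integrable m g : cbm g ->
  m.-integrable halfline (EFin \o (fun s => complex.Re (g s))) /\
  m.-integrable halfline (EFin \o (fun s => complex.Im (g s))).
Proof.
move=> [K [mRe mIm gK]]; split.
  apply: (@bounded_integrable _ _ _ m halfline _ K) => // s; rewrite halflineE => s0.
  by rewrite (le_trans (normr_Re_le _))// gK.
apply: (@bounded_integrable _ _ _ m halfline _ K) => // s; rewrite halflineE => s0.
by rewrite (le_trans (normr_Im_le _))// gK.
Qed.

Lemma eq_scalar_int m g h : (forall s : R, 0 <= s -> g s = h s) ->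
  scalar_int g m = scalar_int h m.
Proof.
move=> gh; rewrite /scalar_int.
have -> : \int[m]_(s in halfline) complex.Re (g s) = \int[m]_(s in halfline) complex.Re (h s).
  by apply: eq_Rintegral => s; rewrite inE halflineE => s0; rewrite gh.
congr Complex.
by apply: eq_Rintegral => s; rewrite inE halflineE => s0; rewrite gh.
Qed.

Lemma scalar_intZ m (c : R[i]) g : cbm g ->
  scalar_int (fun s => c * g s) m = c * scalar_int g m.
Proof.
move=> /(cbm_integrable m)[iRe iIm]; case: c => a b; rewrite /scalar_int.
have E1 : \int[m]_(s in halfline) complex.Re ((a +i* b) * g s) =
    a * \int[m]_(s in halfline) complex.Re (g s) - b * \int[m]_(s in halfline) complex.Im (g s).
  rewrite -!RintegralZl// -RintegralB//; last 2 first.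
  - by have := integrableZl (@measurable_halfline R) a iRe; apply: eq_integrable.
  - by have := integrableZl (@measurable_halfline R) b iIm; apply: eq_integrable.
  by apply: eq_Rintegral => s _; case: (g s).
have E2 : \int[m]_(s in halfline) complex.Im ((a +i* b) * g s) =
    a * \int[m]_(s in halfline) complex.Im (g s) + b * \int[m]_(s in halfline) complex.Re (g s).
  rewrite -!RintegralZl// -RintegralD//; last 2 first.
  - by have := integrableZl (@measurable_halfline R) a iIm; apply: eq_integrable.
  - by have := integrableZl (@measurable_halfline R) b iRe; apply: eq_integrable.
  by apply: eq_Rintegral => s _; case: (g s).
by rewrite E1 E2.
Qed.

Lemma scalar_intD m g h : cbm g -> cbm h ->
  scalar_int (fun s => g s + h s) m = scalar_int g m + scalar_int h m.
Proof.
move=> /(cbm_integrable m)[iRe iIm] /(cbm_integrable m)[jRe jIm]; rewrite /scalar_int.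
have E1 : \int[m]_(s in halfline) complex.Re (g s + h s) =
    \int[m]_(s in halfline) complex.Re (g s) + \int[m]_(s in halfline) complex.Re (h s).
  by rewrite -RintegralD//; apply: eq_Rintegral => s _; case: (g s) (h s) => ? ? [].
have E2 : \int[m]_(s in halfline) complex.Im (g s + h s) =
    \int[m]_(s in halfline) complex.Im (g s) + \int[m]_(s in halfline) complex.Im (h s).
  by rewrite -RintegralD//; apply: eq_Rintegral => s _; case: (g s) (h s) => ? ? [].
by rewrite E1 E2.
Qed.

Lemma cbm_cst (c : R[i]) : cbm (fun=> c).
Proof. by exists (normc c); split=> //; exact: measurable_cst. Qed.

Lemma cbmD g h : cbm g -> cbm h -> cbm (fun s => g s + h s).
Proof.
move=> [K [gR gI gK]] [L [hR hI hL]]; exists (K + L); split.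
- apply: (eq_measurable_fun (fun s => complex.Re (g s) + complex.Re (h s))).
    by move=> s _; case: (g s) (h s) => ? ? [].
  exact: measurable_funD.
- apply: (eq_measurable_fun (fun s => complex.Im (g s) + complex.Im (h s))).
    by move=> s _; case: (g s) (h s) => ? ? [].
  exact: measurable_funD.
- by move=> s s0; rewrite (le_trans (le_normcD _ _))// lerD ?gK ?hL.
Qed.

Lemma cbmM g h : cbm g -> cbm h -> cbm (fun s => g s * h s).
Proof.
move=> [K [gR gI gK]] [L [hR hI hL]]; exists (K * L); split.
- apply: (eq_measurable_fun (fun s => complex.Re (g s) * complex.Re (h s)
    - complex.Im (g s) * complex.Im (h s))).
    by move=> s _; case: (g s) (h s) => ? ? [].
  by apply: measurable_funB; exact: measurable_funM.
- apply: (eq_measurable_fun (fun s => complex.Re (g s) * complex.Im (h s)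
    + complex.Im (g s) * complex.Re (h s))).
    by move=> s _; case: (g s) (h s) => ? ? [].
  by apply: measurable_funD; exact: measurable_funM.
- by move=> s s0; rewrite normcM ler_pM ?normc_ge0 ?gK ?hL.
Qed.

Lemma scalar_int_norm_le m g (K : R) : cbm g -> 0 <= K ->
  (forall s : R, 0 <= s -> normc (g s) <= K) ->
  normc (scalar_int g m) <= 2 * (K * rmeas m halfline).
Proof.
move=> cg K0 gK; rewrite (le_trans (normc_le _))//= mulr2n mulrDl mul1r.
have [iRe iIm] := cbm_integrable m cg.
have H u : m.-integrable halfline (EFin \o u) -> (forall s : R, 0 <= s -> `|u s| <= K) ->
    `|\int[m]_(s in halfline) u s| <= K * rmeas m halfline.
  move=> iu uK; rewrite (le_trans (le_normr_Rintegral _ iu))//.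
  rewrite /rmeas -Rintegral_cst//; apply: le_Rintegral => //.
  - by have := integrable_abse iu; apply: eq_integrable.
  - apply: (@bounded_integrable _ _ _ m halfline _ K) => // s _.
    by rewrite /cst/= ger0_norm.
  - by move=> s; rewrite halflineE; exact: uK.
by apply: lerD; apply: H => // s s0; [rewrite (le_trans (normr_Re_le _))|
  rewrite (le_trans (normr_Im_le _))]; rewrite ?gK.
Qed.

End ScalarIntegral.

Section LaplaceTransforms.
Variable R : realType.
Local Notation borelR := (measurableTypeR R).
Local Notation halfline := (@halfline R).
Implicit Types (m : {finite_measure set borelR -> \bar R}) (z : R[i]).

Definition ez z (s : R) : R[i] := cexp (- (s%:C * z)).

Lemma ezE z (s : R) : ez z s =
  (expR (- (complex.Re z * s)) * cos (complex.Im z * s)) +i*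
  (- (expR (- (complex.Re z * s)) * sin (complex.Im z * s))).
Proof.
by case: z => a b; rewrite /ez realC_mul /cexp realC_mul/= cosN sinN mulrN !(mulrC s).
Qed.

Lemma ezD z (s t : R) : ez z (s + t) = ez z s * ez z t.
Proof. by rewrite /ez -cexpD -opprD -mulrDl rmorphD. Qed.

Lemma normc_ez z (s : R) : 0 <= complex.Re z -> 0 <= s -> normc (ez z s) <= 1.
Proof.
move=> z0 s0; rewrite normc_cexp realC_mul/= expR_le1 oppr_le0 mulr_ge0//.
Qed.

Let meas_ez z :
  @measurable_fun _ _ borelR borelR setT (fun s => complex.Re (ez z s)) /\
  @measurable_fun _ _ borelR borelR setT (fun s => complex.Im (ez z s)).
Proof.
have lin (a : R) : @measurable_fun _ _ borelR borelR setT (fun s => a * s).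
  by apply: continuous_measurable_fun => s; apply: cvgMr; exact: cvg_id.
have me : @measurable_fun _ _ borelR borelR setT (fun s => expR (- (complex.Re z * s))).
  apply: (measurableT_comp (@measurable_expR R)).
  by apply: (measurableT_comp (@oppr_measurable R setT)); exact: lin.
have mc : @measurable_fun _ _ borelR borelR setT (fun s => cos (complex.Im z * s)).
  apply: (measurableT_comp (continuous_measurable_fun (@continuous_cos R))); exact: lin.
have ms : @measurable_fun _ _ borelR borelR setT (fun s => sin (complex.Im z * s)).
  apply: (measurableT_comp (continuous_measurable_fun (@continuous_sin R))); exact: lin.
split.
  apply: (eq_measurable_fun (fun s => expR (- (complex.Re z * s)) * cos (complex.Im z * s))).
    by move=> s _; rewrite ezE.
  exact: measurable_funM.
apply: (eq_measurable_fun (fun s => - (expR (- (complex.Re z * s)) * sin (complex.Im z * s)))).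
  by move=> s _; rewrite ezE.
by apply: (measurableT_comp (@oppr_measurable R setT)); exact: measurable_funM.
Qed.

Lemma cbm_ez z : 0 <= complex.Re z -> cbm (ez z).
Proof.
move=> z0; have [mR mI] := meas_ez z; exists 1; split.
- exact: measurable_funTS.
- exact: measurable_funTS.
- by move=> s s0; exact: normc_ez.
Qed.

Lemma measurable_max0 : @measurable_fun _ _ borelR borelR setT (fun s => Num.max 0 s).
Proof.
apply: continuous_measurable_fun => s; apply/cvgrPdist_le => e e0.
near=> t; have : `|s - t| < e by near: t; exact: cvgr_dist_lt.
move=> /ltW; apply: le_trans.
have h1 := ler_norm (s - t); have h2 := ler_norm (t - s); rewrite distrC in h2.
by rewrite /Num.max; do 2 case: ltP => ?; rewrite ler_norml; apply/andP; split; lra.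
Unshelve. all: by end_near. Qed.

Lemma max0_id (s : R) : 0 <= s -> Num.max 0 s = s.
Proof. by move=> ?; apply/max_idPr. Qed.

Definition lap m z : R[i] := scalar_int (ez z) m.

Lemma lap_prod_push m1 m2 (phi : borelR * borelR -> borelR)
    (mphi : measurable_fun [set: borelR * borelR] phi)
    (phi0 : forall p, (0 : R) <= phi p) z : 0 <= complex.Re z ->
  lap (prod_push m1 m2 mphi) z =
  scalar_int (fun x => scalar_int (fun y => ez z (phi (x, y))) m2) m1.
Proof.
move=> z0; have [mR mI] := meas_ez z; rewrite /lap {1 2}/scalar_int /=.
have E (F : R[i] -> R) : (forall w, `|F w| <= normc w) ->
    @measurable_fun _ _ borelR borelR setT (fun s => F (ez z s)) ->
    \int[prod_push m1 m2 mphi]_(s in halfline) F (ez z s) =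
    \int[m1]_(x in halfline) \int[m2]_(y in halfline) F (ez z (phi (x, y))).
  move=> F1 mF.
  transitivity (\int[prod_push m1 m2 mphi]_(s in halfline) F (ez z (Num.max 0 (s : R)))).
    by apply: eq_Rintegral => s; rewrite inE halflineE => s0; rewrite max0_id.
  rewrite (@prod_push_integral _ _ _ _ _ phi0 (fun s : R => F (ez z (Num.max 0 s))) 1).
  - apply: eq_Rintegral => x _; apply: eq_Rintegral => y _.
    by rewrite max0_id.
  - exact: (measurableT_comp mF measurable_max0).
  - by move=> s; rewrite (le_trans (F1 _))// normc_ez// le_max lexx.
by rewrite (E _ (@normr_Re_le R))// (E _ (@normr_Im_le R)).
Qed.

Let phi_add (p : borelR * borelR) : borelR := (Num.max 0 p.1 : R) + (Num.max 0 p.2 : R).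

Let mphi_add : measurable_fun [set: borelR * borelR] phi_add.
Proof.
apply: measurable_funD.
  exact: (measurableT_comp measurable_max0 measurable_fst).
exact: (measurableT_comp measurable_max0 measurable_snd).
Qed.

(** The transform of a convolution. *)
Lemma lapM m1 m2 : exists m, forall z, 0 <= complex.Re z -> lap m z = lap m1 z * lap m2 z.
Proof.
exists (prod_push m1 m2 mphi_add) => z z0; rewrite lap_prod_push//; last first.
  by move=> p; rewrite addr_ge0// le_max lexx.
have ce := cbm_ez z0.
rewrite (@eq_scalar_int _ _ _ (fun x => lap m2 z * ez z x)).
  by rewrite scalar_intZ// mulrC.
move=> x x0; rewrite mulrC -scalar_intZ//; apply: eq_scalar_int => y y0.
by rewrite /phi_add/= !max0_id// ezD.
Qed.

Let phi_div (p : borelR * borelR) : borelR := (Num.max 0 p.2 : R) * expR (- ln (p.1 : R)).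

Let mphi_div : measurable_fun [set: borelR * borelR] phi_div.
Proof.
apply: measurable_funM.
  exact: (measurableT_comp measurable_max0 measurable_snd).
apply: (measurableT_comp (@measurable_expR R)).
apply: (measurableT_comp (@oppr_measurable R setT)).
exact: (measurableT_comp (@measurable_ln R) measurable_fst).
Qed.

(** A mixture of dilates of m is again a finite measure: it is the image of the
    product of k and m under (tau, u) |-> u / tau.  At tau = 0 the dilation is
    taken to be the identity. *)
Lemma lap_div k m : exists p, forall z, 0 <= complex.Re z ->
  lap p z = scalar_int (fun tau => lap m ((if tau == 0 then 1 else tau^-1)%:C * z)) k.
Proof.
have phi0 (p : borelR * borelR) : (0 : R) <= phi_div p.
  by rewrite mulr_ge0 ?expR_ge0// le_max lexx.
exists (prod_push k m mphi_div) => z z0.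
rewrite (@lap_prod_push k m _ mphi_div phi0 z z0).
apply: eq_scalar_int => x x0; apply: eq_scalar_int => y y0.
have -> : phi_div (x, y) = (y : R) * (if x == 0 then 1 else x^-1) :> R.
  rewrite /phi_div [(x, y).1]/= [(x, y).2]/= max0_id//; congr (_ * _).
  have [->|xn0] := eqVneq x 0; first by rewrite ln0// oppr0 expR0.
  by rewrite expRN lnK// posrE lt_neqAle eq_sym xn0.
by rewrite /ez rmorphM -[in LHS]mulrA.
Qed.

Lemma buc_ez z : 0 <= complex.Re z -> @buc R R[i]^o (ez z) 1.
Proof.
move=> z0; split=> [s s0|e e0]; first exact: (normc_ez z0 s0).
have /cvgrPdist_le/(_ _ e0)[d /= d0 Hd] := @cexp_cvg1 R (- z).
exists d => // s h s0; rewrite le_eqVlt => /predU1P[<-|h0] hd.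
  by rewrite addr0 subrr; rewrite /rnorm normr0 /= ltW.
have -> : rnorm (ez z (s + h) - ez z s : R[i]^o) = normc (ez z s * (ez z h - 1)).
  by rewrite mulrBr mulr1 -ezD.
rewrite normcM (le_trans (ler_piMl (normc_ge0 _) (normc_ez z0 s0)))//.
have hd' : `|0 - h| < d by rewrite sub0r normrN gtr0_norm.
have : `|0 - normc (cexp (h%:C * - z) - 1)| <= e := Hd h hd' h0.
by rewrite sub0r normrN (ger0_norm (normc_ge0 _)) /ez mulrN.
Qed.

End LaplaceTransforms.

Section Transforms.
Variable R : realType.
Local Notation borelR := (measurableTypeR R).
Local Notation halfline := (@halfline R).
Implicit Types (m : {finite_measure set borelR -> \bar R}) (z : R[i]).

(** Applied to the semigroup exp(- z t) on X, whose generator is - z,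
    [hpm_exp_generator] gives the integral with no antiderivative.  A nonzero
    vector is needed to compare coefficients. *)
Lemma lap_expm (X : completeNormedModType R[i]) (x0 : X) (lam : R) (lam0 : 0 < lam) z :
  x0 != 0 -> 0 <= complex.Re z -> lap (expm lam0) z = lam%:C / (lam%:C + z).
Proof.
move=> x00 z0.
pose I (t : R) : {linear X -> X} := idfun.
have HI : C0_semigroup I.
  by split=> //; [move=> t _ x; exact: cvg_id|move=> x; exact: cvg_cst].
have I1 (t : R) x : 0 <= t -> rnorm (I t x) <= 1 * rnorm x by rewrite mul1r.
have nz0 : complex.Re (- z) <= 0 by case: z z0 => a b /=; rewrite oppr_le0.
have I1' := @twist_le _ _ (- z) I 1 nz0 I1.
have gI : generator I (x0, 0).
  rewrite /generator/=; under eq_cvg do rewrite subrr scaler0.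
  exact: cvg_cst.
have gS := @generator_twist _ _ (- z) _ _ _ HI gI; rewrite addr0 in gS.
have := hpm_exp_generator (twist_C0 (- z) HI) ler01 I1' lam0 gS.
have hE y : hpm (twist (- z) I) (expm lam0) y = lap (expm lam0) z *: y.
  rewrite /hpm /lap -(bochner_scalar (expm lam0) y (buc_ez z0)).
  by congr bochner; apply/funext => s; rewrite twistE mulrN.
rewrite hE scaleNr opprK -scalerDl scalerA => /eqP.
rewrite -subr_eq0 -scalerBl scaler_eq0 (negbTE x00) orbF subr_eq0 => /eqP E.
have nz : lam%:C + z != 0.
  apply/eqP => /(congr1 (@complex.Re R)); case: z z0 {nz0 I1' gS hE E} => a b /= a0.
  by apply/eqP; rewrite gt_eqF// ltr_pwDl.
by apply: (canRL (mulfK nz)); rewrite E.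
Qed.

Lemma lap_measure_lin m m1 m2 (c : R) :
  (forall A, measurable A -> rmeas m A = c * rmeas m1 A + rmeas m2 A) ->
  forall z, 0 <= complex.Re z -> lap m z = c%:C * lap m1 z + lap m2 z.
Proof.
move=> mE z z0.
have cv m' : riemann m' (fun s => ez z s *: (1 : R[i]^o)) 1 p @[p --> \oo] -->
    (lap m' z *: (1 : R[i]^o)).
  exact: (@scalar_riemann_cvg _ m' (ez z) 1 (buc_ez z0) _ (1 : R[i]^o) 1 ltr01).
have E1 (a : R[i]) : a = a *: (1 : R[i]^o) by rewrite /GRing.scale/= mulr1.
rewrite (E1 (lap m z)) (E1 (lap m1 z)) (E1 (lap m2 z)).
apply: (cvg_unique (@norm_hausdorff _ R[i]^o) (cv m)).
have : c%:C *: riemann m1 (fun s => ez z s *: (1 : R[i]^o)) 1 p +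
    riemann m2 (fun s => ez z s *: (1 : R[i]^o)) 1 p @[p --> \oo] -->
    c%:C *: (lap m1 z *: (1 : R[i]^o)) + lap m2 z *: (1 : R[i]^o).
  by apply: cvgD => //; apply: cvgZr.
apply: cvg_trans; apply: near_eq_cvg; near=> p.
rewrite /riemann /rsum scaler_sumr -big_split/=; apply: eq_bigr => k _.
rewrite mE; last exact: measurable_itv.
by rewrite scalerA -scalerDl -rmorphM -rmorphD.
Unshelve. all: by end_near. Qed.

Lemma measure_lin m1 m2 (c : {nonneg R}) : exists m,
  forall A, measurable A -> rmeas m A = c%:num * rmeas m1 A + rmeas m2 A.
Proof.
pose s := measure_add (mscale c m1) m2.
have sE A : measurable A -> s A = (c%:num * rmeas m1 A + rmeas m2 A)%:E.
  by move=> mA; rewrite /s measure_addE /mscale/= EFinD EFinM !rmeasE.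
have sT : (s setT < +oo)%E by rewrite sE// ltry.
exists (mfrestr measurableT sT) => A mA.
by rewrite -[LHS]/(fine (s (A `&` setT))) setIT sE.
Qed.

(** Real linear combinations suffice: Stieltjes functions are real on the
    positive half-line, and so are all multipliers used with them. *)
Definition transform (g : R[i] -> R[i]) : Prop :=
  exists m1 m2, forall z, 0 <= complex.Re z -> g z = lap m1 z - lap m2 z.

Lemma lap_lin m1 m2 (c : R) : 0 <= c -> exists m, forall z, 0 <= complex.Re z ->
  lap m z = c%:C * lap m1 z + lap m2 z.
Proof.
by move=> c0; have [m mE] := measure_lin m1 m2 (NngNum c0); exists m; exact: lap_measure_lin.
Qed.

Lemma mzero_finite : (@mzero _ borelR R setT < +oo)%E.
Proof. by rewrite /mzero ltry. Qed.

Lemma lap_zero : exists m, forall z, 0 <= complex.Re z -> lap m z = 0.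
Proof.
exists (mfrestr measurableT mzero_finite) => z z0.
have := @lap_measure_lin (mfrestr measurableT mzero_finite) (mfrestr measurableT mzero_finite)
  (mfrestr measurableT mzero_finite) 1 _ z z0.
rewrite mul1r => h; apply: (@addrI _ (lap (mfrestr measurableT mzero_finite) z)).
rewrite addr0 -h// => A mA.
by rewrite /rmeas /= /mfrestr /mrestr /mzero/= mulr0 addr0.
Qed.

Lemma transform_lap m : transform (lap m).
Proof. by have [m0 m00] := lap_zero; exists m, m0 => z z0; rewrite m00// subr0. Qed.

Lemma transformN g : transform g -> transform (fun z => - g z).
Proof. by move=> [m1 [m2 h]]; exists m2, m1 => z z0; rewrite h// opprB. Qed.

Lemma transformD g h : transform g -> transform h -> transform (fun z => g z + h z).
Proof.
move=> [m1 [m2 gE]] [n1 [n2 hE]].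
have [p1 p1E] := lap_lin m1 n1 ler01; have [p2 p2E] := lap_lin m2 n2 ler01.
exists p1, p2 => z z0; rewrite gE// hE// p1E// p2E// !mul1r; ring.
Qed.

Lemma transformZ (c : R) g : transform g -> transform (fun z => c%:C * g z).
Proof.
have pos (d : R) g' : 0 <= d -> transform g' -> transform (fun z => d%:C * g' z).
  move=> d0 [m1 [m2 gE]]; have [m0 m00] := lap_zero.
  have [p1 p1E] := lap_lin m1 m0 d0; have [p2 p2E] := lap_lin m2 m0 d0.
  exists p1, p2 => z z0; rewrite gE// p1E// p2E// m00//; ring.
have [c0|c0] := leP 0 c; first exact: pos.
move=> tg; have c1 : 0 <= - c by rewrite oppr_ge0 ltW.
have [m1 [m2 h]] := transformN (pos (- c) g c1 tg).
by exists m1, m2 => z z0; rewrite -h// rmorphN mulNr opprK.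
Qed.

Lemma transformM g h : transform g -> transform h -> transform (fun z => g z * h z).
Proof.
move=> [m1 [m2 gE]] [n1 [n2 hE]].
have [p1 p1E] := lapM m1 n1; have [p2 p2E] := lapM m2 n2.
have [p3 p3E] := lapM m1 n2; have [p4 p4E] := lapM m2 n1.
have [q1 q1E] := lap_lin p1 p2 ler01; have [q2 q2E] := lap_lin p3 p4 ler01.
exists q1, q2 => z z0.
rewrite gE// hE// q1E// q2E// p1E// p2E// p3E// p4E// !mul1r; ring.
Qed.

Lemma eq_transform g h : (forall z, 0 <= complex.Re z -> g z = h z) ->
  transform g -> transform h.
Proof. by move=> gh [m1 [m2 gE]]; exists m1, m2 => z z0; rewrite -gh// gE. Qed.

Lemma lap_dirac z : 0 <= complex.Re z -> lap (dirac (0 : borelR)) z = 1.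
Proof.
move=> z0; have [K [mR mI _]] := cbm_ez z0.
have e0 : ez z 0 = 1 by rewrite /ez mul0r oppr0 cexp0.
have d1 : dirac (0 : borelR) halfline = 1%E :> \bar R.
  by rewrite diracE mem_set// halflineE.
rewrite /lap /scalar_int /Rintegral !integral_dirac//; try exact/measurable_EFinP.
by rewrite e0 d1 !mul1e.
Qed.

Lemma transform1 : transform (fun=> 1).
Proof. by apply: eq_transform (transform_lap (dirac (0 : borelR))) => z; exact: lap_dirac. Qed.

Lemma laplace_transform g : transform g ->
  exists nu, forall z, 0 <= complex.Re z -> laplace nu z = g z.
Proof.
(* equal third and fourth measures make the imaginary part vanish *)
move=> [m1 [m2 gE]]; exists (CMeasure m1 m2 m1 m1) => z z0.
by rewrite /laplace /cm_int/= subrr scaler0 addr0 gE.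
Qed.

End Transforms.

(** * Stieltjes functions *)

Section Density.
Context d (T : measurableType d) (R : realType).
Variables (mu : {measure set T -> \bar R}) (w : T -> R).
Hypotheses (mw : measurable_fun [set: T] w) (w0 : forall x, 0 <= w x).
Local Open Scope ereal_scope.

Definition density (A : set T) : \bar R := \int[mu]_(x in A) (w x)%:E.

Let mwE D : measurable_fun D (EFin \o w).
Proof. by apply/measurable_EFinP; exact: measurable_funTS. Qed.

Let density0 : density set0 = 0.
Proof. by rewrite /density integral_set0. Qed.

Let density_ge0 A : 0 <= density A.
Proof. by apply: integral_ge0 => x _; rewrite lee_fin. Qed.

Let density_sigma_additive : semi_sigma_additive density.
Proof.
move=> /= F mF tF mUF; rewrite /density; apply: cvg_toP.
  apply: ereal_nondecreasing_is_cvgn => m n mn.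
  by apply: lee_sum_nneg_natr => // k _ _; exact: density_ge0.
by rewrite ge0_integral_bigcup//= => x _; rewrite lee_fin.
Qed.

HB.instance Definition _ := isMeasure.Build _ _ _
  density density0 density_ge0 density_sigma_additive.

Definition density_measure : {measure set T -> \bar R} := density.

Import HBNNSimple.

Let integral_density_nnsfun (f : {nnsfun T >-> R}) :
  \int[density]_x (f x)%:E = \int[mu]_x ((f x)%:E * (w x)%:E).
Proof.
under [LHS]eq_integral do rewrite fimfunE -fsumEFin//.
rewrite [LHS]ge0_integral_fsum//; last 2 first.
  - by move=> r; exact/measurable_EFinP/measurableT_comp.
  - by move=> n x _; rewrite EFinM nnfun_muleindic_ge0.
under [RHS]eq_integral.
  move=> x xD; rewrite fimfunE -fsumEFin// muleC ge0_mule_fsumr; last first.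
    by move=> r; rewrite EFinM nnfun_muleindic_ge0.
  over.
rewrite [RHS]ge0_integral_fsum//; last 2 first.
  - move=> r; apply: emeasurable_funM; first exact: mwE.
    by apply/measurable_EFinP; apply/measurableT_comp.
  - by move=> n x _; rewrite mule_ge0 ?lee_fin// -lee_fin EFinM nnfun_muleindic_ge0.
apply: eq_fsbigr => r _.
rewrite integralZl_indic_nnsfun// integral_indic// setIT.
have [r0|r0] := leP 0%R r; last first.
  rewrite preimage_nnfun0// measure0 mule0.
  by under eq_integral do rewrite indicE in_set0 mulr0 mule0; rewrite integral0.
rewrite /= /density integral_mkcond -ge0_integralZl//; last 2 first.
- rewrite -measurable_restrict//; exact: mwE.
- by move=> x _; rewrite patchE; case: ifPn => // _; rewrite lee_fin.
apply: eq_integral => x _; rewrite patchE indicE; case: ifPn => xr.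
  by rewrite mulr1 muleC.
by rewrite mulr0 !mule0.
Qed.

Lemma integral_density (f : T -> \bar R) :
  measurable_fun [set: T] f -> (forall x, 0 <= f x) ->
  \int[density_measure]_x f x = \int[mu]_x (f x * (w x)%:E).
Proof.
move=> mf f0; rewrite /density_measure.
pose f_ := nnsfun_approx measurableT mf.
transitivity (lim (\int[density]_x (f_ n x)%:E @[n --> \oo])).
  rewrite -monotone_convergence//=.
  - apply: eq_integral => ? /[!inE] xD; apply/esym/cvg_lim => //=.
    exact: cvg_nnsfun_approx.
  - by move=> n; exact/measurable_EFinP/measurable_funTS.
  - by move=> n ? _; rewrite lee_fin.
  - by move=> ? _ ? ? mn; rewrite lee_fin; exact/lefP/nd_nnsfun_approx.
transitivity (lim (\int[mu]_x ((f_ n x)%:E * (w x)%:E) @[n --> \oo])).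
  by apply: congr_lim; apply/funext => n /=; exact: integral_density_nnsfun.
rewrite -monotone_convergence//=.
- apply: eq_integral => x /[!inE] xD; apply/cvg_lim => //.
  by apply: cvgeZr => //; exact: cvg_nnsfun_approx.
- move=> n; apply: emeasurable_funM; last exact: mwE.
  by exact/measurable_EFinP/measurable_funTS.
- by move=> n x _; rewrite mule_ge0// lee_fin.
- move=> x _ a b ab; rewrite lee_wpmul2r ?lee_fin//.
  exact/lefP/nd_nnsfun_approx.
Qed.

End Density.

Section StieltjesRepresentation.
Variable R : realType.
Local Notation borelR := (measurableTypeR R).
Local Notation halfline := (@halfline R).

Let recip (c s : R) : R := expR (- ln (c + Num.max 0 s)).

Let measurable_recip c : @measurable_fun _ _ borelR borelR setT (recip c).
Proof.
apply: (measurableT_comp (@measurable_expR R)).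
apply: (measurableT_comp (@oppr_measurable R setT)).
apply: (measurableT_comp (@measurable_ln R)).
by apply: measurable_funD; [exact: measurable_cst|exact: measurable_max0].
Qed.

Let recipE c s : 0 < c -> 0 <= s -> recip c s = (c + s)^-1.
Proof. by move=> c0 s0; rewrite /recip max0_id// expRN lnK// posrE ltr_wpDr. Qed.

(** The density 1 / (1 + tau) turns the representing measure into a finite one,
    at the price of the kernel (1 + tau) / (z + tau), which is bounded in tau. *)
Lemma stieltjes_finite (f : R -> R) : stieltjes f ->
  exists (al : R) (k : {finite_measure set borelR -> \bar R}), 0 <= al /\
    forall z, 0 < z ->
      f z = al + \int[k]_(tau in halfline) ((1 + tau) / (z + tau)).
Proof.
move=> [al [mu [al0 mufin fE]]].
pose n0 : {measure set borelR -> \bar R} := mrestr mu (@measurable_halfline R).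
have w0 x : 0 <= recip 1 x by exact: expR_ge0.
pose dn : {measure set borelR -> \bar R} :=
  density_measure n0 (measurable_recip 1) w0.
have dnT : (dn setT < +oo)%E.
  rewrite /dn /= /density integral_mrestr_halfline; last first.
    by apply/measurable_EFinP; exact: measurable_recip.
  apply: le_lt_trans mufin; rewrite le_eqVlt; apply/orP; left; apply/eqP.
  by apply: eq_integral => s; rewrite inE halflineE => s0; rewrite recipE.
exists al, (mfrestr measurableT dnT); split => // z z0.
pose h (s : R) : R := (1 + Num.max 0 s) * recip z s.
have h0 s : 0 <= h s.
  by rewrite mulr_ge0 ?expR_ge0// addr_ge0// le_max lexx.
have mh : @measurable_fun _ _ borelR borelR setT h.
  apply: measurable_funM; last exact: measurable_recip.
  by apply: measurable_funD; [exact: measurable_cst|exact: measurable_max0].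
have hH : (\int[mfrestr measurableT dnT]_(tau in halfline) ((1 + tau) / (z + tau))%:E =
    \int[mu]_(tau in halfline) ((z + tau)^-1)%:E)%E.
  transitivity (\int[mfrestr measurableT dnT]_(tau in halfline) (h tau)%:E)%E.
    by apply: eq_integral => s; rewrite inE halflineE => s0; rewrite /h max0_id// recipE.
  rewrite (eq_measure_integral dn); last first.
    by move=> A mA _; rewrite -[LHS]/(dn (A `&` setT)) setIT.
  rewrite integral_mkcond integral_density; last 2 first.
  - apply/measurable_restrict => //; rewrite setTI.
    by apply/measurable_EFinP; exact: measurable_funTS.
  - by move=> x; rewrite patchE; case: ifPn => // _; rewrite lee_fin.
  rewrite integral_mrestr_halfline; last first.
    apply: emeasurable_funM; last by apply/measurable_EFinP; exact: measurable_recip.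
    apply/measurable_restrict => //; rewrite setTI.
    by apply/measurable_EFinP; exact: measurable_funTS.
  apply: eq_integral => s sH; rewrite patchE sH -EFinM.
  move: sH; rewrite inE halflineE => s0; rewrite /h max0_id// !recipE//.
  by rewrite mulrAC mulfV ?mul1r// gt_eqF// ltr_pwDl.
apply: EFin_inj; rewrite fE// EFinD; congr (_ + _)%E.
rewrite /Rintegral hH fineK//.
have := fE z z0; case: (\int[mu]_(tau in halfline) _)%E => //.
Qed.

End StieltjesRepresentation.

Section ComplexStieltjes.
Variable R : realType.
Local Notation borelR := (measurableTypeR R).
Local Notation halfline := (@halfline R).
Implicit Types (z : R[i]).

(** On the slit plane the kernel 1 / (z + tau) is dominated by a multiple of
    1 / (1 + tau); all integrals below converge for this reason. *)
Definition away (c : R) z : Prop :=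
  forall tau : R, 0 <= tau -> c * (1 + tau) <= normc (z + tau%:C).

(** For tau > 2 |z| + 1 the summand tau dominates; for smaller tau the distance
    d from z to the negative half-axis is a lower bound. *)
Lemma slit_away z : slit_plane z -> exists2 c : R, 0 < c & away c z.
Proof.
move=> zs.
have [d d0 dz] : exists2 d : R, 0 < d & forall tau : R, 0 <= tau -> d <= normc (z + tau%:C).
  have [b0|b0] := eqVneq (complex.Im z) 0.
    have a0 : 0 < complex.Re z by rewrite ltNge; apply/negP => a0; apply: zs.
    exists (complex.Re z) => // tau tau0.
    rewrite (le_trans _ (normr_Re_le _))//; case: z {zs b0} a0 => a b /= a0.
    by rewrite (le_trans _ (ler_norm _))// lerDl.
  exists `|complex.Im z|; first by rewrite normr_gt0.
  move=> tau _; rewrite (le_trans _ (normr_Im_le _))//; case: z {zs b0} => a b /=.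
  by rewrite addr0.
have n0 : 0 < 2 * normc z + 2 by rewrite ltr_wpDl// mulr_ge0// normc_ge0.
exists (Num.min 2^-1 (d / (2 * normc z + 2))).
  by rewrite lt_min invr_gt0 ltr0n divr_gt0.
move=> tau tau0; have t1 : 0 <= 1 + tau by rewrite addr_ge0.
have [t2|t2] := leP (2 * normc z + 1) tau.
  apply: (@le_trans _ _ (2^-1 * (1 + tau))).
    by rewrite ler_wpM2r// ge_min lexx.
  have h1 := @le_normcD R (z + tau%:C) (- z).
  rewrite addrAC subrr add0r normcN normc_real ger0_norm// in h1.
  lra.
apply: (@le_trans _ _ (d / (2 * normc z + 2) * (1 + tau))).
  by rewrite ler_wpM2r// ge_min lexx orbT.
rewrite (le_trans _ (dz _ tau0))// mulrAC ler_pdivrMr// ler_wpM2l ?(ltW d0)//.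
lra.
Qed.

Lemma away_neq0 c z (tau : R) : 0 < c -> away c z -> 0 <= tau -> z + tau%:C != 0.
Proof.
move=> c0 cz t0; apply/eqP => e0; have := cz tau t0.
rewrite e0 (normc_real 0) normr0 leNgt mulr_gt0// ltr_pwDl//.
Qed.

Let measurable_inv_pos (w : R -> R) : @measurable_fun _ _ borelR borelR halfline w ->
  (forall s : R, 0 <= s -> 0 < w s) ->
  @measurable_fun _ _ borelR borelR halfline (fun s => (w s)^-1).
Proof.
move=> mw w0; apply: (eq_measurable_fun (fun s => expR (- ln (w s)))).
  by move=> s; rewrite inE halflineE => s0; rewrite expRN lnK// posrE w0.
apply: (measurableT_comp (@measurable_expR R)).
apply: (measurableT_comp (@oppr_measurable R setT)).
exact: (measurableT_comp (@measurable_ln R)).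
Qed.

Let cadd (c : R) : @measurable_fun _ _ borelR borelR halfline (fun s => c + s).
Proof. by apply: measurable_funD; [exact: measurable_cst|exact: measurable_id]. Qed.

Definition rz z (tau : R) : R[i] := (z + tau%:C)^-1.
Definition gz z (tau : R) : R[i] := (1 + tau)%:C * rz z tau.

Lemma normc_rz c z (tau : R) : 0 < c -> away c z -> 0 <= tau ->
  normc (rz z tau) <= (c * (1 + tau))^-1.
Proof.
move=> c0 cz t0; have p1 : 0 < c * (1 + tau) by rewrite mulr_gt0// ltr_pwDl.
have p2 : 0 < normc (z + tau%:C) := lt_le_trans p1 (cz _ t0).
by rewrite /rz normcV lef_pV2 ?posrE// cz.
Qed.

Lemma normc_gz c z (tau : R) : 0 < c -> away c z -> 0 <= tau ->
  normc (gz z tau) <= c^-1.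
Proof.
move=> c0 cz t0; have t1 : 0 < 1 + tau by rewrite ltr_pwDl.
rewrite normcM normc_real gtr0_norm// (le_trans (ler_wpM2l (ltW t1) (normc_rz c0 cz t0)))//.
by rewrite invfM mulrCA mulfV ?mulr1// gt_eqF.
Qed.

Lemma cbm_rz c z : 0 < c -> away c z -> cbm (rz z).
Proof.
move=> c0 cz; exists c^-1.
have n0 (tau : R) : 0 <= tau -> 0 < (complex.Re z + tau) ^+ 2 + complex.Im z ^+ 2.
  move=> t0; have := away_neq0 c0 cz t0; case: z {cz} => a b /=.
  rewrite eq_complex/= addr0 => /nandP h; rewrite lt_neqAle addr_ge0 ?sqr_ge0// andbT.
  rewrite eq_sym paddr_eq0 ?sqr_ge0// !sqrf_eq0; apply/negP => /andP[/eqP a0 /eqP b0].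
  by case: h; rewrite ?a0 ?b0 eqxx.
have mn : @measurable_fun _ _ borelR borelR halfline
    (fun s => ((complex.Re z + s) ^+ 2 + complex.Im z ^+ 2)^-1).
  apply: measurable_inv_pos => //; apply: measurable_funD; last exact: measurable_cst.
  have -> : (fun s : borelR => (complex.Re z + s) ^+ 2) =
      (fun s => (complex.Re z + s) * (complex.Re z + s)).
    by apply/funext => s; rewrite expr2.
  exact: (measurable_funM (cadd _) (cadd _)).
split.
- apply: (@eq_measurable_fun _ _ borelR borelR halfline (fun s => (complex.Re z + s) *
    ((complex.Re z + s) ^+ 2 + complex.Im z ^+ 2)^-1)).
    by move=> s _; rewrite /rz; case: z {n0 mn cz} => a b /=; rewrite addr0.
  exact: (measurable_funM (cadd _) mn).
- apply: (@eq_measurable_fun _ _ borelR borelR halfline (fun s => (- complex.Im z) *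
    ((complex.Re z + s) ^+ 2 + complex.Im z ^+ 2)^-1)).
    by move=> s _; rewrite /rz; case: z {n0 mn cz} => a b /=; rewrite addr0 mulNr.
  exact: (measurable_funM (@measurable_cst _ _ borelR borelR halfline (- complex.Im z)) mn).
- move=> s s0; rewrite (le_trans (normc_rz c0 cz s0))// lef_pV2 ?posrE ?mulr_gt0 ?ltr_pwDl//.
  by rewrite ler_pMr// lerDl.
Qed.

Lemma gzE c z (tau : R) : 0 < c -> away c z -> 0 <= tau ->
  gz z tau = 1 + (1 - z) * rz z tau.
Proof.
move=> c0 cz t0; rewrite /gz /rz; have := away_neq0 c0 cz t0 => nz.
rewrite rmorphD rmorph1; field; exact: nz.
Qed.

Lemma cbm_eq (g h : R -> R[i]) : (forall s : R, 0 <= s -> g s = h s) -> cbm g -> cbm h.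
Proof.
move=> gh [K [gR gI gK]]; exists K; split.
- by apply: eq_measurable_fun gR => s; rewrite inE halflineE => s0; rewrite gh.
- by apply: eq_measurable_fun gI => s; rewrite inE halflineE => s0; rewrite gh.
- by move=> s s0; rewrite -gh// gK.
Qed.

Lemma cbm_gz c z : 0 < c -> away c z -> cbm (gz z).
Proof.
move=> c0 cz; apply: (@cbm_eq (fun tau => 1 + (1 - z) * rz z tau)).
  by move=> s s0; rewrite (gzE c0 cz s0).
by apply: cbmD; [exact: cbm_cst|apply: cbmM; [exact: cbm_cst|exact: cbm_rz cz]].
Qed.

Variables (al : R) (k : {finite_measure set borelR -> \bar R}).
Hypothesis al0 : 0 <= al.

(** The analytic extension of z |-> al + int (1 + tau) / (z + tau) k(d tau). *)
Definition stieltjes_fun z : R[i] := al%:C + scalar_int (gz z) k.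

Lemma stieltjes_fun_real (z : R) : 0 < z -> stieltjes_fun z%:C =
  (al + \int[k]_(tau in halfline) ((1 + tau) / (z + tau)))%:C.
Proof.
move=> z0; rewrite /stieltjes_fun rmorphD; congr (_ + _).
have gE (tau : R) : gz z%:C tau = ((1 + tau) / (z + tau))%:C.
  by rewrite /gz /rz -rmorphD -fmorphV -rmorphM.
rewrite /scalar_int.
have -> : \int[k]_(s in halfline) complex.Im (gz z%:C s) = 0.
  rewrite (_ : (fun s => _) = cst 0); last by apply/funext => s; rewrite gE.
  by rewrite Rintegral_cst// mul0r.
congr Complex; apply: eq_Rintegral => s _; by rewrite gE.
Qed.

(** The difference quotient is computed exactly: its distance to the integral D
    of the derivative is h times an integral that stays bounded. *)
Lemma stieltjes_fun_holomorphic : holomorphic_on (@slit_plane R) stieltjes_fun.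
Proof.
move=> z /slit_away[c c0 cz].
have crz := cbm_rz c0 cz; have cgz := cbm_gz c0 cz.
pose D : R[i]^o := - scalar_int (fun s => gz z s * rz z s) k.
have c20 : 0 < c / 2 by rewrite divr_gt0.
pose C := 2 * ((c / 2)^-1 * (c^-1 * c^-1) * rmeas k halfline).
apply/cvg_ex; exists D; apply: (@rcvg_le R R[i]^o _ _ _ _ _ (fun h => C * normc h)).
  near=> h.
  have h0 : h != 0 by near: h; apply: (@nbhs_dnbhs_neq R[i]^o).
  have hc : normc h < c / 2.
    have : `|h : R[i]^o| < (c / 2)%:C by near: h; apply: (@dnbhs0_lt R[i] R[i]^o (c / 2)%:C); rewrite ltcR.
    by rewrite [`|_|](_ : _ = (normc h)%:C)// ltcR.
  have czh : away (c / 2) (h + z).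
    move=> tau t0; have := cz tau t0; have h1 := @le_normcD R (h + z + tau%:C) (- h).
    have hE : h + z + tau%:C - h = z + tau%:C by ring.
    rewrite normcN hE in h1.
    have t1 : c / 2 * (1 + tau) >= c / 2 by rewrite ler_pMr// lerDl.
    lra.
  have cgzh := cbm_gz c20 czh.
  pose q s := gz (h + z) s * (rz z s * rz z s).
  have cq : cbm q by apply: cbmM => //; exact: cbmM.
  have gE (s : R) : 0 <= s -> gz (h + z) s = gz z s + ((- h) * (gz z s * rz z s) + (h * h) * q s).
    move=> s0; rewrite /q /gz /rz; have n1 := away_neq0 c0 cz s0.
    have n2 := away_neq0 c20 czh s0; field; exact/andP.
  have IE : scalar_int (gz (h + z)) k = scalar_int (gz z) k + ((- h) * scalar_int (fun s => gz z s * rz z s) k + (h * h) * scalar_int q k).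
    rewrite (eq_scalar_int _ gE) scalar_intD//.
      rewrite scalar_intD; [|by apply: cbmM; [exact: cbm_cst|exact: cbmM]|by apply: cbmM => //; exact: cbm_cst].
      by rewrite !scalar_intZ//; exact: cbmM.
    apply: cbmD; apply: cbmM => //; try exact: cbm_cst.
    exact: cbmM.
  have -> : h^-1 *: ((stieltjes_fun \o shift z) (h *: (1 : R[i]^o)) - stieltjes_fun z) - D =
      h * scalar_int q k.
    rewrite /= /shift/= /GRing.scale/= mulr1 /stieltjes_fun IE /D.
    by field.
  rewrite [rnorm _](_ : _ = normc (h * scalar_int q k))// normcM mulrC.
  rewrite ler_wpM2r ?normc_ge0// /C.
  apply: scalar_int_norm_le => //.
    by rewrite !mulr_ge0// invr_ge0 ltW.
  move=> s s0; rewrite /q normcM [normc (rz _ _ * _)]normcM.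
  have rb : normc (rz z s) <= c^-1.
    rewrite (le_trans (normc_rz c0 cz s0))// lef_pV2 ?posrE ?mulr_gt0 ?ltr_pwDl//.
    by rewrite ler_pMr// lerDl.
  apply: ler_pM; rewrite ?mulr_ge0 ?normc_ge0//; first exact: normc_gz c20 czh s0.
  by apply: ler_pM; rewrite ?normc_ge0.
rewrite -[X in _ --> X](mulr0 C); apply: cvgM; first exact: cvg_cst.
have h := (@cvg_rnorm R R[i]^o _ (0^')%classic _ id 0).1 (cvg_within _).
rewrite [X in X @ _](_ : _ = (fun i : R[i]^o => rnorm (id i - 0))).
  exact: h.
by apply/funext => i; rewrite subr0.
Unshelve. all: by end_near. Qed.

End ComplexStieltjes.

Section StieltjesTransform.
Variables (R : realType) (X : completeNormedModType R[i]) (x0 : X).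
Local Notation borelR := (measurableTypeR R).
Local Notation halfline := (@halfline R).
Hypothesis x00 : x0 != 0.
Variables (al : R) (k : {finite_measure set borelR -> \bar R}).
Hypothesis al0 : 0 <= al.
Local Notation F := (stieltjes_fun al k).
Implicit Types (z : R[i]).

Lemma imag_slit (s : R) : s != 0 -> slit_plane (0 +i* s : R[i]).
Proof. by move=> s0 [/= s1 _]; rewrite s1 eqxx in s0. Qed.

Lemma half_plane_slit z : 0 <= complex.Re z -> z != 0 -> slit_plane z.
Proof.
move=> z0 zn0 [zi zr]; case/eqP: zn0; case: z z0 zi zr => a b /= a0 -> a1.
by have -> : a = 0 by apply/eqP; rewrite eq_le a1.
Qed.

(** On the imaginary axis the kernel has positive real part, and its imaginary
    part has the sign of - s.  Re F - sgn(s) Im F is the integral of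
    (1 + tau) (tau + |s|) / (tau^2 + s^2) >= (1 + tau) / (tau + |s|). *)
Lemma stieltjes_fun_imag_ge (s : R) : s != 0 ->
  al + \int[k]_(tau in halfline) ((1 + tau) / (`|s| + tau)) <= 2 * normc (F (0 +i* s)).
Proof.
move=> s0; have as0 : 0 < `|s| by rewrite normr_gt0.
have [c c0 cz] := slit_away (imag_slit s0).
have [d d0 dz] : exists2 d : R, 0 < d & away d `|s|%:C.
  by apply: slit_away => -[_]; rewrite /= leNgt as0.
have [iR iI] := cbm_integrable k (cbm_gz c0 cz).
have [jR _] := cbm_integrable k (cbm_gz d0 dz).
have gE (tau : R) : complex.Re (gz `|s|%:C tau) = (1 + tau) / (`|s| + tau).
  by rewrite /gz /rz -rmorphD -fmorphV -rmorphM.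
have p1 : \int[k]_(tau in halfline) ((1 + tau) / (`|s| + tau)) <=
    \int[k]_(tau in halfline) (complex.Re (gz (0 +i* s) tau)
       - Num.sg s * complex.Im (gz (0 +i* s) tau)).
  apply: le_Rintegral => //.
  - rewrite [X in _ \o X](_ : _ = (fun tau : R => complex.Re (gz `|s|%:C tau)))//.
    by apply/funext => tau; rewrite gE.
  - exact: (integrableB _ iR (integrableZl _ (Num.sg s) iI)).
  - move=> tau; rewrite halflineE => t0.
    rewrite /gz /rz /= !mul0r !addr0 !subr0 !add0r.
    have q0 : 0 < tau ^+ 2 + s ^+ 2 by rewrite ltr_wpDl ?sqr_ge0// exprn_even_gt0.
    have ss : Num.sg s * s = `|s| by rewrite -normrEsg.
    have -> : (1 + tau) * (tau / (tau ^+ 2 + s ^+ 2)) -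
        Num.sg s * ((1 + tau) * - (s / (tau ^+ 2 + s ^+ 2))) =
        (1 + tau) * ((tau + `|s|) / (tau ^+ 2 + s ^+ 2)) by rewrite -ss; ring.
    rewrite ler_wpM2l ?addr_ge0// addrC -[leLHS]mul1r ler_pdivrMr ?ltr_wpDl//.
    rewrite mulrAC ler_pdivlMr// mul1r.
    have : `|s| ^+ 2 = s ^+ 2 by rewrite real_normK// num_real.
    have : 0 <= tau * `|s| by rewrite mulr_ge0.
    nra.
rewrite RintegralB// in p1; last first.
  exact: (integrableZl _ (Num.sg s) iI).
rewrite RintegralZl// in p1.
have fE : F (0 +i* s) = (al + \int[k]_(t in halfline) complex.Re (gz (0 +i* s) t)) +i*
    \int[k]_(t in halfline) complex.Im (gz (0 +i* s) t).
  by rewrite /stieltjes_fun /scalar_int/=; congr Complex; rewrite add0r.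
have := normr_Re_le (F (0 +i* s)); have := normr_Im_le (F (0 +i* s)).
move: p1; rewrite fE [complex.Re (_ +i* _)]/= [complex.Im (_ +i* _)]/=.
set a := \int[k]_(t in halfline) complex.Re _; set b := \int[k]_(t in halfline) complex.Im _.
set n := normc _ => p1 p2 p3.
have h1 : - (Num.sg s * b) <= `|b|.
  by rewrite (le_trans (ler_norm _))// normrN normrM normr_sg s0 mul1r.
have h2 := ler_norm (al + a); lra.
Qed.

Let ind (tau : R) : R[i] := ((tau == 0)%:R : R)%:C.

Let cbm_ind : cbm ind.
Proof.
exists 1; split.
- apply: (@eq_measurable_fun _ _ borelR borelR halfline (\1_[set (0 : borelR)])).
    by move=> s _ /=; rewrite indicE; congr ((nat_of_bool _)%:R); apply/idP/eqP; rewrite inE.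
  by apply: measurable_indic; exact: measurable_set1.
- by apply: (@eq_measurable_fun _ _ borelR borelR halfline (cst 0)).
- by move=> s _; rewrite normc_real; case: (_ == _); rewrite ?normr1 ?normr0.
Qed.

Let scalar_int_real (u : R -> R) :
  scalar_int (fun s => (u s)%:C) k = (\int[k]_(s in halfline) u s)%:C.
Proof. by rewrite /scalar_int/= Rintegral_cst// mul0r. Qed.

Lemma transform_inv (lam : R) : 0 < lam -> transform (fun z => lam%:C / (lam%:C + z)).
Proof.
move=> l0; apply: eq_transform (transform_lap (expm l0)) => z z0.
exact: lap_expm x00 z0.
Qed.

Lemma half_plane_add_neq0 (lam : R) z : 0 < lam -> 0 <= complex.Re z -> lam%:C + z != 0.
Proof.
move=> l0 z0; apply/eqP => /(congr1 (@complex.Re R)); case: z z0 => a b /= a0.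
by move=> h; have := ltr_pwDl l0 a0; rewrite h ltxx.
Qed.

(** With a = 1 / (1 + z) and b = tau / (z + tau) one has
    z / (1 + z) (1 + tau) / (z + tau) = a + b - 2 a b.  Here a is the transform of
    an exponential distribution, and b that of its dilate by 1 / tau, so the
    integral of b against k is a transform by [lap_div].  That lemma
    puts a in place of b = 0 at tau = 0; [r0] corrects for the atom of k at 0. *)
Lemma stieltjes_transform : exists2 g, transform g &
  forall z, 0 <= complex.Re z -> z != 0 -> g z = z / (1 + z) * F z.
Proof.
have [p pE] := lap_div k (expm (@ltr01 R)).
pose r0 := \int[k]_(s in halfline) ((s == 0)%:R : R).
pose r1 := \int[k]_(s in halfline) (1 : R).
pose a z : R[i] := 1%:C / (1%:C + z).
have ta : transform a := transform_inv ltr01.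
pose g z := al%:C * (1 + - a z) + (r1%:C * a z + (1 + - (2%:C * a z)) * (lap p z + - (r0%:C * a z))).
exists g.
  apply: transformD.
    by apply: transformZ; apply: transformD; [exact: transform1|exact: transformN].
  apply: transformD; first exact: transformZ.
  apply: transformM; first by apply: transformD; [exact: transform1|apply: transformN; exact: transformZ].
  by apply: transformD; [exact: transform_lap|apply: transformN; exact: transformZ].
move=> z z0 zn0.
have [c c0 cz] := slit_away (half_plane_slit z0 zn0).
have z1 : 1 + z != 0 by have := half_plane_add_neq0 ltr01 z0; rewrite rmorph1.
have aE : a z = 1 / (1 + z) by rewrite /a rmorph1.
pose b tau := 1 + (- z * rz z tau + a z * ind tau).
have cb : cbm b.
  apply: cbmD; first exact: cbm_cst.
  apply: cbmD; apply: cbmM => //; try exact: cbm_cst.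
  exact: cbm_rz cz.
have lE : lap p z = scalar_int b k.
  rewrite pE//; apply: eq_scalar_int => s s0; rewrite /b /ind /rz.
  have nz := away_neq0 c0 cz s0.
  have [->|sn0] := eqVneq s 0.
    rewrite mul1r (lap_expm _ x00)// rmorph1 aE addr0; field; exact/andP.
  rewrite (lap_expm _ x00)//; last first.
    by case: (z) z0 => u v /= u0; rewrite mul0r subr0 mulr_ge0// invr_ge0.
  have sc0 : (s%:C : R[i]) != 0 by rewrite -(rmorph0 (real_complex R)) (inj_eq (@complexI R)).
  rewrite fmorphV !rmorph1 rmorph0 mulr0 addr0; field.
  by rewrite [X in X && _]nz [X in _ && X]sc0.
have rE0 : r0%:C = scalar_int ind k by rewrite scalar_int_real.
have rE1 : r1%:C = scalar_int (fun=> 1) k by rewrite /r1 -scalar_int_real rmorph1.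
have cg := cbm_gz c0 cz.
have : z / (1 + z) * scalar_int (gz z) k =
    r1%:C * a z + (1 + - (2%:C * a z)) * (lap p z + - (r0%:C * a z)).
  rewrite -scalar_intZ// lE rE0 rE1.
  rewrite (_ : scalar_int (fun s => z / (1 + z) * gz z s) k =
    scalar_int (fun s => a z * 1 + (1 - 2%:C * a z) * (b s + (- a z) * ind s)) k).
    rewrite scalar_intD; [|by apply: cbmM; exact: cbm_cst|]; last first.
      apply: cbmM; first exact: cbm_cst.
      by apply: cbmD => //; apply: cbmM => //; exact: cbm_cst.
    rewrite scalar_intZ; last exact: cbm_cst.
    rewrite scalar_intZ; last by apply: cbmD => //; apply: cbmM => //; exact: cbm_cst.
    rewrite scalar_intD//; last by apply: cbmM => //; exact: cbm_cst.
    rewrite scalar_intZ//; ring.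
  apply: eq_scalar_int => s s0; rewrite /b /gz /rz aE.
  have nz := away_neq0 c0 cz s0.
  rewrite rmorphD rmorph1 rmorph_nat; field; exact/andP.
move=> h; rewrite /stieltjes_fun /g [RHS]mulrDr h; congr (_ + _).
rewrite aE; field; exact: z1.
Qed.

Lemma stieltjes_transform2 : exists2 g, transform g &
  forall z, 0 <= complex.Re z -> z != 0 -> g z = z / (2%:C + z) * F z.
Proof.
have [g tg gE] := stieltjes_transform.
exists (fun z => g z * (1 + - (2^-1%:C * (2%:C / (2%:C + z))))).
  apply: transformM => //; apply: transformD; first exact: transform1.
  by apply: transformN; apply: transformZ; apply: transform_inv; rewrite ltr0n.
move=> z z0 zn0; rewrite gE//.
have z1 : 1 + z != 0 by have := half_plane_add_neq0 ltr01 z0; rewrite rmorph1.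
have z2 : 2%:C + z != 0 by apply: half_plane_add_neq0.
rewrite fmorphV; move: z2; rewrite rmorph_nat => z2; field; exact/andP.
Qed.

End StieltjesTransform.

(** * The uniform boundedness principle *)

Section UniformBoundedness.
Variables (R : realType) (X : completeNormedModType R[i]) (I : Type).
Variable q : I -> X -> R.
Hypothesis qD : forall i x y, q i (x + y) <= q i x + q i y.
Hypothesis qZ : forall i (a : R) x, q i (a%:C *: x) = `|a| * q i x.
Hypothesis q_bounded : forall i, exists C : R, forall x, q i x <= C * rnorm x.

Let q0 i : q i 0 = 0.
Proof. by rewrite -(scaler0 _ (0 : R)%:C) qZ normr0 mul0r. Qed.

Let qN i x : q i (- x) = q i x.
Proof.
have -> : - x = (-1 : R)%:C *: x by rewrite rmorphN1 scaleN1r.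
by rewrite qZ normrN1 mul1r.
Qed.

Let q_ge0 i x : 0 <= q i x.
Proof. by have := qD i x (- x); rewrite subrr q0 qN -mulr2n pmulrn_lge0. Qed.

(** A vector which almost attains the operator norm c of the seminorm. *)
Lemma seminorm_near_max i : exists c : R, [/\ forall x, q i x <= c * rnorm x, 0 <= c
  & exists u, rnorm u <= 1 /\ 3 / 4 * c <= q i u].
Proof.
pose E := [set q i u | u in [set u | rnorm u <= 1]].
have [C HC] := q_bounded i.
have E0 : E 0 by exists 0; [rewrite /= rnorm0|exact: q0].
have uE : has_ubound E.
  exists `|C| => _ [u /= u1 <-]; rewrite (le_trans (HC u))//.
  by rewrite (le_trans (ler_norm _))// normrM (ger0_norm (rnorm_ge0 _)) ler_piMr.
have supE : has_sup E by split=> //; exists 0.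
have c0 : 0 <= sup E by exact: ub_le_sup.
exists (sup E); split=> // [x|].
  have [x0|x0] := eqVneq (rnorm x) 0.
    by rewrite (rnorm0_eq0 x0) q0 rnorm0 mulr0.
  have p0 : 0 < rnorm x by rewrite lt_neqAle eq_sym x0 rnorm_ge0.
  rewrite -ler_pdivrMr// mulrC -(ger0_norm (_ : 0 <= (rnorm x)^-1)) ?invr_ge0 ?rnorm_ge0//.
  rewrite -qZ; apply: ub_le_sup => //; exists ((rnorm x)^-1%:C *: x) => //.
  by rewrite /= rnormZr ger0_norm ?invr_ge0 ?rnorm_ge0// mulVf.
have [s0|s0] := leP (sup E) 0.
  exists 0; rewrite rnorm0 q0; split=> //.
  by rewrite mulr_ge0_le0// divr_ge0.
have [_ [u /= u1 <-] uq] := sup_adherent (divr_gt0 s0 (ltr0n R 4)) supE.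
by exists u; split=> //; rewrite ltW// (le_lt_trans _ uq)//; lra.
Qed.

Hypothesis q_large : forall K : R, exists i u, rnorm u <= 1 /\ K <= q i u.

(** A gliding hump with ratio 1 / 3.  Step j adds a vector of norm at most 3^-j
    which almost attains the norm c j of a seminorm with c j >= j 3^j.  By the
    triangle inequality one of the signs +, - gives a value at least
    (3 / 4) 3^-j c j.  All later steps together move the limit by at most 3^-j / 2,
    so a value of at least 3^-j c j / 4 >= j / 4 survives. *)
Lemma uniform_boundedness : exists x, forall K : R, exists i, K < q i x.
Proof.
have step (j : nat) : {p : I * X * R | [/\ rnorm p.1.2 <= 1,
    forall x, q p.1.1 x <= p.2 * rnorm x, 3 / 4 * p.2 <= q p.1.1 p.1.2
    & j%:R * 3 ^+ j <= p.2]}.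
  apply: cid; have [i [v [v1 qv]]] := q_large (j%:R * 3 ^+ j).
  have [c [c1 c0 [u [u1 qu]]]] := seminorm_near_max i.
  exists (i, u, c); split=> //=; rewrite (le_trans qv)// (le_trans (c1 v))//.
  by rewrite ler_piMr.
pose n j := (sval (step j)).1.1; pose u j := (sval (step j)).1.2.
pose c j := (sval (step j)).2.
have cj j : j%:R * 3 ^+ j <= c j by rewrite /c; case: (step j) => p [].
have uj j : rnorm (u j) <= 1 by rewrite /u; case: (step j) => p [].
have qc j x : q (n j) x <= c j * rnorm x by rewrite /n /c; case: (step j) => p [].
have qu j : 3 / 4 * c j <= q (n j) (u j) by rewrite /n /c /u; case: (step j) => p [].
pose a (j : nat) : R := 3^-1 ^+ j.
have a0 j : 0 < a j by rewrite exprn_gt0.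
have aS j : a j.+1 = a j / 3 by rewrite /a exprSr.
pose v j := (a j)%:C *: u j.
have vj j : rnorm (v j) <= a j.
  by rewrite rnormZr gtr0_norm// ler_piMr// ltW.
pose fix xs j := if j is j'.+1 then
  if q (n j') (v j') <= q (n j') (xs j' + v j') then xs j' + v j' else xs j' - v j'
  else 0.
(* q (2 v) <= q (x + v) + q (x - v), so one of the two values is at least q v *)
have qx j : q (n j) (v j) <= q (n j) (xs j.+1).
  rewrite /=; case: ifPn => //; rewrite -ltNge => h.
  have := qD (n j) (xs j + v j) (- (xs j - v j)).
  have -> : xs j + v j - (xs j - v j) = (2 : R)%:C *: v j.
    by rewrite opprB addrAC [X in X + _]addrC subrK -mulr2n rmorph_nat scaler_nat.
  rewrite qZ qN normr_nat; lra.
have dx j : rnorm (xs j.+1 - xs j) <= a j.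
  by rewrite /=; case: ifP => _; rewrite addrAC subrr add0r ?rnormN.
have tail m d : rnorm (xs (m + d)%N - xs m) <= 3 / 2 * (a m - a (m + d)%N).
  elim: d => [|d IH]; first by rewrite addn0 !subrr rnorm0 mulr0.
  rewrite addnS aS (le_trans (rnorm_triangle (xs (m + d)%N) _ _))//.
  have := dx (m + d)%N; lra.
have tail' m k : (m <= k)%N -> rnorm (xs k - xs m) <= 3 / 2 * a m.
  move=> mk; have := tail m (k - m)%N; rewrite subnKC//; have := a0 k; lra.
have [x xl] : exists x : X, xs j @[j --> \oo] --> x.
  apply: cauchy_rnorm => e e0.
  have : a j @[j --> \oo] --> 0.
    by apply: cvg_expr; rewrite ger0_norm ?invr_ge0// invf_lt1// ltr1n.
  move=> /cvgrPdist_lt/(_ (e / 3) (divr_gt0 e0 (ltr0n _ 3)))[N _ HN].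
  exists N => m k Nm Nk; have := HN N (leqnn N); rewrite /= sub0r normrN gtr0_norm// => h.
  rewrite (le_lt_trans (rnorm_triangle (xs N) _ _))// (rnormBC (xs N)).
  have := tail' _ _ Nm; have := tail' _ _ Nk; lra.
exists x => K.
have [j h7] : exists j : nat, 4 * K < j%:R.
  by exists (Num.bound (4 * K)); exact: unstable.ltr_bound.
exists (n j).
have xt : rnorm (x - xs j.+1) <= a j / 2.
  have xl' : (fun k => xs k - xs j.+1) @ \oo --> x - xs j.+1.
    by apply: cvgB => //; exact: cvg_cst.
  apply: (@rnorm_lim_le R X nat \oo _ (fun k => xs k - xs j.+1) _ (fun=> a j / 2) _ xl' (cvg_cst _)).
  exists j.+1 => // k /= /tail'; rewrite aS; lra.
have h1 := qD (n j) x (xs j.+1 - x); rewrite addrC subrK in h1.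
have h2 := qc j (xs j.+1 - x); rewrite rnormBC in h2.
have h3 := qx j; rewrite qZ gtr0_norm// in h3.
have c0 : 0 <= c j by rewrite (le_trans _ (cj j)).
have h4 := ler_wpM2l c0 xt; have h5 := ler_wpM2l (ltW (a0 j)) (qu j).
have h6 : j%:R <= a j * c j.
  rewrite (le_trans _ (ler_wpM2l (ltW (a0 j)) (cj j)))// mulrCA /a exprVn.
  by rewrite mulVf ?mulr1.
move: (a j) (c j) h1 h2 h3 h4 h5 h6 => aj cj' h1 h2 h3 h4 h5 h6.
nra.
Qed.

End UniformBoundedness.

(** * The calculus, resolvents and the one-step scheme *)

Section Calculus.
Variables (R : realType) (X : completeNormedModType R[i]).
Variables (T : R -> {linear X -> X}) (M : R).
Hypothesis HT : C0_semigroup T.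
Hypothesis M0 : 0 <= M.
Hypothesis TM : forall (t : R) (x : X), 0 <= t -> rnorm (T t x) <= M * rnorm x.
Implicit Types (mu nu : cmeasure R) (x y : X).

Lemma hpE nu x : hp T nu x = (hpm T (cm1 nu) x - hpm T (cm2 nu) x)
  + (0 +i* 1) *: (hpm T (cm3 nu) x - hpm T (cm4 nu) x).
Proof. by []. Qed.

Lemma hp_linear nu : linear (hp T nu).
Proof.
move=> c x y; rewrite !hpE !(hpm_lin HT M0 TM).
have sub_lin (a1 a2 b1 b2 : X) :
    c *: a1 + b1 - (c *: a2 + b2) = c *: (a1 - a2) + (b1 - b2).
  by rewrite opprD addrACA scalerBr.
by rewrite !sub_lin !scalerDr !scalerA [c * _]mulrC addrACA.
Qed.

Lemma hp_bounded nu : exists2 C : R, 0 <= C & forall x, rnorm (hp T nu x) <= C * rnorm x.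
Proof.
pose c m := M * rmeas m (@halfline R).
have c0 m : 0 <= c m by rewrite mulr_ge0// rmeas_ge0.
exists ((c (cm1 nu) + c (cm2 nu)) + (c (cm3 nu) + c (cm4 nu))); first by rewrite !addr_ge0.
have n1 : normc (0 +i* 1 : R[i]) = 1 by rewrite /= expr0n add0r expr1n sqrtr1.
have b m x : rnorm (hpm T m x) <= c m * rnorm x := hpm_norm_le HT M0 TM m x.
move=> x; rewrite hpE (le_trans (rnormD _ _))// rnormZ n1 mul1r !mulrDl.
by rewrite lerD// (le_trans (rnormB _ _))// lerD.
Qed.

Lemma hp_comm_op mu (L : {linear X -> X}) (C : R) x : 0 <= C ->
  (forall x, rnorm (L x) <= C * rnorm x) ->
  (forall (s : R) x, 0 <= s -> T s (L x) = L (T s x)) ->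
  hp T mu (L x) = L (hp T mu x).
Proof.
move=> C0 LC LT; rewrite !hpE !(hpm_comm HT M0 TM _ x C0 LC LT).
by rewrite [RHS]linearD [X in _ = _ + X]linearZ -!(linearB L).
Qed.

(** Shows that (e f)(A) maps into ran(f(A)): if u = (e f)(A) x then
    e(A) u = (e f)(A) (e(A) x). *)
Lemma hp_comm mu nu x : hp T mu (hp T nu x) = hp T nu (hp T mu x).
Proof.
pose L : {linear X -> X} := HB.pack (hp T nu) (GRing.isLinear.Build _ _ _ _ _ (hp_linear nu)).
have [C C0 LC] := hp_bounded nu.
apply: (@hp_comm_op mu L C x C0 LC) => s {}x s0.
rewrite -[L x]/(hp T nu x) -[L _]/(hp T nu (T s x)) !hpE !(hpm_semigroup HT M0 TM)//.
by rewrite [LHS]linearD [X in _ + X]linearZ -!(linearB (T s)).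
Qed.

Variable A : set (X * X).
Hypothesis genA : op_scale (-1) A = generator T.

Lemma generatorP x y : A (x, y) <-> generator T (x, - y).
Proof.
rewrite -genA; split=> [Axy|[z /= Axz /eqP]]; first by exists y; rewrite ?scaleN1r.
by rewrite scaleN1r eqr_opp => /eqP ->.
Qed.

(** For one step the rational part is (1 + t A)^-1, that is lam (lam + A)^-1 with
    lam = 1 / t. *)
Lemma Delta1E (t : R) (t0 : 0 < t) (s0 : 0 < t^-1) x :
  Delta T A 1 t x = hpm T (expm s0) x - T t x.
Proof.
set E := hpm _ _ x; congr (_ - _); rewrite /op_app divr1.
have inv_resolvent y : op_pow (op_inv (op_add op_id (op_scale t%:C A))) 1 (x, y) <-> y = E.
  split.
    case=> z; rewrite /op_id/op_graph/= => -> [u [v []]]; rewrite /op_graph/= => -> [w /= /generatorP gw ->] xE.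
    have := hpm_exp_generator HT M0 TM s0 gw; rewrite opprK => e1.
    apply: (scalerI (_ : (t^-1)%:C != 0)); first by rewrite (inj_eq (@complexI R) _ 0) gt_eqF.
    rewrite -e1 /E.
    have := hpm_lin HT M0 TM (expm s0) (t^-1)%:C x 0.
    rewrite !addr0 (hpm0 HT M0 TM) addr0 => <-.
    by rewrite xE scalerDr scalerA -rmorphM mulVf ?gt_eqF// scale1r.
  move=> ->; exists x => //; exists E, (t%:C *: (t^-1%:C *: (x - E))); split=> //=.
    exists (t^-1%:C *: (x - E)) => //; apply/generatorP.
    rewrite -scalerN opprB; exact: (@generator_hpm_exp _ _ _ _ HT M0 TM _ s0 x).
  by rewrite scalerA -rmorphM divff ?gt_eqF// scale1r addrC subrK.
apply: xget_unique; first exact/inv_resolvent.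
by move=> y /inv_resolvent.
Qed.

Hypothesis ranA : closure (op_ran A) = setT.

Lemma resolvent_fixed (lam : R) (lam0 : 0 < lam) x : generator T (x, 0) ->
  hpm T (expm lam0) x = x.
Proof.
move=> g0; have := hpm_exp_generator HT M0 TM lam0 g0; rewrite subr0 => e1.
have l0 : lam%:C != 0 by rewrite (inj_eq (@complexI R) _ 0) gt_eqF.
apply: (scalerI l0); rewrite -[in RHS]e1.
have := hpm_lin HT M0 TM (expm lam0) lam%:C x 0.
by rewrite !addr0 (hpm0 HT M0 TM) addr0 => ->.
Qed.

(** lam (lam + A)^-1 fixes the kernel of A and tends to 0 on ran(A) as lam -> 0,
    hence everywhere, as the range is dense and these operators are bounded. *)
Lemma generator_ker x : generator T (x, 0) -> x = 0.
Proof.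
move=> g0; apply: rnorm0_eq0; apply/eqP; rewrite eq_le rnorm_ge0 andbT.
apply/ler_addgt0Pl => e e0; rewrite addr0.
have e1 : 0 < e / (2 * (M + 1)) by rewrite divr_gt0// mulr_gt0// ltr_wpDl.
have : closure (op_ran A) x by rewrite ranA.
have xn : nbhs x [set w | rnorm (x - w) < e / (2 * (M + 1))].
  apply/nbhs_normP; exists (e / (2 * (M + 1)))%:C; first by rewrite /= ltcR.
  by move=> w /=; rewrite norm_rnorm ltcR.
move=> /(_ _ xn)[w [[u /generatorP gu] /= xw]].
have n0 := rnorm_ge0 u.
have [lam lam0 lamE] : exists2 lam : R, 0 < lam & lam * ((M + 1) * (rnorm u + 1)) = e / 2.
  have p0 : 0 < (M + 1) * (rnorm u + 1) by rewrite mulr_gt0// ltr_wpDl.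
  by exists (e / 2 / ((M + 1) * (rnorm u + 1))); rewrite ?divr_gt0// divfK// gt_eqF.
have E_le z : rnorm (hpm T (expm lam0) z) <= M * rnorm z.
  rewrite (le_trans (hpm_norm_le HT M0 TM (expm lam0) z))// ler_wpM2r ?rnorm_ge0//.
  by rewrite ler_piMr// expm_halfline.
have e2 := hpm_exp_generator HT M0 TM lam0 gu.
rewrite opprK (hpm_lin HT M0 TM) in e2.
have Ew : rnorm (hpm T (expm lam0) w) <= lam * (M + 1) * rnorm u.
  have -> : hpm T (expm lam0) w = lam%:C *: u - lam%:C *: hpm T (expm lam0) u.
    by rewrite -e2 [X in X - _]addrC addrK.
  rewrite -scalerBr rnormZr gtr0_norm// -mulrA ler_wpM2l ?(ltW lam0)//.
  by rewrite (le_trans (rnormB _ _))//; have := E_le u; lra.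
have ex := resolvent_fixed lam0 g0.
have Ed := hpm_lin HT M0 TM (expm lam0) 1 (x - w) w.
rewrite !scale1r subrK ex in Ed.
rewrite Ed (le_trans (rnormD _ _))//.
have h1 := E_le (x - w).
have h2 : M * rnorm (x - w) <= e / 2.
  have : (M + 1) * rnorm (x - w) <= e / 2.
    by rewrite mulrC -ler_pdivlMr ?ltr_wpDl// (le_trans (ltW xw))// invfM mulrA.
  have := rnorm_ge0 (x - w); lra.
have h3 : lam * (M + 1) * rnorm u <= e / 2.
  by rewrite -lamE -mulrA ler_wpM2l ?(ltW lam0)// ler_wpM2l ?addr_ge0// lerDl.
by rewrite (splitr e) lerD// ?(le_trans h1)// (le_trans Ew).
Qed.

(** The operator is (1 - R1) (1 - 2 R2) with R1 = (1 + A)^-1 and R2 = (2 + A)^-1,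
    by the resolvent identity R1 - R2 = R1 R2; and a fixed point of R1 or of 2 R2
    is annihilated by A. *)
Lemma regularizer_injective (a1 : 0 < (1 : R)) (a2 : 0 < (2 : R)) x :
  x + hpm T (expm a1) x - 2%:C *: hpm T (expm a2) x = 0 -> x = 0.
Proof.
have hs := @generator_hpm_exp _ _ _ _ HT M0 TM.
have hg := fun x y => @hpm_exp_generator _ _ _ _ HT M0 TM _ a1 x y.
have := fun y => hs _ a1 y; have := hs _ a2 x.
move: hg (hpm_lin HT M0 TM (expm a1)).
move: (hpm T (expm a1)) (hpm T (expm a2)) => E1 E2 E1_gen E1_lin g2 g1 h.
pose y := (2^-1)%:C *: E2 x; pose v := x - E2 x.
have gy : generator T (y, - v).
  have := @generator_lin _ _ T (2^-1)%:C _ 0 _ 0 g2.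
  rewrite !addr0 scalerA -rmorphM mulVf// scale1r opprB; apply.
  have := hs _ a2 0.
  by rewrite (hpm0 HT M0 TM) subrr scaler0.
have two z : 2%:C *: z = z + z :> X by rewrite rmorph_nat scaler_nat mulr2n.
have E1y : E1 x = y + E1 y.
  have := E1_gen _ _ gy; rewrite rmorph1 scale1r opprK.
  move=> {1}<-; rewrite addrC -[E1 y]scale1r -E1_lin scale1r addrA; congr E1.
  have -> : y + y = E2 x by rewrite -two scalerA -rmorphM divff// scale1r.
  by rewrite addrC subrK.
have E1v : E1 v = v.
  have -> : E1 v = E1 x - 2%:C *: E1 y.
    rewrite addrC -scaleNr -E1_lin; congr E1.
    by rewrite scaleNr scalerA -rmorphM divff// scale1r addrC.
  have E1yE : E1 y = E1 x - y by rewrite E1y addrC addKr.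
  rewrite E1yE scalerBr scalerA -rmorphM divff// scale1r opprB.
  have E1x : E1 x = 2%:C *: E2 x - x.
    by apply/eqP; rewrite -subr_eq0 opprB addrA [E1 x + x]addrC h.
  rewrite [2%:C *: E1 x]two opprD addrC -!addrA addNr addr0.
  by rewrite E1x two opprB opprD addrC -!addrA addNr addr0.
have v0 : v = 0.
  apply: generator_ker.
  by have := g1 v; rewrite E1v subrr scaler0.
apply: generator_ker; move: g2.
have -> : E2 x = x by apply/eqP; rewrite eq_sym -subr_eq0 -/v v0.
by rewrite subrr scaler0.
Qed.

End Calculus.

(** * The calculus on approximate eigenvectors *)

Section OrbitGrowth.
Variables (R : realType) (X : completeNormedModType R[i]).
Variables (T : R -> {linear X -> X}) (M : R).
Hypothesis HT : C0_semigroup T.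
Hypothesis M0 : 0 <= M.
Hypothesis TM : forall (t : R) (x : X), 0 <= t -> rnorm (T t x) <= M * rnorm x.

(** The interval [0, t] is cut into steps of length h; each contributes
    T (k h) (T h x - x), where (T h x - x) / h is close to the derivative g. *)
Lemma orbit_growth x g (t : R) : generator T (x, g) -> 0 <= t ->
  rnorm (T t x - x) <= M * t * rnorm g.
Proof.
move=> Hg t0.
have steps (h : R) (p : nat) : 0 <= h ->
    rnorm (T (p%:R * h) x - x) <= p%:R * (M * rnorm (T h x - x)).
  move=> h0; elim: p => [|p IH]; first by rewrite !mul0r (C0_zero HT) subrr rnorm0.
  have ph0 : 0 <= p%:R * h by rewrite mulr_ge0.
  have -> : T (p.+1%:R * h) x - x = T (p%:R * h) (T h x - x) + (T (p%:R * h) x - x).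
    by rewrite -natr1 mulrDl mul1r (C0_add HT)// (linearB (T _)) addrA subrK.
  rewrite (le_trans (rnormD _ _))// -natr1 mulrDl mul1r addrC lerD//.
  exact: TM.
move: t0; rewrite le_eqVlt => /predU1P[<-|t0].
  by rewrite (C0_zero HT) subrr rnorm0 mulr0 mul0r.
apply/ler_addgt0Pl => e e0.
have Mt0 : 0 <= M * t by rewrite mulr_ge0// ltW.
have e1 : 0 < e / (M * t + 1) by rewrite divr_gt0// ltr_wpDl.
move/cvg_rnorm/cvgrPdist_lt : Hg => /(_ _ e1)[d /= d0 Hd].
pose p := (Num.truncn (t / d)).+1; pose h := t / p%:R.
have p0 : 0 < p%:R :> R by rewrite ltr0n.
have h0 : 0 < h by rewrite divr_gt0.
have hd : h < d.
  by rewrite /h ltr_pdivrMr// mulrC -ltr_pdivrMr// truncnS_gt.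
have := Hd h; rewrite /= !sub0r !normrN gtr0_norm// => /(_ hd h0).
rewrite ger0_norm ?rnorm_ge0// => hg.
have ph : p%:R * h = t by rewrite /h mulrCA divff ?mulr1// gt_eqF.
have := steps h p (ltW h0); rewrite ph => /le_trans; apply.
have -> : T h x - x = h%:C *: ((h^-1)%:C *: (T h x - x)).
  by rewrite scalerA -rmorphM divff ?gt_eqF// scale1r.
rewrite rnormZr gtr0_norm// [M * (h * _)]mulrCA [p%:R * _]mulrA ph mulrA [t * M]mulrC [leRHS]addrC.
have h1 : rnorm ((h^-1)%:C *: (T h x - x)) <= rnorm g + e / (M * t + 1).
  rewrite -[X in rnorm X](subrK g) (le_trans (rnormD _ _))// addrC lerD2l ltW//.
rewrite (le_trans (ler_wpM2l Mt0 h1))// mulrDr lerD2l.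
by rewrite mulrC div_succ_mul_le// ltW.
Qed.

End OrbitGrowth.

Section ApproximateEigenvectors.
Variables (R : realType) (X : completeNormedModType R[i]).
Variables (T : R -> {linear X -> X}) (M : R).
Hypothesis HT : C0_semigroup T.
Hypothesis M0 : 0 <= M.
Hypothesis TM : forall (t : R) (x : X), 0 <= t -> rnorm (T t x) <= M * rnorm x.
Variable z : R[i].
Hypothesis z0 : complex.Re z = 0.
Let zle0 : complex.Re z <= 0. Proof. by rewrite z0. Qed.
Let zge0 : 0 <= complex.Re z. Proof. by rewrite z0. Qed.

(** [orbit_growth] for the semigroup of A - z. *)
Lemma approx_eigen_semigroup x y (t : R) : generator T (x, y) -> 0 <= t ->
  rnorm (T t x - ez z t *: x) <= M * t * rnorm (z *: x + y).
Proof.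
move=> Hg t0.
have HS := twist_C0 z HT.
have SM := twist_le zle0 TM.
have Hg' : generator (twist z T) (x, z *: x + y).
  by apply/(generator_twistP z _ _ HT); rewrite addrAC subrr add0r.
have := orbit_growth HS M0 SM Hg' t0; apply: le_trans.
have n1 : normc (ez z t) = 1.
  by rewrite /ez normc_cexp; case: (z) z0 => a b /= ->; rewrite mulr0 mul0r subr0 oppr0 expR0.
have -> : T t x - ez z t *: x = ez z t *: (twist z T t x - x).
  rewrite scalerBr twistE scalerA /ez -cexpD addNr cexp0 scale1r//.
by rewrite rnormZ n1 mul1r.
Qed.

(** The estimate for the semigroup is uniform only on bounded time intervals, so a
    tail of small measure is cut off first; the quality d depends on it. *)
Lemma approx_eigen_hpm m (e : R) : 0 < e -> exists2 d : R, 0 < d &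
  forall x y, generator T (x, y) -> rnorm x = 1 -> rnorm (z *: x + y) <= d ->
  rnorm (hpm T m x - lap m z *: x) <= e.
Proof.
move=> e0.
pose K := M + 1; have K0 : 0 < K by rewrite ltr_wpDl.
have e1 : 0 < e / 2 / K by rewrite !divr_gt0.
have [p _ Hp] := (cvgrPdist_lt _ _).1 (rmeas_tail_cvg m ltr01) _ e1.
have := Hp p (leqnn p); rewrite /= sub0r normrN ger0_norm ?rmeas_ge0// mulr1.
set r : R := p.+1%:R => tail.
have r0 : 0 <= r by [].
pose w := e / 2 / (rmeas m (@halfline R) + 1).
have w0 : 0 < w by rewrite !divr_gt0// ltr_wpDl// rmeas_ge0.
have Mr : 0 <= M * r by rewrite mulr_ge0.
exists (w / (M * r + 1)); first by rewrite divr_gt0// ltr_wpDl.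
move=> x y Hg x1 xy.
have b1 := orbit_buc HT M0 TM x.
have b2 := buc_scalar x (buc_ez zge0).
have := buc_lin (-1) b2 b1.
have -> : normc (-1 : R[i]) * (1 * rnorm x) + M * rnorm x = K.
  by rewrite normcN normc1 x1 !mulr1 addrC.
move=> b3.
have -> : hpm T m x - lap m z *: x = bochner (fun s => (-1) *: (ez z s *: x) + T s x) m.
  rewrite (bochner_lin m (-1) b2 b1) (bochner_scalar m x (buc_ez zge0)).
  by rewrite scaleN1r addrC.
have le_w (s : R) : 0 <= s -> s < r -> rnorm ((-1) *: (ez z s *: x) + T s x) <= w.
  move=> s0 sr; rewrite scaleN1r addrC (le_trans (approx_eigen_semigroup Hg s0))//.
  rewrite (@le_trans _ _ (M * r * (w / (M * r + 1))))//.
    by apply: ler_pM; rewrite ?mulr_ge0 ?rnorm_ge0// ler_wpM2l// ltW.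
  by rewrite mulrC div_succ_mul_le// ltW.
rewrite (le_trans (bochner_norm_le m b3 r0 (ltW w0) le_w))// [leRHS]splitr lerD//.
  by rewrite div_succ_mul_le ?rmeas_ge0// divr_ge0// ltW.
by rewrite mulrC -ler_pdivlMr// ltW.
Qed.

Lemma approx_eigen_hp nu (e : R) : 0 < e -> exists2 d : R, 0 < d &
  forall x y, generator T (x, y) -> rnorm x = 1 -> rnorm (z *: x + y) <= d ->
  rnorm (hp T nu x - laplace nu z *: x) <= e.
Proof.
move=> e0; have e4 : 0 < e / 4 by rewrite divr_gt0.
have [d1 d10 H1] := approx_eigen_hpm (cm1 nu) e4.
have [d2 d20 H2] := approx_eigen_hpm (cm2 nu) e4.
have [d3 d30 H3] := approx_eigen_hpm (cm3 nu) e4.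
have [d4 d40 H4] := approx_eigen_hpm (cm4 nu) e4.
exists (Num.min (Num.min d1 d2) (Num.min d3 d4)); first by rewrite !lt_min d10 d20 d30.
move=> x y Hg x1; rewrite !le_min => /andP[/andP[l1 l2] /andP[l3 l4]].
have {H1} := H1 x y Hg x1 l1; have {H2} := H2 x y Hg x1 l2.
have {H3} := H3 x y Hg x1 l3; have {H4} := H4 x y Hg x1 l4.
rewrite hpE (_ : laplace nu z = (lap (cm1 nu) z - lap (cm2 nu) z)
  + (0 +i* 1) * (lap (cm3 nu) z - lap (cm4 nu) z))//.
set c1 := lap (cm1 nu) z; set c2 := lap (cm2 nu) z.
set c3 := lap (cm3 nu) z; set c4 := lap (cm4 nu) z.
move: (hpm T _ x) (hpm T _ x) (hpm T _ x) (hpm T _ x) => v1 v2 v3 v4 h4 h3 h2 h1.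
have -> : v1 - v2 + (0 +i* 1) *: (v3 - v4) - (c1 - c2 + (0 +i* 1) * (c3 - c4)) *: x =
   ((v1 - c1 *: x) - (v2 - c2 *: x)) + (0 +i* 1) *: ((v3 - c3 *: x) - (v4 - c4 *: x)).
  have sub2 (a b : X) c d : a - b - (c - d) *: x = (a - c *: x) - (b - d *: x).
    by rewrite scalerBl !opprB addrACA [RHS]addrACA [- b + _]addrC.
  by rewrite scalerDl opprD addrACA sub2 -scalerA -scalerBr sub2.
have n1 : normc (0 +i* 1 : R[i]) = 1 by rewrite /= expr0n add0r expr1n sqrtr1.
rewrite (le_trans (rnormD _ _))// rnormZ n1 mul1r.
have := rnormB (v1 - c1 *: x) (v2 - c2 *: x).
have := rnormB (v3 - c3 *: x) (v4 - c4 *: x).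
move: h1 h2 h3 h4; move: (rnorm (v1 - _)) (rnorm (v2 - _)) (rnorm (v3 - _)) (rnorm (v4 - _)).
move: (rnorm _) (rnorm _) => a1 a2 a3 a4 a5 a6; lra.
Qed.

End ApproximateEigenvectors.

(** * Regularizer and lower bound *)

Section Regularizer.
Variables (R : realType) (X : completeNormedModType R[i]).
Local Notation borelR := (measurableTypeR R).
Variables (T : R -> {linear X -> X}) (M : R).
Hypothesis HT : C0_semigroup T.
Hypothesis M0 : 0 <= M.
Hypothesis TM : forall (t : R) (x : X), 0 <= t -> rnorm (T t x) <= M * rnorm x.

Lemma hpm_dirac x : hpm T (dirac (0 : borelR)) x = x.
Proof.
have z0 : 0 <= complex.Re (0 : R[i]) by [].
have b1 := orbit_buc HT M0 TM x.
have b2 := buc_scalar x (buc_ez z0).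
have b3 := buc_lin (-1) b2 b1.
apply/eqP; rewrite -subr_eq0; apply/eqP.
have -> : hpm T (dirac (0 : borelR)) x - x =
    bochner (fun s => (-1) *: (ez 0 s *: x) + T s x) (dirac (0 : borelR)).
  rewrite (bochner_lin _ (-1) b2 b1) (bochner_scalar _ x (buc_ez z0)).
  by rewrite -/(lap _ _) (lap_dirac z0) !scale1r scaleN1r addrC.
apply: rnorm0_eq0; apply/eqP; rewrite eq_le rnorm_ge0 andbT.
apply/ler_addgt0Pl => e e0; rewrite addr0.
have [d d0 Hd] := orbit_near0 HT x e0.
have le_e (s : R) : 0 <= s -> s < d -> rnorm ((-1) *: (ez 0 s *: x) + T s x) <= e.
  move=> s0 sd; rewrite /ez mulr0 oppr0 cexp0 scale1r scaleN1r addrC; exact: Hd.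
rewrite (le_trans (bochner_norm_le _ b3 (ltW d0) (ltW e0) le_e))//.
have d1 B : rmeas (dirac (0 : borelR)) B = (0 \in B)%:R by rewrite -[RHS]/(fine (\1_B (0 : borelR))%:E).
have n1 : (0 : borelR) \in (@halfline R) = true by apply/idP; rewrite inE halflineE.
have n2 : (0 : borelR) \in `[d, +oo[%classic = false.
  by apply/negbTE; rewrite notin_setE/= in_itv/= andbT; apply/negP; rewrite -ltNge.
by rewrite !d1 n1 n2 mulr0 addr0 mulr1.
Qed.

Variable A : set (X * X).
Hypothesis genA : op_scale (-1) A = generator T.
Hypothesis ranA : closure (op_ran A) = setT.

(** z^2 / ((1 + z) (2 + z)) = 1 + 1 / (1 + z) - 2 (2 / (2 + z)) is the transform of
    a combination of the Dirac mass at 0 and two exponential distributions.  The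
    two factors z / (1 + z) and z / (2 + z) are distinct in order that the resolvent
    identity replaces a product of measures. *)
Lemma regularizer_exists (x0 : X) : x0 != 0 -> exists mu : cmeasure R,
  (forall z, 0 <= complex.Re z -> z != 0 -> laplace mu z = (z / (1 + z)) * (z / (2%:C + z))) /\
  injective (hp T mu).
Proof.
move=> x00.
have a1 := @ltr01 R; have a2 := @ltr0Sn R 1.
have [m1 m1E] := measure_lin (dirac (0 : borelR)) (expm a1) 1%:nng.
have [m2 m2E] := measure_lin (expm a2) (expm a2) 1%:nng.
exists (CMeasure m1 m2 m2 m2); split.
  move=> z z0 zn0.
  rewrite (_ : laplace _ z = (lap m1 z - lap m2 z) + (0 +i* 1) * (lap m2 z - lap m2 z))//.
  rewrite subrr mulr0 addr0 (lap_measure_lin m1E z0) (lap_measure_lin m2E z0).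
  rewrite (lap_dirac z0) !(lap_expm _ x00 z0) rmorph1.
  have z1 : 1 + z != 0 by have := half_plane_add_neq0 a1 z0; rewrite rmorph1.
  have := half_plane_add_neq0 a2 z0; rewrite rmorph_nat => z2.
  by field; rewrite z1 z2.
have hE x : hp T (CMeasure m1 m2 m2 m2) x = x + hpm T (expm a1) x - 2%:C *: hpm T (expm a2) x.
  have bx := orbit_buc HT M0 TM x.
  have m1E' B : measurable B -> rmeas m1 B =
      1 * rmeas (dirac (0 : borelR)) B + 1 * rmeas (expm a1) B.
    by move=> mA; rewrite m1E// [X in _ = _ + X]mul1r.
  have m2E' B : measurable B -> rmeas m2 B = 1 * rmeas (expm a2) B + 1 * rmeas (expm a2) B.
    by move=> mA; rewrite m2E// [X in _ = _ + X]mul1r.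
  have h1 : hpm T m1 x = x + hpm T (expm a1) x.
    have := bochner_measure_lin bx m1E'.
    by rewrite -!/(hpm T _ x) hpm_dirac !scale1r.
  have h2 : hpm T m2 x = 2%:C *: hpm T (expm a2) x.
    have := bochner_measure_lin bx m2E'.
    have two (v : X) : 2%:C *: v = v + v by rewrite rmorph_nat scaler_nat mulr2n.
    by rewrite -!/(hpm T _ x) !scale1r two.
  by rewrite -h1 -h2 hpE [cm3 _]/= [cm4 _]/= subrr scaler0 addr0.
move=> x y; rewrite !hE => e1; apply/eqP; rewrite -subr_eq0; apply/eqP.
apply: (regularizer_injective HT M0 TM genA ranA (a1 := a1) (a2 := a2)).
have lin m u v : hpm T m (u - v) = hpm T m u - hpm T m v := hpmB HT M0 TM m u v.
rewrite !lin scalerBr.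
move: e1; move: (hpm T (expm a1) x) (hpm T (expm a1) y) (hpm T (expm a2) x) (hpm T (expm a2) y) => u1 v1 u2 v2 e1.
have -> : x - y + (u1 - v1) - (2%:C *: u2 - 2%:C *: v2) =
    (x + u1 - 2%:C *: u2) - (y + v1 - 2%:C *: v2).
  by rewrite addrACA -opprD !opprB addrACA [RHS]addrACA [- (y + v1) + _]addrC.
by rewrite e1 subrr.
Qed.

End Regularizer.

Section DeltaLowerBound.
Variables (R : realType) (X : completeNormedModType R[i]).
Variables (T : R -> {linear X -> X}) (A : set (X * X)) (M : R).
Hypothesis HT : C0_semigroup T.
Hypothesis M0 : 0 <= M.
Hypothesis TM : forall (t : R) (x : X), 0 <= t -> rnorm (T t x) <= M * rnorm x.
Hypothesis genA : op_scale (-1) A = generator T.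

(** The modulus is 1 / sqrt 2. *)
Lemma imag_resolvent_le (s : R) : s != 0 ->
  normc (`|s|%:C / (`|s|%:C + (0 +i* s))) <= 3 / 4.
Proof.
move=> s0; have a0 : 0 < `|s| by rewrite normr_gt0.
rewrite normcM normcV normc_real normr_id.
have b : 4 / 3 * `|s| <= normc (`|s|%:C + (0 +i* s)).
  rewrite /= addr0 add0r -[leLHS]ger0_norm ?mulr_ge0// -sqrtr_sqr ler_sqrt; last first.
    by rewrite addr_ge0// sqr_ge0.
  have : `|s| ^+ 2 = s ^+ 2 by rewrite real_normK// num_real.
  rewrite exprMn => ->; have := sqr_ge0 s; lra.
rewrite ler_pdivrMr; last by rewrite (lt_le_trans _ b)// mulr_gt0.
lra.
Qed.

Lemma Delta_bounded (t : R) x : 0 < t -> rnorm (Delta T A 1 t x) <= 2 * M * rnorm x.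
Proof.
move=> t0; have s0 : 0 < t^-1 by rewrite invr_gt0.
rewrite (Delta1E HT M0 TM genA t0 s0) (le_trans (rnormB _ _))//.
have h1 := TM x (ltW t0); have h2 := hpm_norm_le HT M0 TM (expm s0) x.
have : M * rmeas (expm s0) (@halfline R) * rnorm x <= M * rnorm x.
  by rewrite ler_wpM2r ?rnorm_ge0// ler_piMr// expm_halfline.
lra.
Qed.

Lemma Delta_lin (t : R) c x y : 0 < t ->
  Delta T A 1 t (c *: x + y) = c *: Delta T A 1 t x + Delta T A 1 t y.
Proof.
move=> t0; have s0 : 0 < t^-1 by rewrite invr_gt0.
rewrite !(Delta1E HT M0 TM genA t0 s0) (hpm_lin HT M0 TM).
by rewrite (linearP (T t)) opprD addrACA scalerBr.
Qed.

(** On an approximate eigenvector u, with G the symbol of B at i s, B u is close to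
    G u and Delta u is close to delta u, where
    |delta| >= 1 - 3 / 4.  The errors 1 / 16 + 1 / 16 leave ||Delta u|| >= 1 / 8, and
    the error in B u costs at most |G| / 16. *)
Lemma Delta_spectral_ge nu (s : R) : s != 0 -> spectrum A (0 +i* s) ->
  0 < normc (laplace nu (0 +i* s)) -> exists u, rnorm u = 1 /\
  normc (laplace nu (0 +i* s)) / 16 <= rnorm (Delta T A 1 `|s|^-1 (hp T nu u)).
Proof.
move=> s0 specs; set z : R[i] := 0 +i* s; set G := laplace nu z; set g := normc G => g0.
have zr : complex.Re z = 0 by [].
have z0 : 0 <= complex.Re z by [].
have a0 : 0 < `|s| by rewrite normr_gt0.
set t := `|s|^-1; have t0 : 0 < t by rewrite invr_gt0.
have l0 : 0 < t^-1 by rewrite invr_gt0.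
have e16 : 0 < (16^-1 : R) by [].
have e1 : 0 < g / (32 * (M + 1)) by rewrite divr_gt0// mulr_gt0// ltr_wpDl.
have [d1 d10 H1] := approx_eigen_hp HT M0 TM zr nu e1.
have [d2 d20 H2] := approx_eigen_hpm HT M0 TM zr (expm l0) e16.
have Mt0 : 0 <= M * t by rewrite mulr_ge0// ltW.
have d30 : 0 < 16^-1 / (M * t + 1) by rewrite divr_gt0// ltr_wpDl.
set d3 := 16^-1 / (M * t + 1) in d30.
have d0 : 0 < Num.min d1 (Num.min d2 d3) by rewrite !lt_min d10 d20.
have [u [y [Hg u1 uy]]] := approximate_eigenvector HT M0 TM genA d0 specs.
move: uy; rewrite !le_min => /and3P[uy1 uy2 uy3].
have u0 : u != 0 by apply/eqP => u0; move: u1; rewrite u0 rnorm0 => /esym/eqP; rewrite oner_eq0.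
have h1 := H1 u y Hg u1 uy1; have h2 := H2 u y Hg u1 uy2.
have h3 : rnorm (T t u - ez z t *: u) <= 16^-1.
  rewrite (le_trans (approx_eigen_semigroup HT M0 TM zr Hg (ltW t0)))//.
  rewrite (le_trans (ler_wpM2l Mt0 uy3))// mulrC div_succ_mul_le// ltW//.
exists u; split=> //.
pose D := Delta T A 1 t.
have DE v : D v = hpm T (expm l0) v - T t v := Delta1E HT M0 TM genA t0 l0 v.
have Du : 8^-1 <= rnorm (D u).
  have n1 : normc (ez z t) = 1 by rewrite /ez normc_cexp/= mulr0 mul0r subr0 oppr0 expR0.
  have n2 : normc (lap (expm l0) z) <= 3 / 4.
    by rewrite (lap_expm l0 u0 z0) invrK imag_resolvent_le.
  have n3 : rnorm (lap (expm l0) z *: u) <= 3 / 4 by rewrite rnormZ u1 mulr1.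
  have n4 : rnorm (ez z t *: u) = 1 by rewrite rnormZ u1 n1 mulr1.
  have bE : ez z t *: u = (lap (expm l0) z *: u - D u)
      + ((hpm T (expm l0) u - lap (expm l0) z *: u) - (T t u - ez z t *: u)).
    rewrite DE; move: (lap _ _ *: u) (ez _ _ *: u) (hpm _ _ u) (T t u) => v1 v2 v3 v4.
    rewrite !opprB addrA [v1 + _]addrC -[_ + (v3 - v1)]addrA [v1 + (v3 - v1)]addrC.
    by rewrite !subrK [v4 + _]addrC subrK.
  have := rnormD (lap (expm l0) z *: u - D u)
    ((hpm T (expm l0) u - lap (expm l0) z *: u) - (T t u - ez z t *: u)).
  rewrite -bE n4; have := rnormB (lap (expm l0) z *: u) (D u).
  have := rnormB (hpm T (expm l0) u - lap (expm l0) z *: u) (T t u - ez z t *: u).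
  move: n3 h2 h3; move: (rnorm (D u)) (rnorm (lap _ _ *: u)) (rnorm (hpm _ _ _ - _)) (rnorm (T t u - _)).
  move: (rnorm _) (rnorm _) => r1 r2 r3 r4 r5 r6; lra.
have DB : D (hp T nu u) = D (hp T nu u - G *: u) + G *: D u.
  rewrite -{1}(subrK (G *: u) (hp T nu u)) addrC.
  by rewrite /D Delta_lin// addrC.
have h4 := Delta_bounded (hp T nu u - G *: u) t0; rewrite -/(D _) in h4.
have h5 : 2 * M * (g / (32 * (M + 1))) <= g / 16.
  have M1 : M + 1 != 0 by rewrite gt_eqF// ltr_wpDl.
  have -> : 2 * M * (g / (32 * (M + 1))) = M / (M + 1) * (g / 16) by field.
  by rewrite ler_piMl ?divr_ge0// ?(ltW g0)// ler_pdivrMr ?mul1r ?lerDl// ltr_wpDl.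
have h6 : 2 * M * rnorm (hp T nu u - G *: u) <= 2 * M * (g / (32 * (M + 1))).
  by rewrite ler_wpM2l// mulr_ge0.
have h7 : g * 8^-1 <= rnorm (G *: D u) by rewrite rnormZ ler_wpM2l// ltW.
have := rnormB (D (hp T nu u)) (D (hp T nu u - G *: u)).
have -> : D (hp T nu u) - D (hp T nu u - G *: u) = G *: D u.
  by rewrite DB addrAC subrr add0r.
move=> h8.
rewrite -/(D _).
move: h4 h5 h6 h7 h8; move: (rnorm (D (hp T nu u))) (rnorm (D (_ - _))) (rnorm (G *: _)) (2 * M * rnorm _) (2 * M * (g / _)).
by move=> r1 r2 r3 r4 r5 h4 h5 h6 h7 h8; lra.
Qed.

End DeltaLowerBound.

(** * The theorem *)

Lemma imag_frac_ge (R : realType) (c s : R) : 0 <= c -> 1 <= `|s| ->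
  (c + 1)^-1 <= normc ((0 +i* s) / (c%:C + (0 +i* s))).
Proof.
move=> c0 s1; have s0 : 0 < `|s| by rewrite (lt_le_trans _ s1).
have ni : normc (0 +i* s) = `|s| by rewrite /= expr0n add0r sqrtr_sqr.
have z0 : 0 < normc (c%:C + (0 +i* s)).
  rewrite (lt_le_trans s0)// (le_trans _ (normr_Im_le _))//= add0r//.
rewrite normcM normcV ni ler_pdivlMr// mulrC ler_pdivrMr ?ltr_wpDl//.
have := @le_normcD R c%:C (0 +i* s); rewrite normc_real ni ger0_norm// => h.
rewrite (le_trans h)// mulrDr mulr1 lerD2r ler_peMl//.
Qed.

(** Collects what the proof of the theorem uses about a product of two Stieltjes
    functions: it extends, it is regularized by z^2 / ((1 + z) (2 + z)), and it is
    not small on the imaginary axis. *)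
Lemma stieltjes2_extension (R : realType) (X : completeNormedModType R[i]) (x0 : X)
  (f : R -> R) : x0 != 0 -> stieltjes2 f -> exists F : R[i] -> R[i],
  [/\ analytic_extension f F,
      exists2 g, transform g & forall z, 0 <= complex.Re z -> z != 0 ->
        g z = (z / (1 + z)) * (z / (2%:C + z)) * F z
    & forall s : R, 1 <= `|s| -> f `|s| <= 4 * normc (F (0 +i* s))].
Proof.
move=> x00 [f1 [f2 [S1 S2 fE]]].
have [al1 [k1 [al10 f1E]]] := stieltjes_finite S1.
have [al2 [k2 [al20 f2E]]] := stieltjes_finite S2.
pose F1 := stieltjes_fun al1 k1; pose F2 := stieltjes_fun al2 k2.
exists (fun z => F1 z * F2 z); split.
- split=> [z zs|z z0].
    apply: (@derivableM R[i] R[i]^o F1 F2).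
      exact: stieltjes_fun_holomorphic.
    exact: stieltjes_fun_holomorphic.
  by rewrite /F1 /F2 !stieltjes_fun_real// -f1E// -f2E// -rmorphM fE.
- have [g1 t1 g1E] := stieltjes_transform x00 al1 k1.
  have [g2 t2 g2E] := stieltjes_transform2 x00 al2 k2.
  exists (fun z => g1 z * g2 z); first exact: transformM.
  by move=> z z0 zn0; rewrite g1E// g2E// mulrACA.
- move=> s s1; have a0 : 0 < `|s| by rewrite (lt_le_trans _ s1).
  have s0 : s != 0 by rewrite -normr_gt0.
  rewrite fE// f1E// f2E//.
  have h1 := @stieltjes_fun_imag_ge R al1 k1 s s0.
  have h2 := @stieltjes_fun_imag_ge R al2 k2 s s0.
  have pos (al : R) (k : {finite_measure set (measurableTypeR R) -> \bar R}) : 0 <= al ->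
      0 <= al + \int[k]_(tau in @halfline R) ((1 + tau) / (`|s| + tau)).
    move=> al0; rewrite addr_ge0//; apply: Rintegral_ge0 => tau; rewrite halflineE => t0.
    by rewrite divr_ge0// addr_ge0.
  have -> : 4 * normc (F1 (0 +i* s) * F2 (0 +i* s)) =
      (2 * normc (F1 (0 +i* s))) * (2 * normc (F2 (0 +i* s))) by rewrite normcM; ring.
  by apply: ler_pM; rewrite ?pos.
Qed.

(** The supremum is infinite for every r, already along n = 1, where
    sqrt n / t = 1 / t. *)
Lemma limsup_sqrt_pinfty (R : realType) (F : nat -> R -> R) :
  (forall r K : R, exists t : R, [/\ 0 < t, r <= t^-1 & K <= F 1%N t]) ->
  limsup_sqrt F +oo%E.
Proof.
move=> h; rewrite /limsup_sqrt.
rewrite (_ : (fun r : R => _) = cst +oo%E); first exact: cvg_cst.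
apply/funext => r; apply/eqyP => K K0.
have [t [t0 rt KF]] := h r K.
rewrite (@le_trans _ _ (F 1%N t)%:E) ?lee_fin//.
apply: ereal_sup_ubound; exists 1%N, t; split=> //.
by rewrite sqrtr1 div1r.
Qed.

Theorem corollary6p6 (R : realType) (X : completeNormedModType R[i])
    (T : R -> {linear X -> X}) (A : set (X * X))
    (HT : C0_semigroup T) (bT : bounded_semigroup T)
    (genA : op_scale (-1) A = generator T)
    (ranA : closure (op_ran A) = setT)
    (specA : forall M : R, exists s : R, M < `|s| /\ spectrum A (0 +i* s))
    (f : R -> R) (Sf : stieltjes2 f)
    (limf : tau ^+ 2 * f tau @[tau --> +oo] --> +oo)
    (eps : R -> R) (eps_gt0 : forall tau, 0 < tau -> 0 < eps tau)
    (eps_decr : forall s t, 0 < s -> s <= t -> eps t <= eps s)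
    (eps_lim : eps tau @[tau --> +oo] --> 0) :
  exists2 y : X, op_ran (stieltjes2_calculus T f) y &
    limsup_sqrt (fun n t => rnorm (Delta T A n t y)
       / (eps (Num.sqrt n%:R / t) * f (Num.sqrt n%:R / t))) +oo%E.
Proof.
have [M M0 TM] : exists2 M : R, 0 <= M &
    forall (t : R) (x : X), 0 <= t -> rnorm (T t x) <= M * rnorm x.
  have [M HM] := bT; exists (Num.max M 0); first by rewrite le_max lexx orbT.
  move=> t x t0; rewrite (le_trans (HM t x t0))// ler_wpM2r ?rnorm_ge0//.
  by rewrite le_max lexx.
have [x0 x00] : exists x : X, x != 0.
  have [s [_ specs]] := specA 0.
  have [x [_ [_ x1 _]]] := approximate_eigenvector HT M0 TM genA ltr01 specs.
  by exists x; apply/eqP => x0; move: x1; rewrite x0 rnorm0 => /esym/eqP; rewrite oner_eq0.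
have [F [ext [g tg gE] F_ge]] := stieltjes2_extension x00 Sf.
have [mu [muE mu_inj]] := regularizer_exists HT M0 TM genA ranA x00.
have [nu nuE] := laplace_transform tg.
have half_neq0 (z : R[i]) : 0 < complex.Re z -> z != 0.
  by move=> z0; apply/eqP => ze; rewrite ze ltxx in z0.
have calc x : op_ran (stieltjes2_calculus T f) (hp T nu x).
  exists (hp T mu x); exists F => //; split=> /=.
    by move=> z z0; apply: ext.1 => -[_]; rewrite leNgt z0.
  exists mu, nu; split=> //; last exact: hp_comm HT M0 TM mu nu x.
  by move=> z z0; rewrite nuE ?(ltW z0)// gE ?(ltW z0) ?half_neq0// muE ?(ltW z0)// half_neq0.
have [r0 r01 f_pos] : exists2 r0 : R, 1 <= r0 & forall tau, r0 < tau -> 0 < f tau.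
  have [a [_ Ha]] := cvgry_ge limf 1.
  exists (Num.max 1 a); first by rewrite le_max lexx.
  move=> tau; rewrite gt_max => /andP[t1 ta].
  have := Ha tau ta; rewrite /= => h; have t0 : 0 < tau ^+ 2 by rewrite exprn_gt0// (lt_trans _ t1).
  by rewrite -(pmulr_rgt0 _ t0) (lt_le_trans _ h).
(* spectral points on the imaginary axis, farther and farther from 0 *)
have /choice[s Hs] : forall k : nat, exists s : R, Num.max r0 k%:R < `|s| /\ spectrum A (0 +i* s).
  by move=> k; exact: specA.
have s_r0 k : r0 < `|s k| by have [+ _] := Hs k; rewrite gt_max => /andP[].
have s_k k : k%:R < `|s k| by have [+ _] := Hs k; rewrite gt_max => /andP[].
have s1 k : 1 < `|s k| by rewrite (le_lt_trans r01).
have s0 k : 0 < `|s k| by rewrite (lt_trans _ (s1 k)).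
have t0 k : 0 < `|s k|^-1 by rewrite invr_gt0.
have fs k : 0 < f `|s k| := f_pos _ (s_r0 k).
have G_ge k : f `|s k| / 24 <= normc (laplace nu (0 +i* s k)).
  have sk0 : s k != 0 by rewrite -normr_gt0.
  have z0 : (0 +i* s k : R[i]) != 0.
    by apply/eqP => -[e0]; rewrite e0 eqxx in sk0.
  rewrite nuE// gE//.
  have h1 := imag_frac_ge (@ler01 R) (ltW (s1 k)).
  have h2 := imag_frac_ge (ler0n R 2) (ltW (s1 k)).
  have h3 := F_ge _ (ltW (s1 k)).
  rewrite normcM normcM.
  (* 6 = (1 + 1) (2 + 1), from |z / (c + z)| >= 1 / (c + 1) for c = 1, 2 *)
  have h4 : 6^-1 <= normc ((0 +i* s k) / (1 + (0 +i* s k))) * normc ((0 +i* s k) / (2%:C + (0 +i* s k))).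
    have -> : (6 : R)^-1 = (1 + 1)^-1 * (2 + 1)^-1 by field.
    by rewrite rmorph1 in h1; apply: ler_pM.
  have -> : f `|s k| / 24 = 6^-1 * (f `|s k| / 4) by field.
  apply: ler_pM => //; first by rewrite divr_ge0// ltW.
  by rewrite ler_pdivrMr// mulrC.
pose w k := eps `|s k| * f `|s k|.
have w0 k : 0 < w k by rewrite mulr_gt0// eps_gt0.
pose q k x := rnorm (Delta T A 1 `|s k|^-1 (hp T nu x)) / w k.
have DB_lin k c x y : Delta T A 1 `|s k|^-1 (hp T nu (c *: x + y)) =
    c *: Delta T A 1 `|s k|^-1 (hp T nu x) + Delta T A 1 `|s k|^-1 (hp T nu y).
  by rewrite (hp_linear HT M0 TM) (Delta_lin HT M0 TM genA).
have DB0 k : Delta T A 1 `|s k|^-1 (hp T nu 0) = 0.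
  by have := DB_lin k (-1) 0 0; rewrite scaleN1r oppr0 addr0 scaleN1r addNr.
have q0 k x : 0 <= q k x by rewrite divr_ge0 ?rnorm_ge0// ltW.
have [x Hx] : exists x, forall K : R, exists k, K < q k x.
  apply: uniform_boundedness.
  - move=> k x y; rewrite /q -mulrDl ler_wpM2r ?invr_ge0 ?(ltW (w0 k))//.
    by rewrite -[x]scale1r DB_lin !scale1r rnormD.
  - move=> k a x; rewrite /q mulrA; congr (_ / _).
    by rewrite -[_ *: x]addr0 DB_lin DB0 addr0 rnormZr.
  - move=> k; have [C C0 HC] := hp_bounded HT M0 TM nu.
    exists (2 * M * C / w k) => x; rewrite mulrAC ler_wpM2r ?invr_ge0 ?(ltW (w0 k))//.
    rewrite (le_trans (Delta_bounded HT M0 TM genA _ (t0 k)))// -(mulrA (2 * M)).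
    by rewrite ler_wpM2l// mulr_ge0.
  - move=> K.
    (* 384 = 24 * 16: 24 from the symbol of B, 16 from the approximate eigenvector *)
    have d0 : 0 < (384 * (`|K| + 1))^-1 by rewrite invr_gt0 mulr_gt0// ltr_wpDl.
    have [a [_ Ha]] := (cvgrPdist_lt _ _).1 eps_lim _ d0.
    pose k := Num.bound a; exists k.
    have ak : a < `|s k| by rewrite (lt_trans _ (s_k k))// unstable.ltr_bound.
    have := Ha _ ak; rewrite /= sub0r normrN gtr0_norm ?eps_gt0// => epsk.
    have g0 : 0 < normc (laplace nu (0 +i* s k)).
      by rewrite (lt_le_trans _ (G_ge k))// divr_gt0.
    have sk0 : s k != 0 by rewrite -normr_gt0.
    have [u [u1 Hu]] := Delta_spectral_ge HT M0 TM genA sk0 (Hs k).2 g0.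
    exists u; rewrite u1; split=> //; rewrite /q ler_pdivlMr//.
    rewrite (le_trans _ Hu)//.
    have h1 : K * w k <= 384^-1 * f `|s k|.
      rewrite /w mulrA ler_wpM2r ?(ltW (fs k))//.
      rewrite (le_trans (ler_wpM2r (ltW (eps_gt0 _ (s0 k))) (_ : K <= `|K| + 1)))//.
        by rewrite (le_trans (ler_norm _))// lerDl.
      rewrite (le_trans (ler_wpM2l _ (ltW epsk)))// ?addr_ge0//.
      by rewrite invfM mulrCA divff ?mulr1// gt_eqF// ltr_wpDl.
    rewrite (le_trans h1)//; have := G_ge k; lra.
exists (hp T nu x); first exact: calc.
apply: limsup_sqrt_pinfty => r K.
(* 1 / t = |s k| > k, so an index beyond N makes 1 / t exceed r *)
pose N := Num.bound r.
(* exceeding K and the first N values forces an index beyond N *)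
have [k Hk] := Hx (`|K| + \sum_(j < N.+1) q j x).
have sum0 : 0 <= \sum_(j < N.+1) q j x by rewrite sumr_ge0.
have Nk : (N < k)%N.
  rewrite ltnNge; apply/negP => kN; move: Hk; apply/negP; rewrite -leNgt.
  have kN' : (k < N.+1)%N by [].
  rewrite (bigD1 (Ordinal kN'))//= addrCA lerDl addr_ge0// sumr_ge0//.
exists `|s k|^-1; split=> //.
  rewrite invrK ltW// (lt_trans _ (s_k k))// (lt_trans (unstable.ltr_bound r))// ltr_nat//.
rewrite sqrtr1 div1r invrK -/(w k) -/(q k x) ltW// (le_lt_trans _ Hk)//.
by rewrite (le_trans (ler_norm _))// lerDl.
Qed.
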